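(* Let $\mathbb K$ be a field and let $\mathcal C$ be a fusion category over $\mathbb K$ with canonical coend $R$. Then $\operatorname{FPdim}(\mathcal C)=\operatorname{FPdim}(R)$. In particular, $\operatorname{FPdim}(\mathcal C)$ is an algebraic integer.
   Context: A finite $\mathbb K$-linear abelian category is separable over $\mathbb K$ if it is equivalent to the category of finite-dimensional modules over a finite-dimensional separable $\mathbb K$-algebra $A$ (i.e. the multiplication $A\otimes A\to A$ splits as a map of $A$-bimodules). A fusion category over $\mathbb K$ is a rigid monoidal category $\mathcal C$ that is separable over $\mathbb K$, whose tensor product is $\mathbb K$-linear in both arguments, and whose unit $\mathbf 1$ is simple. It is not assumed that $\operatorname{End}(\mathbf 1)=\mathbb K$ or that $\mathbb K$ is algebraically closed. The ring $\mathbb E=\operatorname{End}(\mathbf 1)$ is a finite field extension of $\mathbb K$, and each $\operatorname{End}(X)$ is an $\mathbb E$-vector space via the left embedding $\lambda_X(e)=\ell_X\circ(e\otimes\mathrm{id}_X)\circ\ell_X^{-1}$, where $\ell_X:\mathbf 1\otimes X\to X$ is the left unitor. $\mathcal O(\mathcal C)$ is the finite set of isomorphism classes of simple objects. $\mathbb N\mathcal O(\mathcal C)$ is the free commutative monoid on $\mathcal O(\mathcal C)$; every object $X$ has a class $[X]$ with $[X\oplus Y]=[X]+[Y]$, and it is a semiring via $[X][Y]=[X\otimes Y]$. $\operatorname{FPdim}(X)$ is the largest non-negative real eigenvalue of the matrix of left multiplication by $[X]$ in the basis of simple classes. The Frobenius–Perron dimension of $\mathcal C$ is $$\operatorname{FPdim}(\mathcal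 C)=\sum_{X\in\mathcal O(\mathcal C)}\frac{\operatorname{FPdim}(X)^2}{\dim_{\mathbb E}\operatorname{End}(X)}.$$ The canonical coend of $\mathcal C$ is the object $$R:=\int^{V\in\mathcal C}V^*\otimes V\;\cong\;\bigoplus_{X\in\mathcal O(\mathcal C)}\frac{X^*\otimes X}{\big\langle\{\,f^*\otimes\mathrm{id}_X-\mathrm{id}_{X^*}\otimes f\mid f:X\to X\,\}\big\rangle},$$ where the quotient is by the subobject of $X^*\otimes X$ generated by the images of the listed endomorphisms of $X^*\otimes X$. *)

(* Defs.v *)
From Stdlib Require Import ClassicalEpsilon.
From HB Require Import structures.
From mathcomp Require Import all_boot all_order all_algebra all_field.
From mathcomp Require Import boolp.

Set Implicit Arguments.
Unset Strict Implicit.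
Unset Printing Implicit Defensive.

Import Order.TTheory GRing.Theory Num.Theory.

Local Open Scope ring_scope.

Declare Scope cat_scope.
Delimit Scope cat_scope with C.
Local Open Scope cat_scope.

Reserved Notation "g '∘' f" (at level 40, left associativity).
Reserved Notation "X '⊗' Y" (at level 35, right associativity).
Reserved Notation "f '⊗m' g" (at level 35, right associativity).

(** * Linear categories *)

Record linCat (K : fieldType) := LinCat {
  Ob :> Type;
  Hom : Ob -> Ob -> lmodType K;
  idm : forall X, Hom X X;
  comp : forall X Y Z, Hom Y Z -> Hom X Y -> Hom X Z;
  comp_idl : forall X Y (f : Hom X Y), comp (idm Y) f = f;
  comp_idr : forall X Y (f : Hom X Y), comp f (idm X) = f;
  comp_assoc : forall W X Y Z (h : Hom Y Z) (g : Hom X Y) (f : Hom W X),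
    comp h (comp g f) = comp (comp h g) f;
  comp_linl : forall X Y Z (f : Hom X Y), linear (fun g : Hom Y Z => comp g f);
  comp_linr : forall X Y Z (g : Hom Y Z), linear (fun f : Hom X Y => comp g f)
}.

Arguments Hom {K l} X Y.
Arguments idm {K l} X.
Arguments comp {K l X Y Z} g f.
Notation "g '∘' f" := (comp g f) : cat_scope.

Section InLinCat.
Variables (K : fieldType) (C : linCat K).
Implicit Types X Y Z : C.

Definition are_inverse X Y (f : Hom X Y) (g : Hom Y X) : Prop :=
  g ∘ f = idm X /\ f ∘ g = idm Y.

Definition is_iso X Y (f : Hom X Y) : Prop := exists g, are_inverse f g.

Definition isomorphic X Y : Prop := exists f : Hom X Y, is_iso f.

Definition monic X Y (f : Hom X Y) : Prop :=
  forall Z (g h : Hom Z X), f ∘ g = f ∘ h -> g = h.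

Definition is_zero X : Prop := idm X = 0.

Definition simple X : Prop :=
  ~ is_zero X /\
  forall Y (f : Hom Y X), monic f -> is_zero Y \/ is_iso f.

Definition is_direct_sum (J : finType) (F : J -> C) X : Prop :=
  exists (inj : forall j, Hom (F j) X) (proj : forall j, Hom X (F j)),
    [/\ forall j, proj j ∘ inj j = idm (F j),
        forall i j, i != j -> proj i ∘ inj j = 0
      & \sum_j inj j ∘ proj j = idm X].

(** A finite family with exactly one object of each isomorphism class of simple
    objects. *)
Record family_of_objects := FamilyOfObjects {
  fam_size : nat;
  fam : 'I_fam_size -> C
}.

Definition enumerates_simples (S : family_of_objects) : Prop :=
  [/\ forall i, simple (@fam S i),
      forall i j, isomorphic (@fam S i) (@fam S j) -> i = j
    & forall X, simple X -> exists i, isomorphic X (@fam S i)].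

End InLinCat.

(** * Linear functors and equivalences *)

Record linFunctor (K : fieldType) (C D : linCat K) := LinFunctor {
  fob :> C -> D;
  fhom : forall X Y, Hom X Y -> Hom (fob X) (fob Y);
  fhom_lin : forall X Y, linear (@fhom X Y);
  fhom_id : forall X, fhom (idm X) = idm (fob X);
  fhom_comp : forall X Y Z (g : Hom Y Z) (f : Hom X Y),
    fhom (g ∘ f) = fhom g ∘ fhom f
}.

Arguments fhom {K C D} F {X Y} f : rename.

Section Functors.
Variable K : fieldType.

Definition functor_id (C : linCat K) : linFunctor C C.
Proof. by exists id (fun _ _ f => f). Defined.

Definition functor_comp (C D E : linCat K) (G : linFunctor D E)
  (F : linFunctor C D) : linFunctor C E.
Proof.
exists (fun X => G (F X)) (fun X Y f => fhom G (fhom F f)).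
- by move=> X Y a f g; rewrite !fhom_lin.
- by move=> X; rewrite !fhom_id.
- by move=> X Y Z g f; rewrite !fhom_comp.
Defined.

Definition nat_isomorphic (C D : linCat K) (F G : linFunctor C D) : Prop :=
  exists eta : forall X, Hom (F X) (G X),
    (forall X, is_iso (eta X)) /\
    (forall X Y (f : Hom X Y), eta Y ∘ fhom F f = fhom G f ∘ eta X).

Definition equivalent (C D : linCat K) : Prop :=
  exists (F : linFunctor C D) (G : linFunctor D C),
    nat_isomorphic (functor_comp G F) (functor_id C) /\
    nat_isomorphic (functor_comp F G) (functor_id D).

End Functors.

(** * Finite-dimensional modules over a finite-dimensional algebra *)

Record amod (K : fieldType) (A : falgType K) := AMod {
  carrier :> vectType K;
  act : {linear A -> 'End(carrier)};
  act1 : act 1 = \1%VF;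
  actM : forall a b, act (a * b) = (act a \o act b)%VF
}.

Arguments act {K A} M : rename.

Section AMod.
Variables (K : fieldType) (A : falgType K).
Implicit Types M N P : amod A.

Definition amod_linear M N : {pred 'Hom(M, N)} :=
  fun f => `[< forall a, (f \o act M a)%VF = (act N a \o f)%VF >].

Fact amod_linear_submod M N : submod_closed (@amod_linear M N).
Proof.
split; first by apply/asboolP => a; rewrite comp_lfun0l comp_lfun0r.
move=> k f g /asboolP Hf /asboolP Hg; apply/asboolP => a.
by rewrite comp_lfunDl comp_lfunDr -comp_lfunZl -comp_lfunZr Hf Hg.
Qed.

HB.instance Definition _ M N :=
  GRing.isSubmodClosed.Build K 'Hom(M, N) (@amod_linear M N)
    (@amod_linear_submod M N).

Record amod_hom M N := AModHom {
  amod_fun :> 'Hom(M, N);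
  amod_funP : amod_fun \in @amod_linear M N
}.

HB.instance Definition _ M N := [isSub for @amod_fun M N].
HB.instance Definition _ M N := [Choice of amod_hom M N by <:].
HB.instance Definition _ M N :=
  [SubChoice_isSubLmodule of amod_hom M N by <:].

Fact amod_id_subproof M : \1%VF \in @amod_linear M M.
Proof. by apply/asboolP => a; rewrite comp_lfun1l comp_lfun1r. Qed.

Fact amod_comp_subproof M N P (g : amod_hom N P) (f : amod_hom M N) :
  (g \o f)%VF \in @amod_linear M P.
Proof.
case: g f => g /= /asboolP Hg [f /= /asboolP Hf]; apply/asboolP => a.
by rewrite -comp_lfunA Hf !comp_lfunA Hg.
Qed.

Definition amod_cat : linCat K.
Proof.
refine (@LinCat K (amod A) (fun M N => amod_hom M N : lmodType K)
  (fun M => AModHom (amod_id_subproof M))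
  (fun M N P g f => AModHom (amod_comp_subproof g f)) _ _ _ _ _).
- by move=> M N f; apply: val_inj; rewrite /= comp_lfun1l.
- by move=> M N f; apply: val_inj; rewrite /= comp_lfun1r.
- by move=> M N P Q h g f; apply: val_inj; rewrite /= comp_lfunA.
- by move=> M N P f k g h; apply: val_inj; rewrite /= comp_lfunDl -comp_lfunZl.
- by move=> M N P g k f h; apply: val_inj; rewrite /= comp_lfunDr -comp_lfunZr.
Defined.

End AMod.

(** * Separable algebras *)

Section Separable.
Variables (K : fieldType) (A : falgType K).

Let n := \dim {:A}.
Let e : n.-tuple A := vbasis {:A}.

(** The tensor square of [A] is modelled by the square matrices of size
    [\dim A]: the matrix [M] stands for [\sum_(i, j) M i j *: (e_i ⊗ e_j)]. *)
Definition tensor2 (a b : A) : 'M[K]_n :=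
  \matrix_(i, j) (coord e i a * coord e j b).

Definition tensor2_mul (M : 'M[K]_n) : A :=
  \sum_i \sum_j M i j *: (e`_i * e`_j).

Definition tensor2_lact (a : A) (M : 'M[K]_n) : 'M[K]_n :=
  \sum_(i < n) \sum_(j < n) M i j *: tensor2 (a * e`_i) e`_j.

Definition tensor2_ract (M : 'M[K]_n) (a : A) : 'M[K]_n :=
  \sum_(i < n) \sum_(j < n) M i j *: tensor2 e`_i (e`_j * a).

Definition separable_alg : Prop :=
  exists s : {linear A -> 'M[K]_n},
    (forall a b c, s (a * b * c) = tensor2_lact a (tensor2_ract (s b) c)) /\
    (forall a, tensor2_mul (s a) = a).

End Separable.

(** Being linearly equivalent to [amod_cat A] already makes [C] a finite
    linear abelian category. *)
Definition separable_cat (K : fieldType) (C : linCat K) : Prop :=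
  exists A : falgType K, separable_alg A /\ equivalent C (amod_cat A).

(** * Monoidal and rigid categories *)

Record monCat (K : fieldType) := MonCat {
  mcat :> linCat K;
  one : mcat;
  tens : mcat -> mcat -> mcat;
  tensm : forall X X' Y Y' : mcat,
    Hom X X' -> Hom Y Y' -> Hom (tens X Y) (tens X' Y');
  tensm_id : forall X Y, tensm (idm X) (idm Y) = idm (tens X Y);
  tensm_comp : forall (X X' X'' Y Y' Y'' : mcat)
    (f' : Hom X' X'') (f : Hom X X') (g' : Hom Y' Y'') (g : Hom Y Y'),
    tensm (f' ∘ f) (g' ∘ g) = tensm f' g' ∘ tensm f g;
  (* associator, left and right unitors, and their inverses *)
  assoc : forall X Y Z, Hom (tens (tens X Y) Z) (tens X (tens Y Z));
  assocV : forall X Y Z, Hom (tens X (tens Y Z)) (tens (tens X Y) Z);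
  lunit : forall X, Hom (tens one X) X;
  lunitV : forall X, Hom X (tens one X);
  runit : forall X, Hom (tens X one) X;
  runitV : forall X, Hom X (tens X one);
  assoc_inv : forall X Y Z, are_inverse (assoc X Y Z) (assocV X Y Z);
  lunit_inv : forall X, are_inverse (lunit X) (lunitV X);
  runit_inv : forall X, are_inverse (runit X) (runitV X);
  assoc_nat : forall (X X' Y Y' Z Z' : mcat)
    (f : Hom X X') (g : Hom Y Y') (h : Hom Z Z'),
    assoc X' Y' Z' ∘ tensm (tensm f g) h = tensm f (tensm g h) ∘ assoc X Y Z;
  lunit_nat : forall (X Y : mcat) (f : Hom X Y),
    lunit Y ∘ tensm (idm one) f = f ∘ lunit X;
  runit_nat : forall (X Y : mcat) (f : Hom X Y),
    runit Y ∘ tensm f (idm one) = f ∘ runit X;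
  pentagon : forall W X Y Z,
    assoc W X (tens Y Z) ∘ assoc (tens W X) Y Z =
    tensm (idm W) (assoc X Y Z) ∘ assoc W (tens X Y) Z
      ∘ tensm (assoc W X Y) (idm Z);
  triangle : forall X Y,
    tensm (idm X) (lunit Y) ∘ assoc X one Y = tensm (runit X) (idm Y)
}.

Arguments one {K m}.
Arguments tens {K m} X Y.
Arguments tensm {K m X X' Y Y'} f g.
Arguments assoc {K m} X Y Z.
Arguments assocV {K m} X Y Z.
Arguments lunit {K m} X.
Arguments lunitV {K m} X.
Arguments runit {K m} X.
Arguments runitV {K m} X.
Notation "X '⊗' Y" := (tens X Y) : cat_scope.
Notation "f '⊗m' g" := (tensm f g) : cat_scope.

(** [X'] is a left dual of [X] (equivalently, [X] is a right dual of [X']). *)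
Definition is_left_dual (K : fieldType) (C : monCat K) (X X' : C)
    (ev : Hom (X' ⊗ X) one) (coev : Hom one (X ⊗ X')) : Prop :=
  runit X ∘ (idm X ⊗m ev) ∘ assoc X X' X ∘ (coev ⊗m idm X) ∘ lunitV X
    = idm X /\
  lunit X' ∘ (ev ⊗m idm X') ∘ assocV X' X X' ∘ (idm X' ⊗m coev) ∘ runitV X'
    = idm X'.

Record rigidCat (K : fieldType) := RigidCat {
  rcat :> monCat K;
  dual : rcat -> rcat;
  ev : forall X, Hom (dual X ⊗ X) one;
  coev : forall X, Hom one (X ⊗ dual X);
  ev_coev : forall X, is_left_dual (ev X) (coev X);
  right_dual : forall X, exists (Y : rcat)
    (ev' : Hom (X ⊗ Y) one) (coev' : Hom one (Y ⊗ X)), is_left_dual ev' coev'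
}.

Arguments dual {K r} X.
Arguments ev {K r} X.
Arguments coev {K r} X.
Notation "X ^*" := (dual X) : cat_scope.

Definition fusion (K : fieldType) (C : rigidCat K) : Prop :=
  [/\ separable_cat C,
      (forall (X X' Y Y' : C) (g : Hom Y Y'),
         linear (fun f : Hom X X' => f ⊗m g)),
      (forall (X X' Y Y' : C) (f : Hom X X'),
         linear (fun g : Hom Y Y' => f ⊗m g))
    & simple (one : C)].

(** * The canonical coend *)

Section Coend.
Variables (K : fieldType) (C : rigidCat K).

Definition dualm (V W : C) (f : Hom V W) : Hom W^* V^* :=
  lunit V^* ∘ (ev W ⊗m idm V^*) ∘ ((idm W^* ⊗m f) ⊗m idm V^*)
    ∘ assocV W^* V V^* ∘ (idm W^* ⊗m coev V) ∘ runitV W^*.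

Definition cowedge (Z : C) (j : forall V : C, Hom (V^* ⊗ V) Z) : Prop :=
  forall (V W : C) (f : Hom V W),
    j V ∘ (dualm f ⊗m idm V) = j W ∘ (idm W^* ⊗m f).

Definition canonical_coend (R : C) : Prop :=
  exists i : forall V : C, Hom (V^* ⊗ V) R,
    cowedge i /\
    forall (Z : C) (j : forall V : C, Hom (V^* ⊗ V) Z), cowedge j ->
      exists! h : Hom R Z, forall V, h ∘ i V = j V.

End Coend.

(** * Frobenius-Perron dimensions

    [epsilon (inhabits x0) P] is some [x] such that [P x] if there is one. In a
    fusion category all the values selected below exist, and all but the list
    of representatives [simples] are unique. *)

Section FPdim.
Variables (K : fieldType) (C : rigidCat K).

Definition no_object : family_of_objects C :=
  @FamilyOfObjects K C 0 (fun i => False_rect C (notF (ltn_ord i))).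

Definition simples : family_of_objects C :=
  epsilon (inhabits no_object) (@enumerates_simples K C).

Definition irr_index := 'I_(fam_size simples).

Definition irr (i : irr_index) : C := fam i.

(** [gclass X] is the class of [X] in the free commutative monoid on the simple
    classes: the object [X] is the direct sum of [n i] copies of [irr i]. *)
Definition gclass (X : C) : {ffun irr_index -> nat} :=
  epsilon (inhabits [ffun=> 0%N]) (fun n : {ffun irr_index -> nat} =>
    is_direct_sum (fun p : {i : irr_index & 'I_(n i)} => irr (tag p)) X).

(** Row [j] holds the coordinates of [[X][irr j]], since [eigenvalue] lets
    matrices act on row vectors. *)
Definition left_mul_mx (X : C) : 'M[algC]_(fam_size simples) :=
  \matrix_(j, i) (gclass (X ⊗ irr j) i)%:R.

(** Eigenvalues of these matrices are algebraic numbers, and [0 <= a] in [algC]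
    says that [a] is a non-negative real. *)
Definition FPdim (X : C) : algC :=
  epsilon (inhabits 0) (fun a =>
    [/\ eigenvalue (left_mul_mx X) a, 0 <= a
      & forall b, eigenvalue (left_mul_mx X) b -> 0 <= b -> b <= a]).

Definition left_embedding (X : C) (e : Hom (one : C) one) : Hom X X :=
  lunit X ∘ (e ⊗m idm X) ∘ lunitV X.

(** Dimension of [End X] over [End 1] acting through [left_embedding X]. *)
Definition dimE_End (X : C) : nat :=
  epsilon (inhabits 0%N) (fun d => exists b : 'I_d -> Hom X X,
    forall f : Hom X X, exists! c : {ffun 'I_d -> Hom (one : C) one},
      f = \sum_k left_embedding X (c k) ∘ b k).

Definition FPdim_cat : algC :=
  \sum_(i < fam_size simples) FPdim (irr i) ^+ 2 / (dimE_End (irr i))%:R.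

End FPdim.

(* Main.v *)
(** Let [δ(X) = dim_K End X]. Averaging over separability idempotents makes
    every [K]-linear category met below von Neumann regular, hence semisimple.
    Perron-Frobenius for the symmetric positive matrix
    [dim Hom(X_i ⊗ X_k, X_j ⊗ X_l)], summed over [k] and [l], gives a positive
    character [d] of the Grothendieck ring, which is [FPdim].

    For [X] simple with [D = End X], the separability idempotent
    [\sum_k a_k ⊗ b_k] of [D] defines the projector [\sum_k a_k^* ⊗ b_k] of
    [X^* ⊗ X] onto [X^* ⊗_D X], and [R] is the direct sum of these images. The
    main point is [FPdim(X^* ⊗_D X) = FPdim(X)^2 / dim_E D]. On the category of
    [D]-modules [N] in [C], the functions [FPdim(N)] and [FPdim(N ⊗_D X)] are
    both multiplied by [FPdim(Y)] when [N] is replaced by [Y ⊗ N]; this module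
    category is irreducible, so they are proportional by the uniqueness of
    Perron vectors. The free module on the unit gives the ratio
    [FPdim(X) / dim_E D], and [N = X^*] the formula. *)

Require Import Defs.
From mathcomp Require Import all_boot all_order all_algebra all_field.
From Stdlib Require Import ClassicalEpsilon.
From HB Require Import structures.
From mathcomp Require Import boolp zify ring.
Import Defs.

Set Implicit Arguments.
Unset Strict Implicit.
Unset Printing Implicit Defensive.

Import Order.TTheory GRing.Theory Num.Theory.

Local Open Scope ring_scope.
Local Open Scope cat_scope.

(** * Finite-dimensional spaces *)

(** Over an imperfect field a semisimple algebra may lose semisimplicity under scalar extension, so
    separability idempotents, not semisimplicity alone, are carried from one category to the next.
    All Hom dimensions are over [K]. The endomorphisms of a simple object form an arbitrary division
    algebra, so a multiplicity is a Hom dimension divided by [sdim]. The field [E] enters through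
    the unit: its weight is [1 / dim_K E], and this factor turns [dim_K D] into [dim_E D]. Functions
    additive on direct sums stand for linear forms on the Grothendieck group. Summing over all pairs
    [(k, l)] makes every matrix entry positive, so that uniqueness of Perron vectors needs no
    connectivity argument. Modules with an action are never built: their category is the idempotent
    completion of the morphisms between free modules, and the dimension of an underlying object is
    read off from the morphisms out of free modules. *)

Lemma choice_dep (I : Type) (T : I -> Type) (P : forall i, T i -> Prop) :
  (forall i, exists x, P i x) -> exists f : forall i, T i, forall i, P i (f i).
Proof. by move=> h; exists (fun i => sval (cid (h i))) => i; case: cid. Qed.

Section LinearMaps.
Variables (K : fieldType) (V W : lmodType K) (f : V -> W).
Hypothesis lin_f : linear f.

Lemma lin_0 : f 0 = 0.
Proof. by have := lin_f (-1) 0 0; rewrite scaler0 addr0 scaleN1r addNr. Qed.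

Lemma lin_D x y : f (x + y) = f x + f y.
Proof. by have := lin_f 1 x y; rewrite !scale1r. Qed.

Lemma lin_Z a x : f (a *: x) = a *: f x.
Proof. by have := lin_f a x 0; rewrite !addr0 lin_0 addr0. Qed.

Lemma lin_N x : f (- x) = - f x.
Proof. by rewrite -scaleN1r lin_Z scaleN1r. Qed.

Lemma lin_B x y : f (x - y) = f x - f y.
Proof. by rewrite lin_D lin_N. Qed.

Lemma lin_sum I (r : seq I) (P : pred I) (F : I -> V) :
  f (\sum_(i <- r | P i) F i) = \sum_(i <- r | P i) f (F i).
Proof. by apply: big_morph; [exact: lin_D | exact: lin_0]. Qed.

End LinearMaps.

Section Dimension.
Variable K : fieldType.
Implicit Types (V W : lmodType K) (I J : finType).

(** Morphism spaces are bare [lmodType]s, so finite dimension is a property of a space and not part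
    of its structure. *)
Definition spans V I (b : I -> V) : Prop :=
  forall v, exists c : I -> K, v = \sum_i c i *: b i.

Definition independent V I (b : I -> V) : Prop :=
  forall c : I -> K, \sum_i c i *: b i = 0 -> forall i, c i = 0.

Definition is_basis V I (b : I -> V) : Prop := spans b /\ independent b.

Definition has_dim V (n : nat) : Prop :=
  exists I (b : I -> V), #|I| = n /\ is_basis b.

Definition findim V : Prop := exists n, has_dim V n.

Definition vdim V : nat := epsilon (inhabits 0%N) (has_dim V).

Lemma ordinal_basis V n : has_dim V n -> exists b : 'I_n -> V, is_basis b.
Proof.
move=> [I [b [<- [sb ib]]]]; exists (b \o enum_val); split.
  move=> v; have [c ->] := sb v; exists (c \o enum_val).
  by rewrite (reindex (@enum_val I I)) //; apply: onW_bij; exact: enum_val_bij.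
move=> c h i.
have := ib (c \o enum_rank); rewrite (reindex (@enum_val I I)) /=; last first.
  by apply: onW_bij; exact: enum_val_bij.
under eq_bigr => j _ do rewrite enum_valK.
by move=> /(_ h (enum_val i)); rewrite enum_valK.
Qed.

(** Coordinates move linear questions to row vectors, where rank and pseudo-inverse are
    available. *)
Lemma has_dim_coords V n : has_dim V n ->
  exists (r : V -> 'rV[K]_n) (s : 'rV[K]_n -> V),
    [/\ linear r, linear s, cancel r s & cancel s r].
Proof.
move=> /ordinal_basis[b [sb ib]].
have [r rP] := choice sb.
pose s (u : 'rV[K]_n) := \sum_i u 0 i *: b i.
have ls : linear s.
  move=> a u v; rewrite /s scaler_sumr -big_split; apply: eq_bigr => i _.
  by rewrite !mxE scalerDl scalerA.
have rs : cancel (fun v => \row_i r v i) s.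
  by move=> v; rewrite {2}(rP v); apply: eq_bigr => i _; rewrite mxE.
have s0 u : s u = 0 -> u = 0.
  by move=> /ib h; apply/rowP => i; rewrite mxE h.
have sr : cancel s (fun v => \row_i r v i).
  by move=> u; apply/eqP; rewrite -subr_eq0; apply/eqP/s0; rewrite lin_B // rs subrr.
exists (fun v => \row_i r v i), s; split=> // a u v.
by apply: (can_inj sr); rewrite ls !rs.
Qed.

Lemma has_dim_rV V n (s : 'rV[K]_n -> V) (r : V -> 'rV[K]_n) :
  linear s -> cancel r s -> cancel s r -> has_dim V n.
Proof.
move=> ls rs sr; exists 'I_n, (fun i => s (delta_mx 0 i)).
have sE (c : 'I_n -> K) : \sum_i c i *: s (delta_mx 0 i) = s (\row_i c i).
  rewrite [\row_i _]row_sum_delta lin_sum //; apply: eq_bigr => i _.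
  by rewrite lin_Z // mxE.
split; first by rewrite card_ord.
split=> [v | c].
  exists (fun i => r v 0 i); rewrite sE -[LHS]rs; congr s.
  by apply/rowP => i; rewrite mxE.
rewrite sE => h i.
have : \row_i c i = 0 by apply: (can_inj sr); rewrite h lin_0.
by move/rowP/(_ i); rewrite !mxE.
Qed.

Lemma linear_rV_mx m n (f : 'rV[K]_m -> 'rV[K]_n) :
  linear f -> exists A, forall u, f u = u *m A.
Proof.
move=> lf; exists (\matrix_i f (delta_mx 0 i)) => u.
rewrite {1}[u]row_sum_delta lin_sum // mulmx_sum_row; apply: eq_bigr => i _.
by rewrite lin_Z // rowK.
Qed.

Lemma linear_comp V1 V2 V3 (f : V2 -> V3) (g : V1 -> V2) :
  linear f -> linear g -> linear (f \o g).
Proof. by move=> lf lg a x y; rewrite /= lg lf. Qed.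

Lemma injective_dim V W m n (f : V -> W) : linear f -> injective f ->
  has_dim V m -> has_dim W n -> (m <= n)%N.
Proof.
move=> lf injf /has_dim_coords[r [s [lr ls rs sr]]].
move=> /has_dim_coords[r' [s' [lr' ls' rs' sr']]].
have [A AP] := linear_rV_mx (linear_comp lr' (linear_comp lf ls)).
suff : row_free A by rewrite -row_leq_rank => /leq_trans->//; exact: rank_leq_col.
apply: inj_row_free => u; rewrite -AP /= => h.
apply: (can_inj sr); apply: injf; apply: (can_inj rs').
by rewrite h !(lin_0 ls, lin_0 lf) lin_0.
Qed.

Lemma has_dim_uniq V m n : has_dim V m -> has_dim V n -> m = n.
Proof.
move=> hm hn; apply/eqP; rewrite eqn_leq.
by rewrite !(@injective_dim V V _ _ id).
Qed.

Lemma vdimP V : findim V -> has_dim V (vdim V).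
Proof. by move=> h; exact: epsilon_spec. Qed.

Lemma has_dim_vdim V n : has_dim V n -> vdim V = n.
Proof. by move=> h; apply: (has_dim_uniq _ h); apply: vdimP; exists n. Qed.

Lemma has_dim_bij V W (f : V -> W) (g : W -> V) n :
  linear f -> cancel f g -> cancel g f -> has_dim V n -> has_dim W n.
Proof.
move=> lf fg gf /has_dim_coords[r [s [lr ls rs sr]]].
apply: (@has_dim_rV _ _ (f \o s) (r \o g)).
- exact: linear_comp.
- by move=> v /=; rewrite rs gf.
- by move=> v /=; rewrite fg sr.
Qed.

Lemma linear_can V W (f : V -> W) (g : W -> V) :
  linear f -> cancel f g -> cancel g f -> linear g.
Proof. by move=> lf fg gf a x y; apply: (can_inj fg); rewrite lf !gf. Qed.

Lemma vdim_bij V W (f : V -> W) (g : W -> V) :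
  linear f -> cancel f g -> cancel g f -> vdim V = vdim W.
Proof.
move=> lf fg gf; rewrite /vdim; congr epsilon; apply/funext => n; apply/propext.
split; first exact: has_dim_bij.
by apply: (has_dim_bij _ gf fg); exact: (linear_can lf).
Qed.

Lemma vdim_bijective V W (f : V -> W) : linear f -> injective f ->
  (forall w, exists v, f v = w) -> vdim V = vdim W.
Proof.
move=> lf injf surjf; have [g gP] := choice surjf.
by apply: (vdim_bij (g := g) lf) => [v|w]; [apply: injf|]; rewrite gP.
Qed.

Lemma vdim_eq0 V : findim V -> vdim V = 0%N <-> forall v : V, v = 0.
Proof.
move=> /vdimP h; split=> [h0 v | h0].
  move: h; rewrite h0 => /has_dim_coords[r [s [lr ls rs sr]]].
  by rewrite -[v]rs [r v]thinmx0 lin_0.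
apply: (has_dim_uniq h); exists void, (fun=> 0); split; first exact: card_void.
split=> [v | c _ []]; exists (fun=> 0).
by rewrite (h0 v) big1.
Qed.

Lemma vdim_gt0 V (v : V) : findim V -> v <> 0 -> (0 < vdim V)%N.
Proof. by move=> h n0; rewrite lt0n; apply/eqP => /(vdim_eq0 h)/(_ v). Qed.

(** The injection bounds the length of independent families in [V], and one of maximal length must
    span. *)
Lemma findim_sub V W (f : V -> W) :
  linear f -> injective f -> findim W -> findim V.
Proof.
move=> lf injf [n hW].
pose P m := `[< exists b : 'I_m -> V, independent b >].
have P0 : exists m, P m.
  by exists 0; apply/asboolP; exists (fun=> 0) => c _ [].
have Pn m : P m -> (m <= n)%N.
  move=> /asboolP[b ib]; have [r [s [lr ls rs sr]]] := has_dim_coords hW.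
  have lin : linear (fun u : 'rV[K]_m => r (f (\sum_i u 0 i *: b i))).
    move=> a u v; rewrite -lr -lf; congr (r (f _)).
    rewrite scaler_sumr -big_split; apply: eq_bigr => i _.
    by rewrite !mxE scalerDl scalerA.
  have [A AP] := linear_rV_mx lin.
  suff : row_free A by rewrite -row_leq_rank => /leq_trans->//; exact: rank_leq_col.
  apply: inj_row_free => u; rewrite -AP => h.
  have /ib h' : \sum_i u 0 i *: b i = 0.
    by apply: injf; apply: (can_inj rs); rewrite h !(lin_0 lf, lin_0 lr).
  by apply/rowP => i; rewrite h' mxE.
case: (ex_maxnP P0 Pn) => m /asboolP[b ib] maxm.
exists m, 'I_m, b; split; first by rewrite card_ord.
split=> // v; apply/notP => nv.
suff : P m.+1 by move/maxm; rewrite ltnn.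
apply/asboolP; exists (fun i => oapp b v (unlift ord0 i)) => c.
rewrite big_ord_recl unlift_none /=; under eq_bigr => i _ do rewrite liftK /=.
move=> h; have c0 : c ord0 = 0.
  apply: contra_notP nv => /eqP c0.
  exists (fun i => - (c ord0)^-1 * c (lift ord0 i)).
  apply: (scalerI c0); rewrite -[LHS]opprK (addr0_eq h) scaler_sumr -sumrN.
  by apply: eq_bigr => i _; rewrite scalerA mulrA mulrN mulfV // mulN1r scaleNr.
move: h; rewrite c0 scale0r add0r => /ib h i.
by case: (unliftP ord0 i) => [j|] ->.
Qed.

Lemma vdim_sum V J (W : J -> lmodType K) (inj : forall j, W j -> V)
    (pr : forall j, V -> W j) :
  (forall j, linear (inj j)) -> (forall j, linear (pr j)) ->
  (forall j w, pr j (inj j w) = w) ->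
  (forall i j w, i != j -> pr i (inj j w) = 0) ->
  (forall v, \sum_j inj j (pr j v) = v) ->
  (forall j, findim (W j)) -> vdim V = (\sum_j vdim (W j))%N.
Proof.
move=> li lp pi pi0 ip fW; apply: has_dim_vdim.
have [b bP] := choice_dep (fun j => ordinal_basis (vdimP (fW j))).
exists {j : J & 'I_(vdim (W j))}, (fun t => inj (tag t) (b (tag t) (tagged t))).
split; first by rewrite card_tagged sumnE big_map big_enum; apply: eq_bigr => j; rewrite card_ord.
have E (c : forall j, 'I_(vdim (W j)) -> K) :
    \sum_(t : {j : J & 'I_(vdim (W j))})
      c (tag t) (tagged t) *: inj (tag t) (b (tag t) (tagged t)) =
    \sum_j inj j (\sum_i c j i *: b j i).
  rewrite -(sig_big_dep xpredT (fun _ => xpredT)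
    (fun j i => c j i *: inj j (b j i))) /=; apply: eq_bigr => j _.
  by rewrite lin_sum //; apply: eq_bigr => i _; rewrite lin_Z.
split=> [v | c].
  have [c cP] := choice_dep (fun j => (bP j).1 (pr j v)).
  exists (fun t => c (tag t) (tagged t)); rewrite E -[LHS]ip.
  by apply: eq_bigr => j _; rewrite -cP.
pose c' (j : J) (i : 'I_(vdim (W j))) := c (Tagged (fun j => 'I_(vdim (W j))) i).
rewrite (eq_bigr (fun t : {j : J & 'I_(vdim (W j))} =>
  c' (tag t) (tagged t) *: inj (tag t) (b (tag t) (tagged t)))); last by case.
rewrite E => h [j i]; apply: ((bP j).2 (c' j)).
rewrite -[LHS]pi -[RHS](lin_0 (lp j)) -h (lin_sum (lp j)) (bigD1 j) //=.
by rewrite [X in _ + X]big1 ?addr0 // => k; rewrite eq_sym => /pi0.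
Qed.

Lemma linear_pseudo_inverse V W (f : V -> W) : linear f -> findim V -> findim W ->
  exists g : W -> V, linear g /\ forall v, f (g (f v)) = f v.
Proof.
move=> lf [m /has_dim_coords[r [s [lr ls rs sr]]]].
move=> [n /has_dim_coords[r' [s' [lr' ls' rs' sr']]]].
have [A AP] := linear_rV_mx (linear_comp lr' (linear_comp lf ls)).
exists (fun w => s (r' w *m pinvmx A)); split.
  by move=> a x y; rewrite lr' mulmxDl -scalemxAl ls.
move=> v; apply: (can_inj rs').
have fE u : r' (f u) = r u *m A by rewrite -AP /= rs.
by rewrite !fE sr mulmxKpV ?submxMl.
Qed.

End Dimension.

(** * Linear categories with a separability idempotent *)

Lemma big_unit (R : Type) (idx : R) (op : Monoid.law idx) (F : unit -> R) :
  \big[op/idx]_j F j = F tt.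
Proof. by apply: big_pred1; case. Qed.

Section CompLinear.
Variables (K : fieldType) (C : linCat K).
Implicit Types X Y Z : C.

Lemma compDl X Y Z (g g' : Hom Y Z) (f : Hom X Y) :
  (g + g') ∘ f = g ∘ f + g' ∘ f.
Proof. exact: (lin_D (comp_linl f)). Qed.

Lemma compDr X Y Z (g : Hom Y Z) (f f' : Hom X Y) :
  g ∘ (f + f') = g ∘ f + g ∘ f'.
Proof. exact: (lin_D (comp_linr g)). Qed.

Lemma compBl X Y Z (g g' : Hom Y Z) (f : Hom X Y) :
  (g - g') ∘ f = g ∘ f - g' ∘ f.
Proof. exact: (lin_B (comp_linl f)). Qed.

Lemma compBr X Y Z (g : Hom Y Z) (f f' : Hom X Y) :
  g ∘ (f - f') = g ∘ f - g ∘ f'.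
Proof. exact: (lin_B (comp_linr g)). Qed.

Lemma compZl X Y Z a (g : Hom Y Z) (f : Hom X Y) : (a *: g) ∘ f = a *: (g ∘ f).
Proof. exact: (lin_Z (comp_linl f)). Qed.

Lemma compZr X Y Z a (g : Hom Y Z) (f : Hom X Y) : g ∘ (a *: f) = a *: (g ∘ f).
Proof. exact: (lin_Z (comp_linr g)). Qed.

Lemma comp0l X Y Z (f : Hom X Y) : (0 : Hom Y Z) ∘ f = 0.
Proof. exact: (lin_0 (comp_linl f)). Qed.

Lemma comp0r X Y Z (g : Hom Y Z) : g ∘ (0 : Hom X Y) = 0.
Proof. exact: (lin_0 (comp_linr g)). Qed.

Lemma comp_suml X Y Z (f : Hom X Y) I (r : seq I) (P : pred I) (F : I -> Hom Y Z) :
  (\sum_(i <- r | P i) F i) ∘ f = \sum_(i <- r | P i) F i ∘ f.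
Proof. exact: (lin_sum (comp_linl f)). Qed.

Lemma comp_sumr X Y Z (g : Hom Y Z) I (r : seq I) (P : pred I) (F : I -> Hom X Y) :
  g ∘ (\sum_(i <- r | P i) F i) = \sum_(i <- r | P i) g ∘ F i.
Proof. exact: (lin_sum (comp_linr g)). Qed.

End CompLinear.

Definition bilinear (K : fieldType) (U V W : lmodType K) (b : U -> V -> W) : Prop :=
  (forall v, linear (b^~ v)) /\ (forall u, linear (b u)).

Section Categories.
Variables (K : fieldType) (C : linCat K).
Implicit Types X Y Z G : C.

Lemma iso_refl X : isomorphic X X.
Proof. by exists (idm X), (idm X); split; rewrite comp_idl. Qed.

Lemma iso_sym X Y : isomorphic X Y -> isomorphic Y X.
Proof. by move=> [f [g [h1 h2]]]; exists g, f. Qed.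

Lemma iso_trans X Y Z : isomorphic X Y -> isomorphic Y Z -> isomorphic X Z.
Proof.
move=> [f [f' [h1 h2]]] [g [g' [k1 k2]]]; exists (g ∘ f), (f' ∘ g'); split.
  by rewrite comp_assoc -(comp_assoc f') k1 comp_idr.
by rewrite comp_assoc -(comp_assoc g) h2 comp_idr.
Qed.

Lemma zero_hom X Y (f : Hom X Y) : is_zero X -> f = 0.
Proof. by move=> h; rewrite -[f]comp_idr h comp0r. Qed.

Definition split_by X (p : Hom X X) Y (i : Hom Y X) (q : Hom X Y) : Prop :=
  q ∘ i = idm Y /\ i ∘ q = p.

Definition split_idempotents : Prop := forall X (p : Hom X X),
  p ∘ p = p -> exists Y (i : Hom Y X) (q : Hom X Y), split_by p i q.

Definition hom_findim : Prop := forall X Y, findim (Hom X Y).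

Definition hdim X Y : nat := vdim (Hom X Y).

Definition regular : Prop :=
  forall X Y (f : Hom X Y), exists g : Hom Y X, f ∘ g ∘ f = f.

(** A separability idempotent [\sum_k x_k ⊗ y_k] of the algebra [Hom G G]; the
    equation [\sum_k z x_k ⊗ y_k = \sum_k x_k ⊗ y_k z] is tested on bilinear
    maps. *)
Definition casimir G (s : seq (Hom G G * Hom G G)) : Prop :=
  \sum_(x <- s) x.1 ∘ x.2 = idm G /\
  forall (V : lmodType K) (b : Hom G G -> Hom G G -> V), bilinear b ->
    forall z, \sum_(x <- s) b (z ∘ x.1) x.2 = \sum_(x <- s) b x.1 (x.2 ∘ z).

(** This says that [X] is a retract of a finite power of [G]. A list of pairs avoids direct sums,
    whose existence is not part of a [linCat]. *)
Definition retract X G : Prop := exists s : seq (Hom G X * Hom X G),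
  \sum_(x <- s) x.1 ∘ x.2 = idm X.

Definition separated : Prop := exists G (s : seq (Hom G G * Hom G G)),
  casimir s /\ forall X, retract X G.

(** The idempotent of [Hom G G] spread over all objects: an element of [Hom G X ⊗ Hom X G] for each
    [X], along which any morphism can be moved from left to right. *)
Definition natural_casimir G (t : forall X, seq (Hom G X * Hom X G)) : Prop :=
  (forall X, \sum_(x <- t X) x.1 ∘ x.2 = idm X) /\
  forall X Y (f : Hom X Y) (V : lmodType K) (b : Hom G Y -> Hom X G -> V),
    bilinear b ->
    \sum_(x <- t X) b (f ∘ x.1) x.2 = \sum_(x <- t Y) b x.1 (x.2 ∘ f).

(** Conjugate the idempotent of [G] by the maps presenting [X] as a retract of a power of [G]. *)
Lemma separated_natural : separated ->
  exists G (t : forall X, seq (Hom G X * Hom X G)), natural_casimir t.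
Proof.
move=> [G [c [[c1 cz] /choice_dep[s s1]]]].
exists G, (fun X => [seq (p.1 ∘ x.1, x.2 ∘ p.2) | p <- s X, x <- c]).
split=> [X | X Y f V b [bl br]].
  rewrite big_allpairs_dep -[RHS](s1 X) /=; apply: eq_bigr => p _.
  rewrite -[in RHS](comp_idr p.1) -c1 comp_sumr comp_suml; apply: eq_bigr => x _.
  by rewrite !comp_assoc.
rewrite !big_allpairs_dep /=.
(* Inserting the identity of [Y] turns [f] into the endomorphism [r.2 ∘ f ∘ p.1] of [G], which the
   casimir relation can move across. *)
transitivity (\sum_(p <- s X) \sum_(r <- s Y) \sum_(x <- c)
    b (r.1 ∘ (r.2 ∘ f ∘ p.1 ∘ x.1)) (x.2 ∘ p.2)).
  apply: eq_bigr => p _; rewrite exchange_big /=; apply: eq_bigr => x _.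
  rewrite -(lin_sum (bl _)); congr (b _ _).
  rewrite -[LHS]comp_idl -s1 comp_suml; apply: eq_bigr => r _.
  by rewrite !comp_assoc.
rewrite exchange_big /=; apply: eq_bigr => r _.
transitivity (\sum_(p <- s X) \sum_(x <- c)
    b (r.1 ∘ x.1) (x.2 ∘ (r.2 ∘ f ∘ p.1) ∘ p.2)).
  apply: eq_bigr => p _.
  apply: (cz _ (fun u v => b (r.1 ∘ u) (v ∘ p.2))); split=> [v | u].
    exact: (linear_comp (bl _) (comp_linr _)).
  exact: (linear_comp (br _) (comp_linl _)).
rewrite exchange_big /=; apply: eq_bigr => x _.
rewrite -(lin_sum (br _)); congr (b _ _).
rewrite -[RHS]comp_idr -s1 comp_sumr; apply: eq_bigr => p _.
by rewrite !comp_assoc.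
Qed.

(* A [K]-linear partial inverse of [f ∘ _] becomes a morphism after averaging
   it against the natural casimir element. *)
Lemma separated_regular : hom_findim -> separated -> regular.
Proof.
move=> fin /separated_natural[G [t [t1 tn]]] X Y f.
have [g [lg fgf]] := linear_pseudo_inverse (comp_linr (X := G) f) (fin G X) (fin G Y).
exists (\sum_(x <- t Y) g x.1 ∘ x.2).
rewrite comp_sumr comp_suml.
transitivity (\sum_(x <- t Y) f ∘ g x.1 ∘ (x.2 ∘ f)).
  by apply: eq_bigr => x _; rewrite !comp_assoc.
rewrite -(tn _ _ f _ (fun u v => f ∘ g u ∘ v)); last first.
  split=> [v | u]; last exact: comp_linr.
  exact: (linear_comp (comp_linl v) (linear_comp (comp_linr f) lg)).
transitivity (\sum_(x <- t X) f ∘ (x.1 ∘ x.2)).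
  by apply: eq_bigr => x _; rewrite fgf comp_assoc.
by rewrite -comp_sumr t1 comp_idr.
Qed.

Lemma simple_idem X (p : Hom X X) : split_idempotents -> simple X ->
  p ∘ p = p -> p = 0 \/ p = idm X.
Proof.
move=> sp [_ sX] pp; have [Y [i [q [qi iq]]]] := sp X p pp.
have mi : monic i.
  by move=> Z g h e; rewrite -[g]comp_idl -[h]comp_idl -qi -!comp_assoc e.
case: (sX Y i mi) => [z | [j [ji ij]]].
  by left; rewrite -iq (zero_hom i z) comp0l.
right; rewrite -iq; suff -> : q = j by [].
by rewrite -[q]comp_idr -ij comp_assoc qi comp_idl.
Qed.

(** For monic [f] a quasi-inverse [g] is a left inverse, so [f ∘ g] is the idempotent to be
    tested. *)
Lemma idem_simple X : regular -> ~ is_zero X ->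
  (forall p : Hom X X, p ∘ p = p -> p = 0 \/ p = idm X) -> simple X.
Proof.
move=> reg nz idem; split=> // Y f mf; have [g fgf] := reg _ _ f.
have gf : g ∘ f = idm Y by apply: mf; rewrite comp_assoc fgf comp_idr.
have [|h|h] := idem (f ∘ g).
- by rewrite comp_assoc fgf.
- left; rewrite /is_zero -[LHS]comp_idl -{1}gf -gf comp_assoc -(comp_assoc g) h.
  by rewrite comp0r comp0l.
- by right; exists g.
Qed.

End Categories.

(** The form of separability used from here on: unlike [separable_cat] it needs no algebra, and it
    can be checked directly on module categories. *)
Record fin_separable (K : fieldType) (C : linCat K) : Prop := FinSeparable {
  fs_findim : hom_findim C;
  fs_separated : separated C;
  fs_split : split_idempotents C
}.

Section DirectSums.
Variables (K : fieldType) (C : linCat K).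
Implicit Types X Y Z : C.

Lemma hdim_suml (J : finType) (F : J -> C) X Z : hom_findim C ->
  is_direct_sum F X -> hdim X Z = (\sum_j hdim (F j) Z)%N.
Proof.
move=> fin [inj [pr [pi pi0 ip]]].
apply: (@vdim_sum _ _ _ (fun j => Hom (F j) Z) (fun j f => f ∘ pr j)
         (fun j f => f ∘ inj j)).
- by move=> j; exact: comp_linl.
- by move=> j; exact: comp_linl.
- by move=> j f; rewrite -comp_assoc pi comp_idr.
- by move=> i j f ij; rewrite -comp_assoc pi0 ?comp0r // eq_sym.
- move=> f; rewrite -[RHS]comp_idr -ip comp_sumr.
  by apply: eq_bigr => j _; rewrite comp_assoc.
- by move=> j; exact: fin.
Qed.

Lemma hdim_sumr (J : finType) (F : J -> C) X Z : hom_findim C ->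
  is_direct_sum F X -> hdim Z X = (\sum_j hdim Z (F j))%N.
Proof.
move=> fin [inj [pr [pi pi0 ip]]].
apply: (@vdim_sum _ _ _ (fun j => Hom Z (F j)) (fun j f => inj j ∘ f)
         (fun j f => pr j ∘ f)).
- by move=> j; exact: comp_linr.
- by move=> j; exact: comp_linr.
- by move=> j f; rewrite comp_assoc pi comp_idl.
- by move=> i j f ij; rewrite comp_assoc pi0 ?comp0l.
- move=> f; rewrite -[RHS]comp_idl -ip comp_suml.
  by apply: eq_bigr => j _; rewrite comp_assoc.
- by move=> j; exact: fin.
Qed.

Lemma direct_sum_iso X Y : isomorphic Y X -> is_direct_sum (fun _ : unit => Y) X.
Proof.
move=> [f [g [gf fg]]]; exists (fun=> f), (fun=> g); split=> //.
by rewrite big_unit.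
Qed.

Lemma direct_sum_zero X (F : void -> C) : is_zero X -> is_direct_sum F X.
Proof.
move=> z; exists (fun j => 0), (fun j => 0).
by split=> [[]|[]|]; rewrite big1 => [|[]].
Qed.

Lemma direct_sum_reindex (J T : finType) (h : T -> J) (F : J -> C) (G : T -> C) X :
  bijective h -> (forall t, isomorphic (G t) (F (h t))) ->
  is_direct_sum F X -> is_direct_sum G X.
Proof.
move=> bh /choice_dep[u /choice_dep[v uv]] [inj [pr [pi pi0 ip]]].
exists (fun t => inj (h t) ∘ u t), (fun t => v t ∘ pr (h t)); split.
- by move=> t; rewrite comp_assoc -(comp_assoc (v t)) pi comp_idr (uv t).1.
- move=> s t st; rewrite comp_assoc -(comp_assoc (v s)) pi0 ?comp0r ?comp0l //.
  by rewrite (inj_eq (bij_inj bh)).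
- rewrite -ip (reindex h) /=; last exact: onW_bij.
  apply: eq_bigr => t _.
  by rewrite comp_assoc -(comp_assoc (inj _)) (uv t).2 comp_idr.
Qed.

Lemma direct_sum_split X (p : Hom X X) Y (i : Hom Y X) (q : Hom X Y)
    Z (i' : Hom Z X) (q' : Hom X Z) (J J' : finType) (F : J -> C) (F' : J' -> C) :
  p ∘ p = p -> split_by p i q -> split_by (idm X - p) i' q' ->
  is_direct_sum F Y -> is_direct_sum F' Z ->
  is_direct_sum (fun t : J + J' => match t with inl j => F j | inr j => F' j end) X.
Proof.
move=> pp [qi iq] [qi' iq'] [inj [pr [pi pi0 ip]]] [inj' [pr' [pi' pi0' ip']]].
have qi'0 : q ∘ i' = 0.
  rewrite -[q]comp_idl -qi -[i']comp_idr -qi' !comp_assoc.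
  rewrite -(comp_assoc q) iq -(comp_assoc _ i') iq' compBr comp_idr -comp_assoc pp.
  by rewrite subrr comp0l.
have q'i0 : q' ∘ i = 0.
  rewrite -[q']comp_idl -qi' -[i]comp_idr -qi !comp_assoc.
  rewrite -(comp_assoc q') iq' -(comp_assoc _ i) iq compBr comp_idr compBl.
  by rewrite -comp_assoc pp subrr comp0l.
pose G (t : J + J') := match t with inl j => F j | inr j => F' j end.
exists (fun t => match t return Hom (G t) X with
                 | inl j => i ∘ inj j | inr j => i' ∘ inj' j end).
exists (fun t => match t return Hom X (G t) with
                 | inl j => pr j ∘ q | inr j => pr' j ∘ q' end).
have key A B D E (a : Hom D E) (b : Hom X D) (c : Hom B X) (d : Hom A B) :
  a ∘ b ∘ (c ∘ d) = a ∘ (b ∘ c) ∘ d by rewrite !comp_assoc.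
split.
- by case=> j; rewrite key ?qi ?qi' comp_idr.
- case=> j; case=> k jk; rewrite key ?qi ?qi' ?qi'0 ?q'i0 ?comp0r ?comp0l //.
    by rewrite comp_idr pi0.
  by rewrite comp_idr pi0'.
- rewrite big_sumType /= -[RHS](subrK p) [RHS]addrC -iq' -iq; congr (_ + _).
    rewrite -[RHS](congr1 (comp i) (comp_idl q)) -ip comp_suml comp_sumr.
    by apply: eq_bigr => j _; rewrite !comp_assoc.
  rewrite -[RHS](congr1 (comp i') (comp_idl q')) -ip' comp_suml comp_sumr.
  by apply: eq_bigr => j _; rewrite !comp_assoc.
Qed.

End DirectSums.

Section FunctorSums.
Variables (K : fieldType) (C D : linCat K) (F : linFunctor C D).

Lemma fhom0 X Y : fhom F (0 : Hom X Y) = 0.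
Proof. exact: (lin_0 (fhom_lin F (Y := Y))). Qed.

Lemma fhom_sum X Y I (r : seq I) (P : pred I) (f : I -> Hom X Y) :
  fhom F (\sum_(i <- r | P i) f i) = \sum_(i <- r | P i) fhom F (f i).
Proof. exact: (lin_sum (fhom_lin F (Y := Y))). Qed.

Lemma functor_direct_sum (J : finType) (G : J -> C) X :
  is_direct_sum G X -> is_direct_sum (F \o G) (F X).
Proof.
move=> [inj [pr [pi pi0 ip]]].
exists (fun j => fhom F (inj j)), (fun j => fhom F (pr j)); split.
- by move=> j; rewrite -fhom_comp pi fhom_id.
- by move=> i j ij; rewrite -fhom_comp pi0 // fhom0.
- rewrite -fhom_id -ip fhom_sum; apply: eq_bigr => j _; exact: esym (fhom_comp _ _ _).
Qed.

Lemma functor_iso X Y : isomorphic X Y -> isomorphic (F X) (F Y).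
Proof.
move=> [f [g [gf fg]]]; exists (fhom F f), (fhom F g).
by split; rewrite -fhom_comp ?gf ?fg fhom_id.
Qed.

End FunctorSums.

(** * Decomposition into simple objects and multiplicities *)

Section FinSeparableCategories.
Variables (K : fieldType) (C : linCat K).
Hypothesis sepC : fin_separable C.
Implicit Types X Y Z : C.

Let fin := fs_findim sepC.
Let reg := separated_regular fin (fs_separated sepC).
Let spl := fs_split sepC.

Lemma simple_iso X Y (f : Hom X Y) : simple X -> simple Y -> f <> 0 -> is_iso f.
Proof.
move=> sX sY f0; have [g fgf] := reg f; exists g; split.
  have [||//] := simple_idem spl sX (p := g ∘ f).
    by rewrite comp_assoc -(comp_assoc g) -(comp_assoc g) fgf.
  by move=> h; case: f0; rewrite -fgf -comp_assoc h comp0r.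
have [||//] := simple_idem spl sY (p := f ∘ g).
  by rewrite comp_assoc fgf.
by move=> h; case: f0; rewrite -fgf h comp0l.
Qed.

Lemma hdim_iso X X' Y Y' : isomorphic X X' -> isomorphic Y Y' -> hdim X Y = hdim X' Y'.
Proof.
move=> /direct_sum_iso h /direct_sum_iso h'.
by rewrite (hdim_suml Y' fin h) big_unit (hdim_sumr X fin h') big_unit.
Qed.

Lemma hdim_gt0 X Y (f : Hom X Y) : f <> 0 -> (0 < hdim X Y)%N.
Proof. exact: vdim_gt0. Qed.

(** Induction on [hdim X X]: a nonzero object that is not simple has a proper idempotent. Each of
    the two pieces has a smaller endomorphism space, because the other piece maps nontrivially to
    [X]. *)
Lemma decomposition X : exists (J : finType) (F : J -> C),
  (forall j, simple (F j)) /\ is_direct_sum F X.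
Proof.
have [m] := ubnP (hdim X X); elim: m X => // m IH X leXm.
have [z|nz] := pselect (is_zero X).
  exists void, (fun=> X); split; first by case.
  exact: direct_sum_zero.
have [sX|nsX] := pselect (simple X).
  by exists unit, (fun=> X); split=> //; apply: direct_sum_iso; exact: iso_refl.
have [p [pp [p0 p1]]] : exists p : Hom X X, p ∘ p = p /\ p <> 0 /\ p <> idm X.
  apply: contra_notP nsX => np; apply: idem_simple => // p pp.
  by apply: contrapT => /not_orP[p0 p1]; apply: np; exists p.
have pp' : (idm X - p) ∘ (idm X - p) = idm X - p.
  by rewrite compBl !compBr comp_idl !comp_idr comp_idl pp subrr subr0.
have [Y [i [q spY]]] := spl pp; have [Z [i' [q' spZ]]] := spl pp'.
have : is_direct_sum (fun t : unit + unit =>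
    match t with inl _ => Y | inr _ => Z end) X.
  by apply: (direct_sum_split pp spY spZ); apply: direct_sum_iso; exact: iso_refl.
move=> dX.
have hX U : hdim X U = (hdim Y U + hdim Z U)%N.
  by rewrite (hdim_suml U fin dX) big_sumType !big_unit.
have hX' U : hdim U X = (hdim U Y + hdim U Z)%N.
  by rewrite (hdim_sumr U fin dX) big_sumType !big_unit.
have i0 : i <> 0 by move=> h; apply: p0; rewrite -spY.2 h comp0l.
have i'0 : i' <> 0.
  by move=> h; apply: p1; have := spZ.2; rewrite h comp0l => /esym/subr0_eq.
have /hdim_gt0 := i0; have /hdim_gt0 := i'0; rewrite !hX' => gZ gY.
rewrite ltnS hX !hX' in leXm.
have [J [F [sF dF]]] := IH Y ltac:(lia).
have [J' [F' [sF' dF']]] := IH Z ltac:(lia).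
exists (J + J')%type, (fun t => match t with inl j => F j | inr j => F' j end).
by split; [case | exact: (direct_sum_split pp spY spZ)].
Qed.

(** The identity of a simple object factors through powers of [G], so it receives a nonzero map from
    a simple summand of [G]; there are finitely many of these. *)
Lemma simples_exist : exists S : family_of_objects C, enumerates_simples S.
Proof.
have [G [t [t1 tn]]] := separated_natural (fs_separated sepC).
have [J [F [sF [inj [pr [pi pi0 ip]]]]]] := decomposition G.
(* [pick] depends only on the predicate, so isomorphic summands get the same representative. The
   default [j] is never reached. *)
pose r j := odflt j [pick k | `[< isomorphic (F j) (F k) >]].
have rP j : isomorphic (F j) (F (r j)).
  by rewrite /r; case: pickP => [k /asboolP //|_]; exact: iso_refl.
have r_iso j k : isomorphic (F j) (F k) -> r j = r k.
  move=> jk; rewrite /r.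
  rewrite (eq_pick (Q := fun l => `[< isomorphic (F k) (F l) >])).
    by case: pickP => // /(_ k) /asboolP; case; exact: iso_refl.
  move=> l; apply: asbool_equiv_eq; split=> h; last exact: iso_trans h.
  by apply: iso_trans h; exact: iso_sym.
pose A := [set r j | j in J].
exists (FamilyOfObjects (fun i : 'I_#|A| => F (enum_val i))); split=> /=.
- by move=> i; exact: sF.
- move=> i j /r_iso h; apply: enum_val_inj.
  have rK k : k \in A -> r k = k.
    by move=> /imsetP[l _ ->]; apply: esym; exact: r_iso.
  by rewrite -[LHS]rK ?enum_valP // h rK ?enum_valP.
- move=> X sX.
  have [x x0] : exists f : Hom G X, f <> 0.
    apply: contrapT => nx; apply: sX.1; rewrite /is_zero -t1 big1 // => x _.
    suff -> : x.1 = 0 by rewrite comp0l.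
    by apply: contrapT => x0; apply: nx; exists x.1.
  have [j xj0] : exists j, x ∘ inj j <> 0.
    apply: contrapT => nx; apply: x0; rewrite -[x]comp_idr -ip comp_sumr big1 // => j _.
    rewrite comp_assoc; suff -> : x ∘ inj j = 0 by rewrite comp0l.
    by apply: contrapT => xj; apply: nx; exists j.
  have jA : r j \in A by apply/imsetP; exists j.
  exists (enum_rank_in jA (r j)); rewrite enum_rankK_in //.
  apply: iso_trans (rP j); apply: iso_sym.
  by exists (x ∘ inj j); exact: simple_iso.
Qed.

Lemma simple_hom0 X Y (f : Hom X Y) : simple X -> simple Y -> ~ isomorphic X Y -> f = 0.
Proof.
by move=> sX sY nXY; apply: contrapT => f0; apply: nXY; exists f; exact: simple_iso.
Qed.

Section Enumerated.
Variable S : family_of_objects C.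
Hypothesis hS : enumerates_simples S.

Let s_simple := let: And3 h _ _ := hS in h.
Let s_inj := let: And3 _ h _ := hS in h.
Let s_surj := let: And3 _ _ h := hS in h.

(** Convertible to [gclass] when [T] is [simples C]; an arbitrary [T] is allowed so that it also
    applies to the module category. *)
Definition mult (T : family_of_objects C) X : {ffun 'I_(fam_size T) -> nat} :=
  epsilon (inhabits [ffun=> 0%N]) (fun n : {ffun 'I_(fam_size T) -> nat} =>
    is_direct_sum (fun p : {i : 'I_(fam_size T) & 'I_(n i)} => fam (tag p)) X).

Lemma multP X :
  is_direct_sum (fun p : {i : 'I_(fam_size S) & 'I_(mult S X i)} => fam (tag p)) X.
Proof.
apply: (@epsilon_spec _ _ (fun n : {ffun 'I_(fam_size S) -> nat} =>
    is_direct_sum (fun p : {i : 'I_(fam_size S) & 'I_(n i)} => fam (tag p)) X)).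
have [J [F [sF dF]]] := decomposition X.
have [c cP] := choice (fun j => s_surj (sF j)).
pose n := [ffun i => #|[pred j | c j == i]|].
exists n.
pose cast i (k : 'I_(n i)) : 'I_#|[pred j | c j == i]| := cast_ord (ffunE _ i) k.
pose h (t : {i : 'I_(fam_size S) & 'I_(n i)}) : J := enum_val (cast (tag t) (tagged t)).
have ch t : c (h t) = tag t.
  by have := enum_valP (cast (tag t) (tagged t)) => /eqP.
have h_inj : injective h.
  move=> [i k] [i' k'] hh; have ii : i = i' by have := ch (Tagged _ k); rewrite hh ch.
  case: _ / ii k' hh => k' /enum_val_inj/cast_ord_inj /= hk.
  by rewrite -[k]/(tagged (Tagged (fun i => 'I_(n i)) k)) hk.
have [g gP] : exists g, forall j, h (g j) = j.
  apply: (choice_dep (P := fun j t => h t = j)) => j.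
  have jP : j \in [pred j' | c j' == c j] by rewrite inE.
  pose k : 'I_(n (c j)) := cast_ord (esym (ffunE _ (c j))) (enum_rank_in jP j).
  exists (Tagged (fun i => 'I_(n i)) k); rewrite /h /cast /= cast_ordKV.
  exact: enum_rankK_in.
apply: (direct_sum_reindex (h := h)) dF.
  by exists g => // t; apply: h_inj.
by move=> t; rewrite -ch; exact/iso_sym/cP.
Qed.

Definition sdim (T : family_of_objects C) (i : 'I_(fam_size T)) := hdim (fam i) (fam i).

Lemma sdim_gt0 (i : 'I_(fam_size S)) : (0 < sdim i)%N.
Proof. by apply: (@hdim_gt0 _ _ (idm _)); exact: (s_simple i).1. Qed.

Lemma hdim_simples i j : hdim (@fam _ _ S i) (fam j) = if i == j then sdim i else 0%N.
Proof.
case: eqP => [->//|ij]; apply/(vdim_eq0 (@fin _ _)) => f.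
by apply: simple_hom0 => // /s_inj.
Qed.

Lemma sum_tagged (n : 'I_(fam_size S) -> nat) (R : nmodType)
    (F : 'I_(fam_size S) -> R) :
  \sum_(p : {i : 'I_(fam_size S) & 'I_(n i)}) F (tag p) = \sum_i F i *+ n i.
Proof.
rewrite -(sig_big_dep xpredT (fun _ => xpredT) (fun i _ => F i)) /=.
by apply: eq_bigr => i _; rewrite sumr_const card_ord.
Qed.

(** By Schur's lemma only the copies of the [i]-th simple object contribute. In particular the
    multiplicity selected by [epsilon] is determined. *)
Lemma hdim_mult i X : hdim (@fam _ _ S i) X = (mult S X i * sdim i)%N.
Proof.
rewrite (hdim_sumr _ fin (multP X)).
rewrite (@sum_tagged _ nat (fun j => hdim (fam i) (fam j))) (bigD1 i) //=.
rewrite hdim_simples eqxx big1 => [|j ji].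
  by rewrite addr0; elim: (mult S X i) => [|m IH] //; rewrite mulrS IH mulSn.
by rewrite hdim_simples eq_sym (negbTE ji) mul0rn.
Qed.

End Enumerated.
End FinSeparableCategories.

(** * Perron vectors of symmetric positive matrices *)

Section Perron.
Local Open Scope sesquilinear_scope.
Variable n : nat.
Implicit Types (g : 'I_n -> 'I_n -> algC) (x u mu : 'I_n -> algC).

(* [|x|] is a top eigenvector as soon as [x] is one: it maximises the Rayleigh
   quotient of a symmetric matrix with positive entries. *)
Lemma perron_vector g : (0 < n)%N ->
  (forall a b, g a b = g b a) -> (forall a b, 0 < g a b) ->
  exists x lam, (forall a, 0 < x a) /\
    forall a, \sum_b g a b * x b = lam * x a.
Proof.
move=> n_gt0 g_sym g_gt0.
pose A : 'M[algC]_n := \matrix_(a, b) g a b.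
have A_real : A \is a realmx by apply/mxOverP => a b; rewrite mxE gtr0_real.
have A_herm : A \is hermsymmx.
  apply: realsym_hermsym A_real; apply/is_hermitianmxP.
  by rewrite expr0 scale1r map_mx_id //; apply/matrixP => a b; rewrite !mxE g_sym.
pose P := spectralmx A; pose d := spectral_diag A.
have P_unit : P \is unitarymx := spectral_unitarymx A.
have A_eq : A = P^t* *m diag_mx d *m P.
  by rewrite -invmx_unitary //; apply/orthomx_spectralP/hermitian_normalmx.
have d_real i : d 0 i \is Num.real.
  by have /mxOverP := hermitian_spectral_diag_real A_herm; apply.
have PPt : P *m P^t* = 1%:M by exact: (unitarymxP P_unit).
have PtP : P^t* *m P = 1%:M.
  by have := mulVmx (unitarymx_unit P_unit); rewrite invmx_unitary.
pose i0 := Ordinal n_gt0.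
have [k _ k_max] : extremum_spec >=%R xpredT (d 0) [arg max_(i > i0) d 0 i]%O.
  by apply: real_arg_maxP => // i _; exact: d_real.
pose lam := d 0 k.
(* In an orthonormal eigenbasis the Rayleigh defect of [u] is a sum of nonnegative terms, so it can
   be nonpositive only if [u] lies in the top eigenspace. *)
have top (u : 'rV_n) : (lam *: u *m u^t* - u *m A *m u^t*) 0 0 <= 0 ->
    u *m A = lam *: u.
  have [y uy] : exists y, u = y *m P by exists (u *m P^t*); rewrite -mulmxA PtP mulmx1.
  have -> : (lam *: u *m u^t* - u *m A *m u^t*) 0 0 =
      \sum_i (lam - d 0 i) * `|y 0 i| ^+ 2.
    rewrite -mulmxBl uy A_eq !mulmxA -(mulmxA y) PPt mulmx1 scalemxAl -mulmxBl.
    rewrite trmx_mul map_mxM mulmxA -(mulmxA _ P) PPt mulmx1 !mxE.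
    apply: eq_bigr => i _; rewrite mul_mx_diag !mxE normCK mulrA; congr (_ * _).
    by rewrite mulrBl; congr (_ - _); rewrite mulrC.
  have pos i : 0 <= (lam - d 0 i) * `|y 0 i| ^+ 2.
    by rewrite mulr_ge0 ?exprn_ge0 // subr_ge0; apply: k_max.
  move=> le0; have /eqP := le_anti (introT andP (conj le0 (sumr_ge0 _ (fun i _ => pos i)))).
  rewrite psumr_eq0 => [/allP all0|i _]; last exact: pos.
  rewrite uy A_eq !mulmxA -(mulmxA y) PPt mulmx1 scalemxAl; congr (_ *m _).
  apply/rowP => i; rewrite mul_mx_diag !mxE.
  have := all0 i (mem_index_enum i); rewrite mulf_eq0 expf_eq0 /= normr_eq0.
  by case/orP => [|/eqP ->]; rewrite ?mul0r ?mulr0 // subr_eq0 mulrC => /eqP ->.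
pose x := row k P; pose z : 'rV[algC]_n := \row_i `|x 0 i|.
have xA : x *m A = lam *: x.
  rewrite A_eq !mulmxA -row_mul PPt row1 -rowE row_diag_mx -scalemxAl -rowE //.
have zt : z^t* = z^T.
  by apply/matrixP => i j; rewrite !mxE; apply: CrealP; rewrite normr_real.
(* Absolute values keep the norm of [x] and, the entries of [A] being positive, do not lower its
   quadratic form. *)
have zA : z *m A = lam *: z.
  have subE (M N : 'M[algC]_1) : (M - N) 0 0 = M 0 0 - N 0 0 by rewrite !mxE.
  apply: top; rewrite subE subr_le0.
  have -> : (lam *: z *m z^t*) 0 0 = (x *m A *m x^t*) 0 0.
    rewrite xA !mxE; apply: eq_bigr => i _.
    rewrite !mxE -!mulrA; congr (_ * _).
    by rewrite -normCK (CrealP _) ?normr_real // expr2.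
  apply: (@le_trans _ _ `|(x *m A *m x^t*) 0 0|).
    apply: real_ler_norm; rewrite xA !mxE rpred_sum // => i _.
    by rewrite !mxE -mulrA -normCK rpredM ?rpredX ?normr_real // d_real.
  rewrite !mxE (le_trans (ler_norm_sum _ _ _)) // ler_sum // => i _.
  rewrite normrM !mxE norm_conjC (CrealP _) ?normr_real //.
  rewrite ler_wpM2r // (le_trans (ler_norm_sum _ _ _)) // ler_sum // => j _.
  by rewrite !mxE normrM [X in _ * X]gtr0_norm.
have [j z_j] : exists j, 0 < z 0 j.
  have [/existsP//|] := boolP [exists j, 0 < z 0 j].
  rewrite negb_exists => /forallP z0.
  have x0 : x = 0.
    apply/rowP => j; rewrite !mxE; apply/eqP.
    by have := z0 j; rewrite !mxE normr_gt0 negbK.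
  have := row_unitarymxP P_unit k k; rewrite eqxx -/x x0 dotmxE mul0mx mxE => /eqP.
  by rewrite eq_sym oner_eq0.
have zAE a : \sum_b g a b * z 0 b = lam * z 0 a.
  have /rowP/(_ a) := zA; rewrite !mxE => <-.
  by apply: eq_bigr => b _; rewrite [X in _ = X * _]mxE !mxE mulrC g_sym.
exists (fun a => z 0 a), lam; split=> // a.
have z_ge0 b : 0 <= z 0 b by rewrite mxE.
(* A zero entry would make a combination of the entries of [z] with positive coefficients vanish,
   against [z_j]. *)
rewrite lt0r z_ge0 andbT; apply: contraTneq (z_j) => za0.
have := zAE a; rewrite za0 mulr0 => /eqP.
rewrite psumr_eq0 => [/allP/(_ j)|b _]; last by rewrite mulr_ge0 // ltW.
by rewrite mem_index_enum mulf_eq0 gt_eqF //= => /(_ isT)/eqP ->; rewrite ltxx.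
Qed.

(* The Dirichlet form [\sum_(a, b) g a b x_a x_b (u_a / x_a - u_b / x_b)^2]
   vanishes. *)
Lemma perron_unique g x u mu :
  (forall a b, g a b = g b a) -> (forall a b, 0 < g a b) ->
  (forall a, 0 < x a) -> (forall a, u a \is Num.real) ->
  (forall a, \sum_b g a b * x b = mu a * x a) ->
  (forall a, \sum_b g a b * u b = mu a * u a) ->
  forall a b, u a * x b = u b * x a.
Proof.
move=> g_sym g_gt0 x_gt0 u_real gx gu.
have x0 a : x a != 0 by rewrite gt_eqF.
have [t ut] : exists t, forall a, u a = t a * x a.
  by exists (fun a => u a / x a) => a; rewrite divfK.
have t_real a : t a \is Num.real.
  by rewrite -[t a](mulfK (x0 a)) -ut rpred_div // gtr0_real.
(* Expand the square: the equation for [x] evaluates the two square terms and the equation for [u]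
   the cross term, and all three give the same sum. *)
have sum0 : \sum_a \sum_b g a b * x a * x b * (t a - t b) ^+ 2 = 0.
  have E1 : \sum_a \sum_b g a b * x a * x b * t a ^+ 2 = \sum_a mu a * u a ^+ 2.
    apply: eq_bigr => a _; rewrite ut exprMn.
    rewrite [X in X = _](_ : _ = (\sum_b g a b * x b) * (x a * t a ^+ 2)).
      by rewrite gx; ring.
    by rewrite mulr_suml; apply: eq_bigr => b _; ring.
  have E2 : \sum_a \sum_b g a b * x a * x b * t b ^+ 2 = \sum_a mu a * u a ^+ 2.
    rewrite exchange_big -E1; apply: eq_bigr => a _; apply: eq_bigr => b _.
    by rewrite g_sym; ring.
  have E3 : \sum_a \sum_b g a b * x a * x b * (t a * t b) = \sum_a mu a * u a ^+ 2.
    apply: eq_bigr => a _; rewrite expr2 mulrA -gu mulr_suml; apply: eq_bigr => b _.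
    by rewrite !ut; ring.
  transitivity (\sum_a mu a * u a ^+ 2 + \sum_a mu a * u a ^+ 2
                - (\sum_a mu a * u a ^+ 2) *+ 2); last by rewrite mulr2n subrr.
  rewrite -{1}E1 -{1}E2 -E3 -sumrMnl -!big_split -sumrB /=.
  apply: eq_bigr => a _; rewrite -sumrMnl -!big_split -sumrB /=.
  by apply: eq_bigr => b _; ring.
have pos a b : 0 <= g a b * x a * x b * (t a - t b) ^+ 2.
  by apply: mulr_ge0; [rewrite ltW // !mulr_gt0 | rewrite -realEsqr rpredB].
move=> a b; suff -> : u a = t b * x a by rewrite (ut b) mulrAC.
rewrite ut; congr (_ * _); apply/eqP; rewrite -subr_eq0 -sqrf_eq0.
move/eqP: sum0; rewrite psumr_eq0 => [/allP/(_ a (mem_index_enum a))|c _]; last first.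
  by rewrite sumr_ge0.
rewrite psumr_eq0 // => /allP/(_ b (mem_index_enum b)) /=.
by rewrite !mulf_eq0 !(negbTE (x0 _)) gt_eqF.
Qed.

End Perron.

(** * Functions additive on direct sums *)

Section AdditiveFunctions.
Variables (K : fieldType) (C : linCat K).
Hypothesis sepC : fin_separable C.
Variable S : family_of_objects C.
Hypothesis hS : enumerates_simples S.
Implicit Types (X Y Z : C) (f : C -> algC).

Let fin := fs_findim sepC.
Local Notation simp := (@fam _ _ S).

Let d_gt0 (i : 'I_(fam_size S)) : 0 < (sdim i)%:R :> algC.
Proof. rewrite ltr0n; exact: sdim_gt0. Qed.

Definition dsum_additive f : Prop := forall (J : finType) (F : J -> C) X,
  is_direct_sum F X -> f X = \sum_j f (F j).

Lemma additive_iso f X Y : dsum_additive f -> isomorphic X Y -> f X = f Y.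
Proof. by move=> af /direct_sum_iso/af ->; rewrite big_unit. Qed.

Lemma additive_mult f X : dsum_additive f ->
  f X = \sum_i f (simp i) * (mult S X i)%:R.
Proof.
move=> af; rewrite (af _ _ _ (multP sepC hS X)) (sum_tagged _ (fun i => f (simp i))).
by apply: eq_bigr => i _; rewrite mulr_natr.
Qed.

Lemma multE X i : (mult S X i)%:R = (hdim (simp i) X)%:R / (sdim i)%:R :> algC.
Proof.
rewrite (hdim_mult sepC hS) natrM mulfK // pnatr_eq0 -lt0n.
exact: sdim_gt0.
Qed.

(** Expressing [f] through the functions [hdim (simp i)] lets an adjunction act on it. *)
Lemma additive_hdim X f : dsum_additive f ->
  f X = \sum_i (f (simp i) / (sdim i)%:R) * (hdim (simp i) X)%:R.
Proof.
move=> af; rewrite (additive_mult X af).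
by apply: eq_bigr => i _; rewrite multE mulrA mulrAC.
Qed.

Lemma additive_hdimr Z : dsum_additive (fun X => (hdim Z X)%:R).
Proof. by move=> J F X /hdim_sumr -> //; rewrite natr_sum. Qed.

Lemma additive_hdiml Z : dsum_additive (fun X => (hdim X Z)%:R).
Proof. by move=> J F X /hdim_suml -> //; rewrite natr_sum. Qed.

Lemma additive_sum I (r : seq I) (F : I -> C -> algC) :
  (forall i, dsum_additive (F i)) -> dsum_additive (fun X => \sum_(i <- r) F i X).
Proof.
move=> aF J G X dX; rewrite exchange_big; apply: eq_bigr => i _.
by rewrite (aF i _ _ _ dX).
Qed.

Lemma additive_scale a f : dsum_additive f -> dsum_additive (fun X => a * f X).
Proof. by move=> af J F X dX; rewrite (af _ _ _ dX) mulr_sumr. Qed.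

Definition extend (v : 'I_(fam_size S) -> algC) X : algC :=
  \sum_i v i * (mult S X i)%:R.

Lemma extend_additive v : dsum_additive (extend v).
Proof.
apply: additive_sum => i; apply: additive_scale => J F X dX.
rewrite multE (hdim_sumr _ fin dX) natr_sum mulr_suml; apply: eq_bigr => j _.
by rewrite multE.
Qed.

Lemma extend_simple v i : extend v (simp i) = v i.
Proof.
rewrite /extend (bigD1 i) //= multE -/(sdim i) divff ?mulr1; last first.
  by rewrite pnatr_eq0 -lt0n (sdim_gt0 sepC hS).
rewrite big1 ?addr0 // => j ji.
by rewrite multE (hdim_simples sepC hS) (negbTE ji) mul0r mulr0.
Qed.

(** After decomposing both objects only pairs of equal simple objects contribute, and these terms
    are symmetric. *)
Lemma hdim_sym X Y : hdim X Y = hdim Y X.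
Proof.
apply/eqP; rewrite -(eqr_nat algC); apply/eqP.
rewrite (additive_mult Y (additive_hdimr X)) (additive_mult Y (additive_hdiml X)).
apply: eq_bigr => i _; congr (_ * _).
rewrite (additive_mult X (additive_hdimr (simp i))).
rewrite (additive_mult X (additive_hdiml (simp i))).
apply: eq_bigr => j _; rewrite !(hdim_simples sepC hS) [j == i]eq_sym.
by case: eqP => // ->.
Qed.

Lemma additive_ge0 f X : dsum_additive f -> (forall i, 0 <= f (simp i)) -> 0 <= f X.
Proof.
move=> af f_ge0; rewrite (additive_mult X af); apply: sumr_ge0 => i _.
by rewrite mulr_ge0 ?ler0n.
Qed.

(** * Perron functionals of a family of functors with adjoints *)

Section PerronFunctional.
Variables (I : finType) (F F' : I -> linFunctor C C).
Hypothesis adjF : forall k A B, hdim (F' k A) B = hdim A (F k B).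
Hypothesis hub : forall a b, exists k l
  (f : Hom (F l (simp a)) (F k (simp b))), f <> 0.

(** By [adjF] this operator has matrix [g] below on the values [f (simp b) / sdim b]. The double sum
    makes [g] symmetric, by exchanging [k] and [l], and positive, by [hub]. *)
Definition transfer f X : algC := \sum_k \sum_l f (F' k (F l X)).

Lemma transfer_additive f : dsum_additive f -> dsum_additive (transfer f).
Proof.
move=> af; apply: additive_sum => k; apply: additive_sum => l J G X dX.
exact: (af _ _ _ (functor_direct_sum _ (functor_direct_sum _ dX))).
Qed.

Let g a b : algC := \sum_k \sum_l (hdim (F l (simp a)) (F k (simp b)))%:R.

Let g_sym a b : g a b = g b a.
Proof.
rewrite /g exchange_big; apply: eq_bigr => k _; apply: eq_bigr => l _.
by rewrite hdim_sym.
Qed.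

Let g_gt0 a b : 0 < g a b.
Proof.
have [k [l [f /(hdim_gt0 sepC) f0]]] := hub a b.
rewrite /g (bigD1 k) //= (bigD1 l) //= -addrA ltr_wpDr ?ltr0n //.
by rewrite addr_ge0 ?sumr_ge0 // => *; rewrite ?sumr_ge0.
Qed.

Let transferE f a : dsum_additive f ->
  \sum_b g a b * (f (simp b) / (sdim b)%:R) = transfer f (simp a).
Proof.
move=> af; rewrite /transfer.
transitivity (\sum_k \sum_l \sum_b
    f (simp b) / (sdim b)%:R * (hdim (F l (simp a)) (F k (simp b)))%:R).
  rewrite /g; under eq_bigr => b _ do rewrite mulr_suml.
  rewrite exchange_big; apply: eq_bigr => k _.
  under eq_bigr => b _ do rewrite mulr_suml.
  rewrite exchange_big; apply: eq_bigr => l _.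
  by apply: eq_bigr => b _; rewrite mulrC.
apply: eq_bigr => k _; apply: eq_bigr => l _; rewrite (additive_hdim _ af).
by apply: eq_bigr => b _; rewrite -adjF hdim_sym.
Qed.

Lemma perron_functional : (0 < fam_size S)%N -> exists f lam,
  [/\ dsum_additive f, forall i, 0 < f (simp i) & forall X, transfer f X = lam * f X].
Proof.
(* The eigenvalue problem is [\sum_b g a b * f b / sdim b = lam * f a]; conjugation by the square
   roots of [sdim] makes its matrix symmetric. *)
move=> S_gt0; pose s (i : 'I_(fam_size S)) : algC := sqrtC (sdim i)%:R.
have s_gt0 i : 0 < s i by rewrite sqrtC_gt0 d_gt0.
have s0 i : s i != 0 by rewrite gt_eqF.
have ss i : (sdim i)%:R = s i * s i by rewrite -expr2 sqrtCK.
have [||x [lam [x_gt0 xP]]] := @perron_vector _ (fun a b => g a b / (s a * s b)) S_gt0.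
- by move=> a b; rewrite g_sym [s a * _]mulrC.
- by move=> a b; rewrite divr_gt0 ?mulr_gt0.
pose f := extend (fun i => s i * x i); exists f, lam.
have af : dsum_additive f by exact: extend_additive.
split=> // [i | X]; first by rewrite /f extend_simple mulr_gt0.
rewrite (additive_mult X (transfer_additive af)) (additive_mult X af) mulr_sumr.
apply: eq_bigr => a _; rewrite mulrA; congr (_ * _); rewrite -transferE //.
rewrite /f extend_simple mulrCA -xP mulr_sumr; apply: eq_bigr => b _.
rewrite extend_simple ss; have := s0 a; have := s0 b.
by move: (s a) (s b) => sa sb sa0 sb0; field; rewrite sa0 sb0.
Qed.

(** The values divided by [sdim] solve the same generalised problem, with [mu a = lam * sdim a], so
    [perron_unique] applies. Only [f1] has to be positive, and the cross-multiplied form avoids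
    dividing by its values. *)
Lemma perron_functional_unique f1 f2 lam : dsum_additive f1 -> dsum_additive f2 ->
  (forall i, 0 < f1 (simp i)) -> (forall i, f2 (simp i) \is Num.real) ->
  (forall X, transfer f1 X = lam * f1 X) -> (forall X, transfer f2 X = lam * f2 X) ->
  forall X Y, f2 X * f1 Y = f2 Y * f1 X.
Proof.
move=> a1 a2 f1_gt0 f2_real t1 t2.
have d0 (i : 'I_(fam_size S)) : (sdim i)%:R != 0 :> algC by rewrite gt_eqF.
have key a b : f2 (simp a) * f1 (simp b) = f2 (simp b) * f1 (simp a).
  have e f : (forall X, transfer f X = lam * f X) -> dsum_additive f -> forall a,
      \sum_b g a b * (f (simp b) / (sdim b)%:R) =
      lam * (sdim a)%:R * (f (simp a) / (sdim a)%:R).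
    by move=> tf af c; rewrite transferE // tf mulrACA divff // mulr1.
  have := @perron_unique _ g (fun a => f1 (simp a) / (sdim a)%:R)
    (fun a => f2 (simp a) / (sdim a)%:R) (fun a => lam * (sdim a)%:R) g_sym g_gt0
    (fun a => divr_gt0 (f1_gt0 a) (d_gt0 a))
    (fun a => rpred_div (f2_real a) (gtr0_real (d_gt0 a))) (e _ t1 a1) (e _ t2 a2) a b.
  have cancel_den (x y z w p q : algC) : p != 0 -> q != 0 ->
      x / p * (y / q) = z / q * (w / p) -> x * y = z * w.
    move=> p0 q0 h; have -> : x * y = x / p * (y / q) * (p * q) by field; rewrite p0 q0.
    by rewrite h; field; rewrite p0 q0.
  by apply: cancel_den; exact: d0.
move=> X Y; rewrite (additive_mult X a1) (additive_mult Y a1).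
rewrite (additive_mult X a2) (additive_mult Y a2) !mulr_suml.
under eq_bigr => i _ do rewrite mulr_sumr.
under [RHS]eq_bigr => i _ do rewrite mulr_sumr.
rewrite exchange_big; apply: eq_bigr => i _; apply: eq_bigr => j _.
by rewrite mulrACA key [RHS]mulrACA; congr (_ * _); exact: mulrC.
Qed.

End PerronFunctional.
End AdditiveFunctions.

(** * Modules over a separable algebra *)

Section Equivalence.
Variable K : fieldType.

Lemma nat_iso_faithful (C : linCat K) (F : linFunctor C C) X Y (f g : Hom X Y) :
  nat_isomorphic F (functor_id C) -> fhom F f = fhom F g -> f = g.
Proof.
move=> [eta [eta_iso eta_nat]] fg.
have [u [_ eu]] := eta_iso X.
have := eta_nat _ _ f; rewrite fg eta_nat /= => /(congr1 (comp^~ u)).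
by rewrite -!comp_assoc eu !comp_idr.
Qed.

Variables C D : linCat K.

Lemma equivalent_ff : equivalent C D -> exists (F : linFunctor C D)
    (FV : forall X Y, Hom (F X) (F Y) -> Hom X Y),
  [/\ forall X Y, cancel (@fhom _ _ _ F X Y) (FV X Y),
      forall X Y, cancel (FV X Y) (@fhom _ _ _ F X Y)
    & forall Y, exists X, isomorphic (F X) Y].
Proof.
move=> [F [G [eta eps]]]; exists F.
have faith X Y (f g : Hom X Y) : fhom F f = fhom F g -> f = g.
  move=> fg; apply: (nat_iso_faithful eta); by rewrite /= fg.
have full X Y (h : Hom (F X) (F Y)) : exists f, fhom F f = h.
  have [e [e_iso e_nat]] := eta.
  have [u [ue eu]] := e_iso X; have [v [ve ev]] := e_iso Y.
  (* The preimage is [fhom G h] conjugated by the unit of the equivalence. It suffices to compare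
     after [G], which is faithful as well. *)
  exists (e Y ∘ fhom G h ∘ u).
  have GF_faith A B (f g : Hom A B) : fhom G f = fhom G g -> f = g.
    by move=> fg; apply: (nat_iso_faithful eps); rewrite /= fg.
  apply: GF_faith; have := e_nat _ _ (e Y ∘ fhom G h ∘ u).
  move/(congr1 (comp v)); rewrite /= !comp_assoc ve !comp_idl => ->.
  by rewrite -comp_assoc ue comp_idr.
exists (fun X Y h => sval (cid (full X Y h))); split=> [X Y f | X Y h | Y].
- by apply: faith; case: cid.
- by case: cid.
- have [e [e_iso _]] := eps; exists (G Y).
  by exists (e Y); exact: e_iso.
Qed.

Lemma fin_separable_equivalent : equivalent C D -> fin_separable D -> fin_separable C.
Proof.
move=> /equivalent_ff[F [FV [FK FVK ess]]] [fin [G [s [[s1 sz] ret]]] spl].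
have lFV X Y : linear (FV X Y) := linear_can (fhom_lin F (Y := Y)) (@FK X Y) (@FVK X Y).
have FVcomp X Y Z (g : Hom (F Y) (F Z)) (f : Hom (F X) (F Y)) :
  FV _ _ (g ∘ f) = FV _ _ g ∘ FV _ _ f.
  by rewrite -[RHS]FK fhom_comp !FVK.
have FVid X : FV X X (idm (F X)) = idm X by rewrite -fhom_id FK.
have [G' [u [v [vu uv]]]] := ess G.
split.
- by move=> X Y; apply: (findim_sub (fhom_lin F (Y := Y)) (can_inj (@FK X Y))).
- pose c (a : Hom G G) : Hom G' G' := FV _ _ (v ∘ a ∘ u).
  have lc : linear c.
    by move=> a x y; rewrite /c -lFV; congr (FV _ _ _); rewrite compDr compDl compZr compZl.
  have cM a b : c (a ∘ b) = c a ∘ c b.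
    by rewrite /c -FVcomp -!comp_assoc (comp_assoc u) uv comp_idl.
  have c1 : c (idm G) = idm G' by rewrite /c comp_idr vu FVid.
  have c_surj z : exists z', c z' = z.
    exists (u ∘ fhom F z ∘ v); rewrite /c !comp_assoc vu comp_idl.
    by rewrite -comp_assoc vu comp_idr FK.
  exists G', [seq (c x.1, c x.2) | x <- s]; split.
    split; first by rewrite big_map -c1 -s1 lin_sum //; apply: eq_bigr => x _; rewrite cM.
    move=> V b [bl br] z; rewrite !big_map /=; have [z' <-] := c_surj z.
    transitivity (\sum_(x <- s) b (c (z' ∘ x.1)) (c x.2)).
      by apply: eq_bigr => x _; rewrite cM.
    rewrite (sz _ (fun a a' => b (c a) (c a'))); last first.
      split=> [a | a]; first exact: (linear_comp (bl _) lc).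
      exact: (linear_comp (br _) lc).
    by apply: eq_bigr => x _; rewrite cM.
  move=> X; have [r rX] := ret (F X).
  exists [seq (FV G' X (x.1 ∘ u), FV X G' (v ∘ x.2)) | x <- r].
  rewrite big_map /= -FVid -rX lin_sum //; apply: eq_bigr => x _.
  by rewrite -FVcomp -!comp_assoc (comp_assoc u) uv comp_idl.
- move=> X p pp; have [|Y [i [q [qi iq]]]] := spl _ (fhom F p).
    by rewrite -fhom_comp pp.
  have [Z [a [b [ba ab]]]] := ess Y.
  exists Z, (FV _ _ (i ∘ a)), (FV _ _ (b ∘ q)); split.
    rewrite -FVcomp -FVid; congr (FV _ _ _).
    by rewrite -!comp_assoc (comp_assoc q) qi comp_idl.
  rewrite -FVcomp -[RHS]FK; congr (FV _ _ _).
  by rewrite -!comp_assoc (comp_assoc a) ab comp_idl iq.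
Qed.

End Equivalence.

Section Modules.
Variables (K : fieldType) (A : falgType K).
Implicit Types M N : amod A.

Lemma amod_eval_linear M N (m : M) : linear (fun f : amod_hom M N => amod_fun f m).
Proof. by move=> a f g; rewrite /= add_lfunE scale_lfunE. Qed.

Lemma amod_homP M N (f g : amod_hom M N) : (forall m, amod_fun f m = amod_fun g m) -> f = g.
Proof. by move=> h; apply: val_inj; apply/lfunP. Qed.

Lemma amod_homE M N (f : amod_hom M N) a m : amod_fun f (act M a m) = act N a (amod_fun f m).
Proof.
case: f => f /= /asboolP/(_ a) h; by rewrite -!comp_lfunE h.
Qed.

Lemma amod_hom_exists M N (f : M -> N) : linear f ->
  (forall a m, f (act M a m) = act N a (f m)) ->
  exists g : amod_hom M N, forall m, amod_fun g m = f m.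
Proof.
move=> lf fA.
pose fl : {linear M -> N} := GRing.Linear.Pack (GRing.Linear.Class
  (GRing.isNmodMorphism.Build _ _ f (conj (lin_0 lf) (lin_D lf)))
  (GRing.isScalable.Build _ _ _ _ f (lin_Z lf))).
have E m : linfun fl m = f m by rewrite lfunE.
suff h : linfun fl \in @amod_linear _ _ M N by exists (AModHom h) => m; rewrite /= E.
by apply/asboolP => a; apply/lfunP => m; rewrite !comp_lfunE !E fA.
Qed.


Lemma amod_findim : hom_findim (amod_cat A).
Proof.
move=> M N.
have h : findim ('Hom(M, N) : lmodType K).
  pose b := vbasis {: 'Hom(M, N)}.
  exists (\dim {: 'Hom(M, N)}), 'I_(\dim {: 'Hom(M, N)}), (fun i : 'I_(\dim {: 'Hom(M, N)}) => b`_i).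
  split; first exact: card_ord.
  split=> [v | c h i]; last exact: (elimT freeP (basis_free (vbasisP fullv)) c h i).
  by exists (fun i => coord b i v); apply: coord_vbasis; exact: memvf.
by apply: (findim_sub (f := fun f : amod_hom M N => amod_fun f) _ val_inj h) => a f g.
Qed.

Lemma linear_map (V W : lmodType K) (f : V -> W) : linear f ->
  exists g : {linear V -> W}, forall v, g v = f v.
Proof.
move=> lf.
by exists (GRing.Linear.Pack (GRing.Linear.Class
  (GRing.isNmodMorphism.Build _ _ f (conj (lin_0 lf) (lin_D lf)))
  (GRing.isScalable.Build _ _ _ _ f (lin_Z lf)))).
Qed.

Lemma amod_split : split_idempotents (amod_cat A).
Proof.
move=> M p pp; pose U := limg (amod_fun p).
have pK m : amod_fun p (amod_fun p m) = amod_fun p m.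
  by have := congr1 (fun f : amod_hom M M => amod_fun f m) pp; rewrite /= comp_lfunE.
have pU m : amod_fun p m \in U by rewrite memv_img ?memvf.
have [i [q [iq qi]]] : exists (i : 'Hom(subvs_of U, M)) (q : 'Hom(M, subvs_of U)),
    (forall m, i (q m) = amod_fun p m) /\ forall u, q (i u) = u.
  pose i : 'Hom(subvs_of U, M) := linfun vsval.
  pose q : 'Hom(M, subvs_of U) := (linfun (vsproj U) \o amod_fun p)%VF.
  have iE u : i u = vsval u by rewrite lfunE.
  have iq m : i (q m) = amod_fun p m by rewrite iE comp_lfunE /= lfunE /= vsprojK.
  exists i, q; split=> // u; apply: val_inj; rewrite /= -iE iq iE.
  by have /memv_imgP[m _ ->] := subvsP u; rewrite pK.
have iI u u' : i u = i u' -> u = u' by move=> h; rewrite -[u]qi h qi.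
have [act' actE] : exists g : {linear A -> 'End(subvs_of U)},
    forall a, g a = (q \o act M a \o i)%VF.
  apply: linear_map => k a b; apply/lfunP => u.
  rewrite add_lfunE scale_lfunE !comp_lfunE.
  by rewrite (linearP (act M)) add_lfunE scale_lfunE !linearP.
have iact a u : i (act' a u) = act M a (i u).
  rewrite actE !comp_lfunE iq amod_homE; congr (act M a _).
  by rewrite -iq qi.
have a1 : act' 1 = \1%VF.
  by apply/lfunP => u; apply: iI; rewrite iact act1 !id_lfunE.
have aM a b : act' (a * b) = (act' a \o act' b)%VF.
  by apply/lfunP => u; apply: iI; rewrite comp_lfunE !iact actM comp_lfunE.
pose N := AMod a1 aM.
have [||i' i'E] := @amod_hom_exists N M (fun u => i u).
- by move=> k a b; rewrite linearP.
- by move=> a u; exact: iact.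
have [||q' q'E] := @amod_hom_exists M N (fun u => q u).
- by move=> k a b; rewrite linearP.
- by move=> a u; apply: iI; rewrite iact !iq amod_homE.
exists N, i', q'; split; apply: amod_homP => u /=; rewrite comp_lfunE i'E q'E.
  by rewrite qi id_lfunE.
exact: iq.
Qed.

Definition amod_regular : amod A.
Proof.
apply: (@AMod _ A A (@amull K A)); first exact: amull1.
by move=> a b; apply/lfunP => u; rewrite comp_lfunE !lfunE /= mulrA.
Defined.

Lemma amod_regularE (a b : A) : act amod_regular a b = a * b :> A.
Proof. by rewrite lfunE. Qed.

Local Notation n := (\dim {:A}).
Local Notation e := (vbasis {:A}).

(** The idempotent is [s 1]: the bimodule property computes [s a] both as [a] acting on the left and
    as [a] acting on the right of [s 1]. *)
Lemma separability_idempotent : separable_alg A -> exists M : 'M[K]_n,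
  tensor2_mul M = 1 /\ forall (V : lmodType K) (b : A -> A -> V), bilinear b ->
  forall a, \sum_i \sum_j M i j *: b (a * e`_i) e`_j =
            \sum_i \sum_j M i j *: b e`_i (e`_j * a).
Proof.
move=> [s [sP s1]]; exists (s 1); split=> [|V b bb a]; first exact: s1.
(* The linear map on the matrix model of [A ⊗ A] induced by a bilinear map [c]. *)
pose hat (c : A -> A -> V) (N : 'M[K]_n) := \sum_i \sum_j N i j *: c e`_i e`_j.
have hat_lin c : linear (hat c).
  move=> k N N'; rewrite /hat scaler_sumr -big_split; apply: eq_bigr => i _.
  rewrite scaler_sumr -big_split; apply: eq_bigr => j _.
  by rewrite !mxE scalerDl scalerA.
have hat_tensor c x y : bilinear c -> hat c (tensor2 x y) = c x y.
  move=> [cl cr]; rewrite [in RHS](coord_vbasis (memvf x)) (lin_sum (cl y)).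
  apply: eq_bigr => i _; rewrite (lin_Z (cl y)) [in RHS](coord_vbasis (memvf y)).
  rewrite (lin_sum (cr _)) scaler_sumr; apply: eq_bigr => j _.
  by rewrite mxE (lin_Z (cr _)) scalerA.
have hat_l c (x : A) (N : 'M_n) : bilinear c -> hat c (tensor2_lact x N) = hat (fun u v => c (x * u) v) N.
  move=> bc; rewrite /tensor2_lact (lin_sum (hat_lin _)); apply: eq_bigr => i _.
  rewrite (lin_sum (hat_lin _)); apply: eq_bigr => j _.
  by rewrite (lin_Z (hat_lin _)) hat_tensor.
have hat_r c (x : A) (N : 'M_n) : bilinear c -> hat c (tensor2_ract N x) = hat (fun u v => c u (v * x)) N.
  move=> bc; rewrite /tensor2_ract (lin_sum (hat_lin _)); apply: eq_bigr => i _.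
  rewrite (lin_sum (hat_lin _)); apply: eq_bigr => j _.
  by rewrite (lin_Z (hat_lin _)) hat_tensor.
have bl (x : A) : bilinear (fun u v => b (x * u) v).
  case: bb => [b1 b2]; split=> u; last exact: b2.
  by move=> k v w; rewrite mulrDr -scalerAr b1.
have L1 : hat b (s a) = hat (fun u v => b (a * u) v) (s 1).
  have := sP a 1 1; rewrite !mulr1 => ->; rewrite hat_l // hat_r //.
  by apply: eq_bigr => i _; apply: eq_bigr => j _; rewrite mulr1.
have L2 : hat b (s a) = hat (fun u v => b u (v * a)) (s 1).
  have := sP 1 1 a; rewrite !mul1r => ->; rewrite hat_l // hat_r //.
  by apply: eq_bigr => i _; apply: eq_bigr => j _; rewrite mul1r.
by rewrite -[LHS]L1 L2.
Qed.

Lemma bilinear_swap (U V W U' V' : lmodType K) (b : U -> V -> W)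
  (f : U' -> V) (g : V' -> U) : bilinear b -> linear f -> linear g ->
  bilinear (fun u v => b (g v) (f u)).
Proof.
move=> [bl br] lf lg; split=> u; first exact: (linear_comp (br _) lf).
exact: (linear_comp (bl _) lg).
Qed.

(* Every [M] is a retract of a power of [A]: the separability idempotent makes the
   coordinate functions of a [K]-basis of [M] linear over [A]. *)
Lemma amod_separated : separable_alg A -> separated (amod_cat A).
Proof.
move=> /separability_idempotent[s [s1 sP]].
pose G : amod_cat A := amod_regular.
have [r rE] : exists r : A -> Hom G G, forall c a : A, amod_fun (r c) a = a * c :> A.
  apply: (choice_dep (P := fun (c : A) (f : Hom G G) => forall a : A, amod_fun f a = a * c :> A)) => c.
  have [||f fE] := @amod_hom_exists amod_regular amod_regular (fun a : A => a * c).
  - by move=> k x y; rewrite mulrDl scalerAl.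
  - by move=> a x; rewrite !amod_regularE mulrA.
  by exists f => a; exact: fE.
have r_lin : linear r.
  move=> k x y; apply: amod_homP => a; rewrite /= add_lfunE scale_lfunE !rE.
  by rewrite mulrDr scalerAr.
have r_surj z : exists c, z = r c.
  exists (amod_fun z (1 : A)); apply: amod_homP => a; rewrite rE.
  have := @amod_homE amod_regular amod_regular z a (1 : A).
  by rewrite !amod_regularE mulr1.
have rM c c' : r c ∘ r c' = r (c' * c).
  by apply: amod_homP => a; rewrite /= comp_lfunE !rE mulrA.
(* The two factors are exchanged because endomorphisms of the regular module are right
   multiplications, which compose in the opposite order. *)
exists G, [seq (s p.1 p.2 *: r e`_p.2, r e`_p.1) | p <- enum (('I_n * 'I_n)%type : finType)].
have sumE (V : lmodType K) (F : 'I_n * 'I_n -> V) :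
    \sum_(p <- enum (('I_n * 'I_n)%type : finType)) F p = \sum_i \sum_j F (i, j).
  by rewrite big_enum /= pair_bigA /=; apply: eq_bigr => -[].
split; first split.
- rewrite big_map sumE /=; apply: amod_homP => a.
  rewrite (lin_sum (amod_eval_linear (a : amod_regular))).
  under eq_bigr => i _ do rewrite (lin_sum (amod_eval_linear (a : amod_regular))).
  rewrite /= id_lfunE -[RHS](mulr1 a) -s1 /tensor2_mul mulr_sumr.
  apply: eq_bigr => i _; rewrite mulr_sumr; apply: eq_bigr => j _.
  by rewrite comp_lfunE scale_lfunE !rE -scalerAr mulrA.
- move=> V b bb z; have [c ->] := r_surj z; rewrite [LHS]big_map [RHS]big_map [LHS]sumE [RHS]sumE /=.
  case: bb => [bl br].
  transitivity (\sum_i \sum_j s i j *: b (r (e`_j * c)) (r e`_i)).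
    apply: eq_bigr => i _; apply: eq_bigr => j _.
    by rewrite -(lin_Z (bl _)) -rM -compZr.
  rewrite -(sP _ _ (bilinear_swap (conj bl br) r_lin r_lin) c).
  apply: eq_bigr => i _; apply: eq_bigr => j _.
  by rewrite -(lin_Z (bl _)) -rM.
- move=> M; pose m := vbasis {:M}; pose d := \dim {:M}.
  have [p pE] : exists p : 'I_d -> Hom G M, forall k (a : A), amod_fun (p k) a = act M a m`_k.
    apply: (choice_dep (P := fun (k : 'I_d) (f : Hom G M) =>
      forall a : A, amod_fun f a = act M a m`_k)) => k.
    have [||f fE] := @amod_hom_exists amod_regular M (fun a : A => act M a m`_k).
    - by move=> t x y; rewrite linearP add_lfunE scale_lfunE.
    - by move=> a x; rewrite amod_regularE actM comp_lfunE.
    by exists f => a; exact: fE.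
  pose q0 (k : 'I_d) (v : M) : A := \sum_i \sum_j s i j *: (coord m k (act M e`_j v) *: e`_i).
  have [q qE] : exists q : 'I_d -> Hom M G, forall k v, amod_fun (q k) v = q0 k v :> A.
    apply: (choice_dep (P := fun (k : 'I_d) (f : Hom M G) =>
      forall v, amod_fun f v = q0 k v :> A)) => k.
    have [||f fE] := @amod_hom_exists M amod_regular (q0 k).
    - move=> t x y; rewrite /q0 scaler_sumr -big_split; apply: eq_bigr => i _.
      rewrite scaler_sumr -big_split; apply: eq_bigr => j _.
      rewrite !linearP /= scalerDl scalerDr !scalerA; congr (_ *: _ + _).
      by rewrite -mulrA mulrCA.
    - move=> a v; rewrite amod_regularE /q0 mulr_sumr.
      have bb : bilinear (fun x y : A => coord m k (act M y v) *: x).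
        split=> [y t x x' | x t y y']; first by rewrite scalerDr !scalerA mulrC.
        by rewrite linearP add_lfunE scale_lfunE linearP /= scalerDl scalerA.
      under eq_bigr => i _ do under eq_bigr => j _ do rewrite -comp_lfunE -actM.
      rewrite -(sP _ _ bb a); apply: eq_bigr => i _; rewrite mulr_sumr.
      by apply: eq_bigr => j _; rewrite -!scalerAr.
    by exists f => v; exact: fE.
  exists [seq (p k, q k) | k <- enum 'I_d].
  rewrite big_map big_enum /=; apply: amod_homP => v.
  rewrite (lin_sum (amod_eval_linear v)) /= id_lfunE.
  transitivity (\sum_k \sum_i \sum_j s i j *: (coord m k (act M e`_j v) *: act M e`_i m`_k)).
    apply: eq_bigr => k _; rewrite comp_lfunE pE qE /q0 linear_sum sum_lfunE.
    apply: eq_bigr => i _; rewrite linear_sum sum_lfunE; apply: eq_bigr => j _.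
    by rewrite (linearZ_LR (act M)) (linearZ_LR (act M)) !scale_lfunE.
  transitivity (act M (tensor2_mul s) v); last by rewrite s1 act1 id_lfunE.
  rewrite exchange_big /tensor2_mul linear_sum sum_lfunE; apply: eq_bigr => i _.
  rewrite exchange_big linear_sum sum_lfunE; apply: eq_bigr => j _.
  rewrite (linearZ_LR (act M)) scale_lfunE -scaler_sumr; congr (_ *: _).
  rewrite actM comp_lfunE; set w := act M e`_j _.
  rewrite [in RHS](coord_vbasis (memvf w)) linear_sum; apply: eq_bigr => k _.
  by rewrite (linearZ_LR (act M _)).
Qed.

Lemma amod_fin_separable : separable_alg A -> fin_separable (amod_cat A).
Proof.
move=> sA; split; [exact: amod_findim | exact: amod_separated | exact: amod_split].
Qed.

End Modules.

Lemma separable_cat_fin_separable (K : fieldType) (C : linCat K) : separable_cat C -> fin_separable C.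
Proof. by move=> [A [sA eA]]; apply: fin_separable_equivalent eA _; exact: amod_fin_separable. Qed.

(** * Coherence, adjunctions and duals *)

Section Whiskering.
Variables (K : fieldType) (C : linCat K).
Implicit Types X Y Z V : C.

Lemma whisk X Y Y' Z V (k : Hom Z V) (a : Hom Y Z) (b : Hom X Y) (c : Hom Y' Z)
  (d : Hom X Y') : a ∘ b = c ∘ d -> k ∘ a ∘ b = k ∘ c ∘ d.
Proof. by move=> h; rewrite -!comp_assoc h. Qed.

Lemma whisk1 X Y Z V (k : Hom Z V) (a : Hom Y Z) (b : Hom X Y) (c : Hom X Z) :
  a ∘ b = c -> k ∘ a ∘ b = k ∘ c.
Proof. by move=> h; rewrite -!comp_assoc h. Qed.

Lemma cancelr X Y Z (k : Hom Y Z) (a : Hom X Y) (b : Hom Y X) :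
  a ∘ b = idm Y -> k ∘ a ∘ b = k.
Proof. by move=> h; rewrite (whisk1 _ h) comp_idr. Qed.

Lemma inv_nat X X' Y Y' (a : Hom X X') (b : Hom X' X) (c : Hom Y Y') (d : Hom Y' Y)
    (f : Hom X Y) (g : Hom X' Y') :
  a ∘ b = idm X' -> d ∘ c = idm Y -> c ∘ f = g ∘ a -> d ∘ g = f ∘ b.
Proof.
move=> ab dc h; rewrite -[f ∘ b]comp_idl -dc -!comp_assoc (comp_assoc c) h.
by rewrite -comp_assoc ab comp_idr.
Qed.

Lemma iso_epi X Y Z (a : Hom X Y) (b : Hom Y X) (f g : Hom Y Z) :
  a ∘ b = idm Y -> f ∘ a = g ∘ a -> f = g.
Proof. by move=> ab h; rewrite -[f]comp_idr -ab comp_assoc h -comp_assoc ab comp_idr. Qed.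

Lemma iso_mono X Y Z (a : Hom X Y) (b : Hom Y X) (f g : Hom Z X) :
  b ∘ a = idm X -> a ∘ f = a ∘ g -> f = g.
Proof. by move=> ba h; rewrite -[f]comp_idl -ba -comp_assoc h comp_assoc ba comp_idl. Qed.

End Whiskering.

Section Coherence.
Variables (K : fieldType) (C : monCat K).
Implicit Types W X Y Z : C.

Lemma tensl_comp X X' X'' Y (f : Hom X' X'') (g : Hom X X') :
  (f ∘ g) ⊗m idm Y = (f ⊗m idm Y) ∘ (g ⊗m idm Y).
Proof. by rewrite -tensm_comp comp_idl. Qed.

Lemma tensr_comp X Y Y' Y'' (f : Hom Y' Y'') (g : Hom Y Y') :
  idm X ⊗m (f ∘ g) = (idm X ⊗m f) ∘ (idm X ⊗m g).
Proof. by rewrite -tensm_comp comp_idl. Qed.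

Lemma tens_lr X X' Y Y' (f : Hom X X') (g : Hom Y Y') :
  f ⊗m g = (f ⊗m idm Y') ∘ (idm X ⊗m g).
Proof. by rewrite -tensm_comp comp_idl comp_idr. Qed.

Lemma tens_rl X X' Y Y' (f : Hom X X') (g : Hom Y Y') :
  f ⊗m g = (idm X' ⊗m g) ∘ (f ⊗m idm Y).
Proof. by rewrite -tensm_comp comp_idl comp_idr. Qed.

Lemma assocK X Y Z : assocV X Y Z ∘ assoc X Y Z = idm _.
Proof. exact: (assoc_inv X Y Z).1. Qed.
Lemma assocVK X Y Z : assoc X Y Z ∘ assocV X Y Z = idm _.
Proof. exact: (assoc_inv X Y Z).2. Qed.
Lemma lunitK X : lunitV X ∘ lunit X = idm _.
Proof. exact: (lunit_inv X).1. Qed.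
Lemma lunitVK X : lunit X ∘ lunitV X = idm _.
Proof. exact: (lunit_inv X).2. Qed.
Lemma runitK X : runitV X ∘ runit X = idm _.
Proof. exact: (runit_inv X).1. Qed.
Lemma runitVK X : runit X ∘ runitV X = idm _.
Proof. exact: (runit_inv X).2. Qed.

Lemma assocV_nat X X' Y Y' Z Z' (f : Hom X X') (g : Hom Y Y') (h : Hom Z Z') :
  assocV X' Y' Z' ∘ (f ⊗m (g ⊗m h)) = ((f ⊗m g) ⊗m h) ∘ assocV X Y Z.
Proof. exact: inv_nat (assocVK _ _ _) (assocK _ _ _) (assoc_nat f g h). Qed.

Lemma runitV_nat X Y (f : Hom X Y) : runitV Y ∘ f = (f ⊗m idm one) ∘ runitV X.
Proof. exact: inv_nat (runitVK _) (runitK _) (runit_nat f). Qed.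

Lemma tens_one_inj X Y (f g : Hom X Y) : f ⊗m idm one = g ⊗m idm one -> f = g.
Proof.
move=> h; apply: (iso_epi (runitVK X)).
by rewrite -!runit_nat h.
Qed.

(** A coherence law of Kelly: after tensoring with the unit it follows from the pentagon and the
    triangle. *)
Lemma runit_tens X Y : runit (X ⊗ Y) = (idm X ⊗m runit Y) ∘ assoc X Y one.
Proof.
apply: tens_one_inj; rewrite tensl_comp; apply: (iso_mono (assocK X Y one)).
rewrite comp_assoc assoc_nat -(triangle Y one) tensr_comp.
rewrite -!comp_assoc !(comp_assoc (idm X ⊗m assoc _ _ _)) -pentagon.
rewrite comp_assoc -assoc_nat tensm_id -comp_assoc triangle //.
Qed.

End Coherence.

(** The same category with the reversed tensor product. It converts right-handed statements into
    left-handed ones by conversion, hence the transparent definition. *)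
Definition rev_cat (K : fieldType) (C : monCat K) : monCat K.
Proof.
refine (@MonCat K C one (fun X Y : C => Y ⊗ X)
  (fun (X X' Y Y' : C) (f : Hom X X') (g : Hom Y Y') => g ⊗m f)
  _ _ (fun X Y Z : C => assocV Z Y X) (fun X Y Z : C => assoc Z Y X)
  (fun X : C => runit X) (fun X : C => runitV X)
  (fun X : C => lunit X) (fun X : C => lunitV X) _ _ _ _ _ _ _ _).
- by move=> X Y; exact: tensm_id.
- by move=> *; exact: tensm_comp.
- by move=> X Y Z; split; [exact: assocVK | exact: assocK].
- by move=> X; exact: runit_inv.
- by move=> X; exact: lunit_inv.
- by move=> *; exact: assocV_nat.
- by move=> *; exact: runit_nat.
- by move=> *; exact: lunit_nat.
- move=> W X Y Z; have P := pentagon Z Y X W.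
  have h : assoc Z Y (X ⊗ W) ∘ assoc (Z ⊗ Y) X W ∘
    ((assocV Z Y X ⊗m idm W) ∘ assocV Z (Y ⊗ X) W ∘ (idm Z ⊗m assocV Y X W)) = idm _.
    rewrite P -!comp_assoc (comp_assoc (assoc Z Y X ⊗m _)) -tensl_comp assocVK.
    rewrite tensm_id comp_idl (comp_assoc (assoc Z _ W)) assocVK comp_idl.
    by rewrite -tensr_comp assocVK tensm_id.
  rewrite -[LHS]comp_idr -h !comp_assoc (cancelr _ (assocK _ _ _)) assocK.
  by rewrite comp_idl.
- move=> X Y; apply: (iso_epi (assocVK Y one X)).
  by rewrite triangle -comp_assoc assocK comp_idr.
Defined.

Section Coherence2.
Variables (K : fieldType) (C : monCat K).
Implicit Types W X Y Z : C.

Lemma lunit_tens X Y : lunit (X ⊗ Y) = (lunit X ⊗m idm Y) ∘ assocV one X Y.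
Proof. exact: (@runit_tens K (rev_cat C) Y X). Qed.

Lemma lunit_one : lunit one = runit one :> Hom (one ⊗ one) (one : C).
Proof.
(* This is naturality of [lunit] at the morphism [lunit X], with the isomorphism [lunit X]
   cancelled. *)
have h X : lunit (one ⊗ X) = idm one ⊗m lunit X.
  by apply: (iso_mono (lunitK X)); rewrite lunit_nat.
apply: tens_one_inj; rewrite -triangle -h lunit_tens -comp_assoc assocK comp_idr //.
Qed.

End Coherence2.

(** * Adjunctions given by dual objects *)

Section RightAdjunction.
Variables (K : fieldType) (C : monCat K) (X X' : C).
Variables (e : Hom (X' ⊗ X) (one : C)) (c : Hom (one : C) (X ⊗ X')).
Hypothesis dualXX' : is_left_dual e c.
Implicit Types Y Z : C.

(** With [radj_counit] this exhibits tensoring by [X] on the right as left adjoint to tensoring by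
    [X']; the two zigzag equations of the duality become the triangle identities. *)
Definition radj_unit Z : Hom Z ((Z ⊗ X) ⊗ X') :=
  assocV Z X X' ∘ (idm Z ⊗m c) ∘ runitV Z.

Definition radj_counit Y : Hom ((Y ⊗ X') ⊗ X) Y :=
  runit Y ∘ (idm Y ⊗m e) ∘ assoc Y X' X.

Lemma radj_unit_nat Y Z (f : Hom Y Z) :
  radj_unit Z ∘ f = ((f ⊗m idm X) ⊗m idm X') ∘ radj_unit Y.
Proof.
rewrite /radj_unit !comp_assoc -assocV_nat tensm_id (whisk _ (runitV_nat f)).
rewrite (whisk _ (c := f ⊗m idm _) (d := idm Y ⊗m c)) //.
by rewrite -tens_rl -tens_lr.
Qed.

Lemma radj_counit_nat Y Z (f : Hom Y Z) :
  radj_counit Z ∘ ((f ⊗m idm X') ⊗m idm X) = f ∘ radj_counit Y.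
Proof.
rewrite /radj_counit (whisk _ (assoc_nat f (idm X') (idm X))) tensm_id.
rewrite (whisk _ (c := f ⊗m idm one) (d := idm Y ⊗m e)); last by rewrite -tens_rl -tens_lr.
by rewrite !comp_assoc runit_nat.
Qed.

Lemma radj_triangle1 Z : radj_counit (Z ⊗ X) ∘ (radj_unit Z ⊗m idm X) = idm _.
Proof.
rewrite /radj_counit /radj_unit !tensl_comp !comp_assoc runit_tens.
rewrite -(tensm_id Z X) (whisk _ (assoc_nat _ _ _)).
rewrite -(comp_assoc _ (assoc Z X _)) pentagon !comp_assoc.
rewrite (cancelr _ (a := assoc Z X X' ⊗m _)); last by rewrite -tensl_comp assocVK tensm_id.
rewrite (whisk _ (assoc_nat _ _ _)).
rewrite (whisk1 _ (c := idm Z ⊗m lunitV X)); last first.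
  apply: (iso_mono (a := idm Z ⊗m lunit X) (b := idm Z ⊗m lunitV X)).
    by rewrite -tensr_comp lunitK tensm_id.
  rewrite comp_assoc triangle -tensl_comp runitVK -tensr_comp lunitVK.
  by rewrite !tensm_id.
by rewrite -!tensr_comp dualXX'.1.
Qed.

Lemma radj_triangle2 Y : (radj_counit Y ⊗m idm X') ∘ radj_unit (Y ⊗ X') = idm _.
Proof.
rewrite /radj_counit /radj_unit !tensl_comp !comp_assoc.
have P := pentagon Y X' X X'.
have h : (assoc Y X' X ⊗m idm X') ∘ assocV (Y ⊗ X') X X' =
    assocV Y (X' ⊗ X) X' ∘ (idm Y ⊗m assocV X' X X') ∘ assoc Y X' (X ⊗ X').
  apply: (iso_epi (assocVK _ _ _)); rewrite -!comp_assoc assocK comp_idr P.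
  rewrite !comp_assoc -(comp_assoc (assocV _ _ _)) -tensr_comp assocK tensm_id comp_idr.
  by rewrite assocK comp_idl.
rewrite -(comp_assoc _ (assoc Y X' X ⊗m _)) h !comp_assoc.
rewrite -(tensm_id Y X') -(comp_assoc _ (assoc Y X' (X ⊗ X'))) assoc_nat !comp_assoc.
rewrite -(comp_assoc _ _ (assocV Y (X' ⊗ X) X')) -assocV_nat !comp_assoc.
rewrite (whisk1 _ (a := assoc Y X' one) (c := idm Y ⊗m runitV X')); last first.
  apply: (iso_mono (a := idm Y ⊗m runit X') (b := idm Y ⊗m runitV X')).
    by rewrite -tensr_comp runitK tensm_id.
  by rewrite comp_assoc -runit_tens runitVK -tensr_comp runitVK tensm_id.
rewrite (_ : (runit Y ⊗m idm X') ∘ assocV Y one X' = idm Y ⊗m lunit X'); last first.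
  apply: (iso_epi (assocVK Y one X')).
  by rewrite triangle -!comp_assoc assocK comp_idr.
by rewrite -!tensr_comp dualXX'.2 tensm_id.
Qed.

End RightAdjunction.

Section Adjunction.
Variables (K : fieldType) (C D : linCat K).

Definition adjunction (L : linFunctor C D) (R : linFunctor D C) : Prop :=
  exists (u : forall X, Hom X (R (L X))) (v : forall Y, Hom (L (R Y)) Y),
  [/\ forall X X' (f : Hom X X'), u X' ∘ f = fhom R (fhom L f) ∘ u X,
      forall Y Y' (g : Hom Y Y'), v Y' ∘ fhom L (fhom R g) = g ∘ v Y,
      forall X, v (L X) ∘ fhom L (u X) = idm (L X)
    & forall Y, fhom R (v Y) ∘ u (R Y) = idm (R Y)].

Lemma adjunction_hdim (L : linFunctor C D) (R : linFunctor D C) X Y :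
  adjunction L R -> hdim (L X) Y = hdim X (R Y).
Proof.
move=> [u [v [un vn t1 t2]]].
apply: (vdim_bij (f := fun h : Hom (L X) Y => fhom R h ∘ u X)
                 (g := fun k : Hom X (R Y) => v Y ∘ fhom L k)).
- by move=> a f g; rewrite fhom_lin compDl compZl.
- by move=> h; rewrite fhom_comp comp_assoc vn -comp_assoc t1 comp_idr.
- by move=> k; rewrite fhom_comp -comp_assoc -un comp_assoc t2 comp_idl.
Qed.

End Adjunction.

Section TensorFunctors.
Variables (K : fieldType) (C : monCat K).
Hypothesis tens_linl : forall (X X' Y Y' : C) (g : Hom Y Y'),
  linear (fun f : Hom X X' => f ⊗m g).
Hypothesis tens_linr : forall (X X' Y Y' : C) (f : Hom X X'),
  linear (fun g : Hom Y Y' => f ⊗m g).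

Definition tensr_functor (X : C) : linFunctor C C.
Proof.
refine (@LinFunctor K C C (fun Z => Z ⊗ X) (fun Z W f => f ⊗m idm X) _ _ _).
- by move=> Z W; exact: tens_linl.
- by move=> Z; exact: tensm_id.
- by move=> Z W V g f; exact: tensl_comp.
Defined.

Definition tensl_functor (X : C) : linFunctor C C.
Proof.
refine (@LinFunctor K C C (fun Z => X ⊗ Z) (fun Z W f => idm X ⊗m f) _ _ _).
- by move=> Z W; exact: tens_linr.
- by move=> Z; exact: tensm_id.
- by move=> Z W V g f; exact: tensr_comp.
Defined.

Variables (X X' : C) (e : Hom (X' ⊗ X) (one : C)) (c : Hom (one : C) (X ⊗ X')).
Hypothesis dualXX' : is_left_dual e c.

Lemma tensr_adjunction : adjunction (tensr_functor X) (tensr_functor X').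
Proof.
exists (fun Z => radj_unit c Z), (fun Z => radj_counit e Z); split.
- by move=> Y Z f; exact: radj_unit_nat.
- by move=> Y Z f; exact: radj_counit_nat.
- by move=> Z; exact: radj_triangle1.
- by move=> Z; exact: radj_triangle2.
Qed.

Definition ladj_unit (Z : C) : Hom Z (X ⊗ (X' ⊗ Z)) :=
  @radj_unit K (rev_cat C) X' X c Z.

Definition ladj_counit (Z : C) : Hom (X' ⊗ (X ⊗ Z)) Z :=
  @radj_counit K (rev_cat C) X' X e Z.

Lemma rev_left_dual : @is_left_dual K (rev_cat C) X' X e c.
Proof. by split; [exact: dualXX'.2 | exact: dualXX'.1]. Qed.

Lemma ladj_unit_nat Y Z (f : Hom Y Z) :
  ladj_unit Z ∘ f = (idm X ⊗m (idm X' ⊗m f)) ∘ ladj_unit Y.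
Proof. exact: (@radj_unit_nat K (rev_cat C)). Qed.

Lemma ladj_counit_nat Y Z (f : Hom Y Z) :
  ladj_counit Z ∘ (idm X' ⊗m (idm X ⊗m f)) = f ∘ ladj_counit Y.
Proof. exact: (@radj_counit_nat K (rev_cat C)). Qed.

Lemma ladj_triangle1 Z : ladj_counit (X' ⊗ Z) ∘ (idm X' ⊗m ladj_unit Z) = idm _.
Proof. exact: (radj_triangle1 rev_left_dual). Qed.

Lemma ladj_triangle2 Z : (idm X ⊗m ladj_counit Z) ∘ ladj_unit (X ⊗ Z) = idm _.
Proof. exact: (radj_triangle2 rev_left_dual). Qed.

Lemma tensl_adjunction : adjunction (tensl_functor X') (tensl_functor X).
Proof.
exists ladj_unit, ladj_counit; split.
- by move=> Y Z f; exact: ladj_unit_nat.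
- by move=> Y Z f; exact: ladj_counit_nat.
- by move=> Z; exact: ladj_triangle1.
- by move=> Z; exact: ladj_triangle2.
Qed.

End TensorFunctors.

Section Duals.
Variables (K : fieldType) (C : rigidCat K).
Implicit Types V W Z : C.

(** A morphism into [V^*] is recovered from its pairing with [V]. Equations about [dualm] are thus
    checked after [ev], without unfolding its formula. *)
Lemma ev_inj Z V (f g : Hom Z V^*) :
  ev V ∘ (f ⊗m idm V) = ev V ∘ (g ⊗m idm V) -> f = g.
Proof.
have E (h : Hom Z V^*) :
    lunit V^* ∘ ((ev V ∘ (h ⊗m idm V)) ⊗m idm V^*) ∘ radj_unit (coev V) Z = h.
  rewrite -comp_assoc tensl_comp -comp_assoc -radj_unit_nat.
  rewrite /radj_unit !comp_assoc (ev_coev V).2; exact: comp_idl.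
by move=> h; rewrite -(E f) h E.
Qed.

(** The defining property of the transpose, by [ev_inj]; it also says that [ev] is a cowedge. *)
Lemma ev_dualm V W (f : Hom V W) :
  ev V ∘ (dualm f ⊗m idm V) = ev W ∘ (idm W^* ⊗m f).
Proof.
have -> : dualm f = lunit V^* ∘ ((ev W ∘ (idm W^* ⊗m f)) ⊗m idm V^*)
    ∘ radj_unit (coev V) W^*.
  by rewrite /dualm /radj_unit tensl_comp !comp_assoc.
have E : ev V ∘ (lunit V^* ⊗m idm V) = radj_counit (ev V) one.
  rewrite /radj_counit -lunit_one lunit_nat -comp_assoc lunit_tens.
  by rewrite -comp_assoc assocK comp_idr.
move: (ev W ∘ _) => k; rewrite 2!tensl_comp 2!comp_assoc E radj_counit_nat.
by rewrite -comp_assoc radj_triangle1 ?comp_idr //; exact: ev_coev.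
Qed.

Lemma dualm_comp V W Z (g : Hom W Z) (f : Hom V W) :
  dualm (g ∘ f) = dualm f ∘ dualm g.
Proof.
apply: ev_inj; rewrite ev_dualm tensl_comp comp_assoc ev_dualm tensr_comp.
by rewrite -[RHS]comp_assoc -tens_rl (tens_lr (dualm g) f) !comp_assoc ev_dualm.
Qed.

End Duals.

(** * Karoubi envelopes and categories of modules *)

Section Karoubi.
Variables (K : fieldType) (C : linCat K).

Record kar_ob := KarOb {
  kar_base : C;
  kar_idem : Hom kar_base kar_base;
  kar_idemP : kar_idem ∘ kar_idem = kar_idem
}.
Implicit Types P Q T : kar_ob.

Definition kar_stable P Q : {pred Hom (kar_base P) (kar_base Q)} :=
  fun f => kar_idem Q ∘ f ∘ kar_idem P == f.

Fact kar_stable_submod P Q : submod_closed (@kar_stable P Q).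
Proof.
split; first by apply/eqP; rewrite comp0r comp0l.
move=> k f g /eqP hf /eqP hg; apply/eqP.
by rewrite compDr compZr compDl compZl hf hg.
Qed.

HB.instance Definition _ P Q :=
  GRing.isSubmodClosed.Build K (Hom (kar_base P) (kar_base Q)) (@kar_stable P Q)
    (@kar_stable_submod P Q).

Record kar_hom P Q := KarHom {
  kar_fun :> Hom (kar_base P) (kar_base Q);
  kar_funP : kar_fun \in @kar_stable P Q
}.

HB.instance Definition _ P Q := [isSub for @kar_fun P Q].
HB.instance Definition _ P Q := [Choice of kar_hom P Q by <:].
HB.instance Definition _ P Q := [SubChoice_isSubLmodule of kar_hom P Q by <:].

Lemma kar_homE P Q (f : kar_hom P Q) : kar_idem Q ∘ kar_fun f ∘ kar_idem P = kar_fun f.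
Proof. by case: f => f /= /eqP. Qed.

Lemma kar_homl P Q (f : kar_hom P Q) : kar_idem Q ∘ kar_fun f = kar_fun f.
Proof. by rewrite -kar_homE !comp_assoc kar_idemP. Qed.

Lemma kar_homr P Q (f : kar_hom P Q) : kar_fun f ∘ kar_idem P = kar_fun f.
Proof. by rewrite -kar_homE -comp_assoc kar_idemP. Qed.

Fact kar_cut_subproof P Q (f : Hom (kar_base P) (kar_base Q)) :
  kar_idem Q ∘ f ∘ kar_idem P \in @kar_stable P Q.
Proof.
by apply/eqP; rewrite !comp_assoc kar_idemP -!comp_assoc kar_idemP.
Qed.

Definition kar_cut P Q f : kar_hom P Q := KarHom (kar_cut_subproof f).

Fact kar_id_subproof P : kar_idem P \in @kar_stable P P.
Proof. by apply/eqP; rewrite !kar_idemP. Qed.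

Fact kar_comp_subproof P Q T (g : kar_hom Q T) (f : kar_hom P Q) :
  kar_fun g ∘ kar_fun f \in @kar_stable P T.
Proof. by apply/eqP; rewrite comp_assoc kar_homl -comp_assoc kar_homr. Qed.

Definition karoubi : linCat K.
Proof.
refine (@LinCat K kar_ob (fun P Q => kar_hom P Q : lmodType K)
  (fun P => KarHom (kar_id_subproof P))
  (fun P Q T g f => KarHom (kar_comp_subproof g f)) _ _ _ _ _).
- by move=> P Q f; apply: val_inj; exact: kar_homl.
- by move=> P Q f; apply: val_inj; exact: kar_homr.
- by move=> P Q T U h g f; apply: val_inj; exact: comp_assoc.
- by move=> P Q T f k g h; apply: val_inj; rewrite /= compDl compZl.
- by move=> P Q T g k f h; apply: val_inj; rewrite /= compDr compZr.
Defined.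

Lemma kar_fun_linear P Q : linear (fun f : kar_hom P Q => kar_fun f).
Proof. by []. Qed.

Definition kar_full (X : C) : kar_ob := @KarOb X (idm X) (comp_idl (idm X)).

Fact kar_full_subproof X Y (f : Hom X Y) : f \in @kar_stable (kar_full X) (kar_full Y).
Proof. by apply/eqP; rewrite comp_idl comp_idr. Qed.

Definition kar_embed : linFunctor C karoubi.
Proof.
refine (@LinFunctor K C karoubi kar_full
  (fun X Y f => KarHom (kar_full_subproof f)) _ _ _).
- by move=> X Y k f g; apply: val_inj.
- by move=> X; apply: val_inj.
- by move=> X Y Z g f; apply: val_inj.
Defined.

Lemma karoubi_split : split_idempotents karoubi.
Proof.
move=> P p pp; have pp' : kar_fun p ∘ kar_fun p = kar_fun p by exact: (congr1 (@kar_fun P P) pp).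
pose Q := KarOb pp'.
have hi : kar_fun p \in @kar_stable Q P by apply/eqP; rewrite /= kar_homl pp'.
have hq : kar_fun p \in @kar_stable P Q by apply/eqP; rewrite /= pp' kar_homr.
by exists Q, (KarHom hi), (KarHom hq); split; apply: val_inj.
Qed.

(** An object of the envelope is a retract of its base, so the generator of [C] and its idempotent
    still serve. *)
Lemma karoubi_fin_separable : hom_findim C -> separated C -> fin_separable karoubi.
Proof.
move=> fin [G [s [[s1 sz] ret]]]; split; last exact: karoubi_split.
  move=> P Q; exact: (findim_sub (@kar_fun_linear P Q) val_inj (fin _ _)).
pose e (x : Hom G G) : Hom (kar_full G : karoubi) (kar_full G) := fhom kar_embed x.
have le : linear e by move=> k x y; apply: val_inj.
exists (kar_full G), [seq (e x.1, e x.2) | x <- s]; split.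
  split; first by rewrite big_map -[RHS](fhom_id kar_embed) -s1 fhom_sum;
    apply: eq_bigr => x _; rewrite fhom_comp.
  move=> V b [bl br] z; rewrite !big_map /=.
  have -> : z = e (kar_fun z) by apply: val_inj.
  transitivity (\sum_(x <- s) b (e (kar_fun z ∘ x.1)) (e x.2)).
    by apply: eq_bigr => x _; congr (b _ _); apply: val_inj.
  rewrite (sz _ (fun x y => b (e x) (e y))).
    by apply: eq_bigr => x _; congr (b _ _); apply: val_inj.
  split=> [y | x]; first exact: (linear_comp (bl _) le).
  exact: (linear_comp (br _) le).
move=> P; have [r rP] := ret (kar_base P).
exists [seq (kar_cut (P := kar_full G) (Q := P) x.1, kar_cut (P := P) (Q := kar_full G) x.2) | x <- r].
rewrite big_map; apply: val_inj; rewrite /= (lin_sum (@kar_fun_linear P P)) /=.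
transitivity (kar_idem P ∘ idm _ ∘ kar_idem P); last by rewrite comp_idr kar_idemP.
rewrite -rP comp_sumr comp_suml; apply: eq_bigr => x _.
by rewrite comp_idr comp_idl !comp_assoc.
Qed.

End Karoubi.

Section KaroubiFunctors.
Variable K : fieldType.

Fact kar_functor_ob_subproof (C D : linCat K) (F : linFunctor C D) (P : karoubi C) :
  fhom F (kar_idem P) ∘ fhom F (kar_idem P) = fhom F (kar_idem P).
Proof. by rewrite -fhom_comp kar_idemP. Qed.

Definition kar_functor_ob (C D : linCat K) (F : linFunctor C D) (P : karoubi C) :
  karoubi D := KarOb (kar_functor_ob_subproof F P).

Fact kar_functor_hom_subproof (C D : linCat K) (F : linFunctor C D) (P Q : karoubi C)
  (f : Hom P Q) :
  fhom F (kar_fun f) \in @kar_stable _ _ (kar_functor_ob F P) (kar_functor_ob F Q).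
Proof. by apply/eqP; rewrite /= -!fhom_comp kar_homE. Qed.

Definition kar_functor (C D : linCat K) (F : linFunctor C D) :
  linFunctor (karoubi C) (karoubi D).
Proof.
refine (@LinFunctor K (karoubi C) (karoubi D) (kar_functor_ob F)
  (fun P Q f => KarHom (kar_functor_hom_subproof F f)) _ _ _).
- by move=> P Q k f g; apply: val_inj; rewrite /= fhom_lin.
- by move=> P; apply: val_inj.
- by move=> P Q T g f; apply: val_inj; rewrite /= fhom_comp.
Defined.

Lemma kar_adjunction (C D : linCat K) (L : linFunctor C D) (R : linFunctor D C) :
  adjunction L R -> adjunction (kar_functor L) (kar_functor R).
Proof.
move=> [u [v [un vn t1 t2]]].
pose U (P : karoubi C) : Hom P (kar_functor R (kar_functor L P)) :=
  kar_cut (P := P) (Q := kar_functor R (kar_functor L P)) (u (kar_base P)).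
pose V (Q : karoubi D) : Hom (kar_functor L (kar_functor R Q)) Q :=
  kar_cut (P := kar_functor L (kar_functor R Q)) (Q := Q) (v (kar_base Q)).
have UE P : kar_fun (U P) = u (kar_base P) ∘ kar_idem P.
  by rewrite /= -un -comp_assoc kar_idemP.
have VE Q : kar_fun (V Q) = kar_idem Q ∘ v (kar_base Q).
  by rewrite /= -comp_assoc vn comp_assoc kar_idemP.
exists U, V; split.
- move=> P Q f; apply: val_inj.
  change (kar_fun (U Q) ∘ kar_fun f = fhom R (fhom L (kar_fun f)) ∘ kar_fun (U P)).
  by rewrite !UE -comp_assoc kar_homl comp_assoc -un -comp_assoc kar_homr.
- move=> P Q f; apply: val_inj.
  change (kar_fun (V Q) ∘ fhom L (fhom R (kar_fun f)) = kar_fun f ∘ kar_fun (V P)).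
  by rewrite !VE -comp_assoc vn !comp_assoc kar_homl kar_homr.
- move=> P; apply: val_inj.
  change (kar_fun (V (kar_functor L P)) ∘ fhom L (kar_fun (U P)) = fhom L (kar_idem P)).
  rewrite UE VE fhom_comp -comp_assoc (comp_assoc (v _)) t1.
  by rewrite comp_idl /= -fhom_comp kar_idemP.
- move=> Q; apply: val_inj.
  change (fhom R (kar_fun (V Q)) ∘ kar_fun (U (kar_functor R Q)) = fhom R (kar_idem Q)).
  rewrite UE VE fhom_comp -comp_assoc (comp_assoc _ (u _)) t2.
  by rewrite comp_idl /= -fhom_comp kar_idemP.
Qed.

Section Image.
Variables (C : linCat K) (spl : split_idempotents C).
Implicit Types P Q : karoubi C.

Definition image P : C := sval (cid (spl (kar_idemP P))).
Definition image_in P : Hom (image P) (kar_base P) :=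
  sval (cid (svalP (cid (spl (kar_idemP P))))).
Definition image_out P : Hom (kar_base P) (image P) :=
  sval (cid (svalP (cid (svalP (cid (spl (kar_idemP P))))))).

Lemma image_split P : split_by (kar_idem P) (image_in P) (image_out P).
Proof. exact: (svalP (cid (svalP (cid (svalP (cid (spl (kar_idemP P)))))))). Qed.

Lemma image_in_idem P : kar_idem P ∘ image_in P = image_in P.
Proof. by rewrite -(image_split P).2 -comp_assoc (image_split P).1 comp_idr. Qed.

Definition image_functor : linFunctor (karoubi C) C.
Proof.
refine (@LinFunctor K (karoubi C) C image
  (fun P Q f => image_out Q ∘ kar_fun f ∘ image_in P) _ _ _).
- by move=> P Q k f g; rewrite /= compDr compZr compDl compZl.
- by move=> P; rewrite /= -comp_assoc image_in_idem (image_split P).1.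
- move=> P Q T g f /=; rewrite !comp_assoc -(comp_assoc _ (image_in Q)).
  by rewrite (image_split Q).2 (whisk1 _ (kar_homr g)).
Defined.

Lemma image_iso P Y (i : Hom Y (kar_base P)) (q : Hom (kar_base P) Y) :
  split_by (kar_idem P) i q -> isomorphic (image P) Y.
Proof.
move=> [qi iq]; have [qi' iq'] := image_split P.
exists (q ∘ image_in P), (image_out P ∘ i); split.
  by rewrite comp_assoc -(comp_assoc _ i) iq -comp_assoc image_in_idem.
rewrite comp_assoc -(comp_assoc _ (image_in P)) iq' -iq comp_assoc qi comp_idl.
exact: qi.
Qed.

End Image.
End KaroubiFunctors.

(** * Free modules over the endomorphism algebra of an object *)

Section TensorSpan.
Variables (K : fieldType) (C : monCat K).
Hypothesis tens_linl : forall (X X' Y Y' : C) (g : Hom Y Y'),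
  linear (fun f : Hom X X' => f ⊗m g).
Hypothesis tens_linr : forall (X X' Y Y' : C) (f : Hom X X'),
  linear (fun g : Hom Y Y' => f ⊗m g).
Variable X : C.
Implicit Types Y Z W : C.

(* [Hom(Y, Z) ⊗_E End X] is realised as the span of the [f ⊗ d] in
   [Hom(Y ⊗ X, Z ⊗ X)]. The Karoubi envelope of the resulting category [span_cat],
   whose objects are the free modules, is the category of [End X]-modules in [C]. *)
Definition tens_span Y Z : {pred Hom (Y ⊗ X) (Z ⊗ X)} :=
  fun h => `[< exists s : seq (Hom Y Z * Hom X X), h = \sum_(x <- s) x.1 ⊗m x.2 >].

Fact tens_span_submod Y Z : submod_closed (@tens_span Y Z).
Proof.
split; first by apply/asboolP; exists [::]; rewrite big_nil.
move=> k f g /asboolP[s ->] /asboolP[t ->]; apply/asboolP.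
exists ([seq (k *: x.1, x.2) | x <- s] ++ t).
rewrite big_cat big_map /= scaler_sumr; congr (_ + _); apply: eq_bigr => x _.
by rewrite (lin_Z (tens_linl _)).
Qed.

HB.instance Definition _ Y Z :=
  GRing.isSubmodClosed.Build K (Hom (Y ⊗ X) (Z ⊗ X)) (@tens_span Y Z)
    (@tens_span_submod Y Z).

Record span_hom Y Z := SpanHom {
  span_fun :> Hom (Y ⊗ X) (Z ⊗ X);
  span_funP : span_fun \in @tens_span Y Z
}.

HB.instance Definition _ Y Z := [isSub for @span_fun Y Z].
HB.instance Definition _ Y Z := [Choice of span_hom Y Z by <:].
HB.instance Definition _ Y Z := [SubChoice_isSubLmodule of span_hom Y Z by <:].

Fact span_tens_subproof Y Z (f : Hom Y Z) (d : Hom X X) : f ⊗m d \in @tens_span Y Z.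
Proof. by apply/asboolP; exists [:: (f, d)]; rewrite big_seq1. Qed.

Definition span_tens Y Z (f : Hom Y Z) (d : Hom X X) : span_hom Y Z :=
  SpanHom (span_tens_subproof f d).

Lemma tens_span_ind Y Z (P : Hom (Y ⊗ X) (Z ⊗ X) -> Prop) :
  P 0 -> (forall f g, P f -> P g -> P (f + g)) -> (forall f d, P (f ⊗m d)) ->
  forall h : span_hom Y Z, P (span_fun h).
Proof.
move=> P0 PD Pt [h /= /asboolP[s ->]].
by elim: s => [|x s IH]; rewrite ?big_nil ?big_cons //; apply: PD.
Qed.

Fact span_id_subproof Y : idm (Y ⊗ X) \in @tens_span Y Y.
Proof. by rewrite -tensm_id; exact: span_tens_subproof. Qed.

Fact span_comp_subproof Y Z W (g : span_hom Z W) (f : span_hom Y Z) :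
  span_fun g ∘ span_fun f \in @tens_span Y W.
Proof.
pose P f' := span_fun g ∘ f' \in @tens_span Y W.
apply: (tens_span_ind (P := P)); rewrite /P.
- by rewrite comp0r rpred0.
- by move=> a b ha hb; rewrite compDr rpredD.
- move=> f' d; pose Q g' := g' ∘ (f' ⊗m d) \in @tens_span Y W.
  apply: (tens_span_ind (P := Q)); rewrite /Q.
  + by rewrite comp0l rpred0.
  + by move=> a b ha hb; rewrite compDl rpredD.
  + by move=> g' d'; rewrite -tensm_comp; exact: span_tens_subproof.
Qed.

Definition span_cat : linCat K.
Proof.
refine (@LinCat K C (fun Y Z => span_hom Y Z : lmodType K)
  (fun Y => SpanHom (span_id_subproof Y))
  (fun Y Z W g f => SpanHom (span_comp_subproof g f)) _ _ _ _ _).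
- by move=> Y Z f; apply: val_inj; exact: comp_idl.
- by move=> Y Z f; apply: val_inj; exact: comp_idr.
- by move=> Y Z W V h g f; apply: val_inj; exact: comp_assoc.
- by move=> Y Z W f k g h; apply: val_inj; rewrite /= compDl compZl.
- by move=> Y Z W g k f h; apply: val_inj; rewrite /= compDr compZr.
Defined.

Lemma span_fun_linear Y Z : linear (fun f : span_hom Y Z => span_fun f).
Proof. by []. Qed.

Lemma span_findim : hom_findim C -> hom_findim span_cat.
Proof.
by move=> fin Y Z; exact: (findim_sub (@span_fun_linear Y Z) val_inj (fin _ _)).
Qed.

(** On free modules this is [N ⊗_(End X) X]: the free module on [Y] goes to [Y ⊗ X]. *)
Definition span_forget : linFunctor span_cat C.
Proof.
by refine (@LinFunctor K span_cat C (fun Y => Y ⊗ X) (fun Y Z f => span_fun f) _ _ _).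
Defined.

Definition span_free : linFunctor C span_cat.
Proof.
refine (@LinFunctor K C span_cat id (fun Y Z f => span_tens f (idm X)) _ _ _).
- by move=> Y Z k f g; apply: val_inj; exact: tens_linl.
- by move=> Y; apply: val_inj; exact: tensm_id.
- by move=> Y Z W g f; apply: val_inj; exact: tensl_comp.
Defined.

Lemma span_tens_linl Y Z (d : Hom X X) : linear (fun f : Hom Y Z => span_tens f d).
Proof. by move=> k f g; apply: val_inj; exact: tens_linl. Qed.

Lemma span_tens_linr Y Z (f : Hom Y Z) : linear (span_tens f).
Proof. by move=> k d d'; apply: val_inj; exact: tens_linr. Qed.

Lemma span_tens_comp Y Z W (g : Hom Z W) (f : Hom Y Z) (d' d : Hom X X) :
  (span_tens g d' : Hom (Z : span_cat) W) ∘ span_tens f d = span_tens (g ∘ f) (d' ∘ d).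
Proof. by apply: val_inj; rewrite /= tensm_comp. Qed.

Lemma span_hom_sum Y Z (h : span_hom Y Z) : exists s : seq (Hom Y Z * Hom X X),
  h = \sum_(x <- s) span_tens x.1 x.2.
Proof.
case: h => h hP; have [s sE] := asboolP _ hP; exists s; apply: val_inj.
by rewrite /= (lin_sum (@span_fun_linear Y Z)).
Qed.

(** The product of the idempotents of [G] and of [End X] works: endomorphisms of [G] are sums of
    terms [f ⊗ d], and the two factors are moved across separately. *)
Lemma span_separated (s : seq (Hom X X * Hom X X)) : casimir s ->
  separated C -> separated span_cat.
Proof.
move=> [s1 sz] [G [t [[t1 tz] ret]]].
pose g (x : Hom G G * Hom X X) : Hom (G : span_cat) G := span_tens x.1 x.2.
pose q := [seq (g (x.1, a.1), g (x.2, a.2)) | x <- t, a <- s].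
exists G, q.
split; last first.
  move=> Y; have [r r1] := ret Y.
  exists [seq (span_tens x.1 (idm X), span_tens x.2 (idm X)) | x <- r].
  rewrite big_map -[RHS](fhom_id span_free) -r1 fhom_sum; apply: eq_bigr => x _.
  exact: (esym (fhom_comp span_free x.1 x.2)).
split.
  rewrite big_allpairs_dep -[RHS](fhom_id span_free) -t1 fhom_sum /=.
  apply: eq_bigr => x _; rewrite -s1 (lin_sum (@span_tens_linr _ _ _)).
  by apply: eq_bigr => a _; exact: span_tens_comp.
move=> V b [bl br] z; have [r ->] := span_hom_sum z.
transitivity (\sum_(y <- r) \sum_(p <- q) b (g y ∘ p.1) p.2).
  rewrite exchange_big; apply: eq_bigr => p _.
  by rewrite comp_suml (lin_sum (bl _)).
transitivity (\sum_(y <- r) \sum_(p <- q) b p.1 (p.2 ∘ g y)); last first.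
  rewrite exchange_big; apply: eq_bigr => p _.
  by rewrite comp_sumr (lin_sum (br _)).
apply: eq_bigr => -[f d] _; rewrite !big_allpairs_dep.
transitivity (\sum_(x <- t) \sum_(a <- s)
    b (span_tens x.1 (d ∘ a.1)) (span_tens (x.2 ∘ f) a.2)).
  rewrite exchange_big [RHS]exchange_big; apply: eq_bigr => a _.
  rewrite -(tz _ (fun u v => b (span_tens u (d ∘ a.1)) (span_tens v a.2))).
    by apply: eq_bigr => x _; rewrite span_tens_comp.
  split=> [v | u]; first exact: (linear_comp (bl _) (@span_tens_linl _ _ _)).
  exact: (linear_comp (br _) (@span_tens_linl _ _ _)).
apply: eq_bigr => x _.
rewrite (sz _ (fun u v => b (span_tens x.1 u) (span_tens (x.2 ∘ f) v))).
  by apply: eq_bigr => a _; rewrite span_tens_comp.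
split=> [v | u]; first exact: (linear_comp (bl _) (@span_tens_linr _ _ _)).
exact: (linear_comp (br _) (@span_tens_linr _ _ _)).
Qed.

(** Naturality of the associator turns [f ⊗ d] into [(id ⊗ f) ⊗ d], so the span is preserved. *)
Fact span_tensl_subproof W Y Z (h : span_hom Y Z) :
  assocV W Z X ∘ (idm W ⊗m span_fun h) ∘ assoc W Y X \in @tens_span (W ⊗ Y) (W ⊗ Z).
Proof.
pose P k := assocV W Z X ∘ (idm W ⊗m k) ∘ assoc W Y X \in @tens_span (W ⊗ Y) (W ⊗ Z).
apply: (tens_span_ind (P := P)); rewrite /P.
- by rewrite (lin_0 (tens_linr _)) comp0r comp0l rpred0.
- by move=> f g hf hg; rewrite (lin_D (tens_linr _)) compDr compDl rpredD.
- move=> f d; rewrite assocV_nat -comp_assoc assocK comp_idr.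
  exact: span_tens_subproof.
Qed.

Definition span_tensl (W : C) : linFunctor span_cat span_cat.
Proof.
refine (@LinFunctor K span_cat span_cat (fun Y => W ⊗ Y)
  (fun Y Z h => SpanHom (span_tensl_subproof W h)) _ _ _).
- by move=> Y Z k f g; apply: val_inj; rewrite /= tens_linr compDr compZr compDl compZl.
- by move=> Y; apply: val_inj; rewrite /= tensm_id comp_idr assocK.
- move=> Y Z V g f; apply: val_inj; rewrite /= tensr_comp !comp_assoc.
  by rewrite (cancelr _ (assocVK _ _ _)).
Defined.

Lemma span_tensl_tens W Y Z (f : Hom Y Z) (d : Hom X X) :
  fhom (span_tensl W) (span_tens f d) = span_tens (idm W ⊗m f) d.
Proof.
by apply: val_inj; rewrite /= assocV_nat -comp_assoc assocK comp_idr.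
Qed.

Lemma span_adjunction (V V' : C) (e : Hom (V' ⊗ V) (one : C)) (c : Hom (one : C) (V ⊗ V')) :
  is_left_dual e c -> adjunction (span_tensl V') (span_tensl V).
Proof.
move=> dualV.
exists (fun Y => span_tens (ladj_unit c Y) (idm X)).
exists (fun Y => span_tens (ladj_counit e Y) (idm X)); split.
- move=> Y Z f; have [r ->] := span_hom_sum f.
  rewrite comp_sumr !fhom_sum comp_suml; apply: eq_bigr => x _.
  by rewrite !span_tensl_tens !span_tens_comp ladj_unit_nat comp_idl comp_idr.
- move=> Y Z f; have [r ->] := span_hom_sum f.
  rewrite comp_suml !fhom_sum comp_sumr; apply: eq_bigr => x _.
  by rewrite !span_tensl_tens !span_tens_comp ladj_counit_nat comp_idl comp_idr.
- move=> Y; rewrite span_tensl_tens span_tens_comp ladj_triangle1 // comp_idl.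
  exact: (fhom_id span_free).
- move=> Y; rewrite span_tensl_tens span_tens_comp ladj_triangle2 // comp_idl.
  exact: (fhom_id span_free).
Qed.

End TensorSpan.

(** * The Frobenius-Perron character *)

Section SimpleObjects.
Variables (K : fieldType) (C : linCat K).
Hypothesis sepC : fin_separable C.

Lemma simple_epi (A T : C) (f : Hom A T) : simple T -> f <> 0 ->
  exists h, f ∘ h = idm T.
Proof.
move=> sT f0.
have [h fhf] := separated_regular (fs_findim sepC) (fs_separated sepC) f.
exists h; have [||//] := simple_idem (fs_split sepC) sT (p := f ∘ h).
  by rewrite comp_assoc fhf.
by move=> fh; case: f0; rewrite -fhf fh comp0l.
Qed.

Lemma through_simple_neq0 (A B T : C) (f : Hom A T) (g : Hom T B) : simple T ->
  f <> 0 -> g <> 0 -> g ∘ f <> 0.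
Proof.
move=> sT f0 g0 gf; have [h fh] := simple_epi sT f0.
by apply: g0; rewrite -[g]comp_idr -fh comp_assoc gf comp0l.
Qed.

Lemma sum_neq0 (A B Y : C) (J : finType) (F : J -> C) (inj : forall j, Hom (F j) Y)
  (pr : forall j, Hom Y (F j)) (f : Hom Y B) : \sum_j inj j ∘ pr j = idm Y ->
  f <> 0 -> exists j, f ∘ inj j <> 0.
Proof.
move=> ip f0; apply: contrapT => nx; apply: f0.
rewrite -[f]comp_idr -ip comp_sumr big1 // => j _; rewrite comp_assoc.
suff -> : f ∘ inj j = 0 by rewrite comp0l.
by apply: contrapT => fj; apply: nx; exists j.
Qed.

Lemma hom_neq0_sym (S : family_of_objects C) (hS : enumerates_simples S) (A B : C)
  (f : Hom A B) : f <> 0 -> exists g : Hom B A, g <> 0.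
Proof.
move=> /(hdim_gt0 sepC); rewrite (hdim_sym sepC hS) lt0n => /eqP h.
apply: contrapT => ng; apply: h; apply/(vdim_eq0 (fs_findim sepC B A)) => g.
by apply: contrapT => g0; apply: ng; exists g.
Qed.

End SimpleObjects.

(** * The positive character and its identification with FPdim *)

Section FusionCategory.
Variables (K : fieldType) (C : rigidCat K).
Hypothesis hC : fusion C.
Implicit Types X Y Z : C.

Lemma fusion_fin_separable : fin_separable C.
Proof. by case: hC => /separable_cat_fin_separable. Qed.

Lemma fusion_linl (X X' Y Y' : C) (g : Hom Y Y') : linear (fun f : Hom X X' => f ⊗m g).
Proof. by case: hC => _ h _ _; exact: h. Qed.

Lemma fusion_linr (X X' Y Y' : C) (f : Hom X X') : linear (fun g : Hom Y Y' => f ⊗m g).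
Proof. by case: hC => _ _ h _; exact: h. Qed.

Lemma fusion_one : simple (one : C).
Proof. by case: hC. Qed.

Lemma fusion_simples : enumerates_simples (simples C).
Proof. exact: (epsilon_spec _ _ (simples_exist fusion_fin_separable)). Qed.

Let sepC := fusion_fin_separable.
Let hS := fusion_simples.

Lemma irr_simple i : simple (@irr K C i).
Proof. by case: hS => h _ _; exact: h. Qed.

Lemma one_irr : exists i, isomorphic (one : C) (irr i).
Proof. by case: hS => _ _ h; exact: h fusion_one. Qed.

Lemma zero_tensl (X X' Y Y' : C) (g : Hom Y Y') : (0 : Hom X X') ⊗m g = 0.
Proof. exact: (lin_0 (fusion_linl g)). Qed.

Notation TR X := (tensr_functor fusion_linl X).
Notation TL X := (tensl_functor fusion_linr X).

(** The evaluation on a right dual is nonzero by a zigzag equation, and some simple summand of that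
    dual detects it. *)
Lemma irr_hub i : exists k (f : Hom (irr i ⊗ irr k) (one : C)), f <> 0.
Proof.
have [Y [e [c [_ z]]]] := right_dual (irr i).
have e0 : e <> 0.
  move=> e0; case: (irr_simple i) => nz _; apply: nz; rewrite /is_zero -z e0.
  by rewrite zero_tensl comp0r !comp0l.
have [inj [pr [_ _ ip]]] := functor_direct_sum (TL (irr i)) (multP sepC hS Y).
have [t ht] := sum_neq0 (one : C) ip e0.
by exists (tag t), (e ∘ inj t).
Qed.

Lemma hdim_tensr X Y Z : hdim (X ⊗ Y) Z = hdim X (Z ⊗ Y^*).
Proof.
exact: (adjunction_hdim X Z (tensr_adjunction fusion_linl (ev_coev Y))).
Qed.

Lemma hdim_tensl X Y Z : hdim (Y^* ⊗ X) Z = hdim X (Y ⊗ Z).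
Proof.
exact: (adjunction_hdim X Z (tensl_adjunction fusion_linr (ev_coev Y))).
Qed.

Definition fp_character (d : C -> algC) : Prop :=
  [/\ dsum_additive d, forall i, 0 < d (irr i), forall X Y, d (X ⊗ Y) = d X * d Y
    & d one = 1].

(** Tensoring by [Y] on the left commutes with the functors used, which tensor on the right. So
    [v (Y ⊗ _)] is an eigenfunction with the same eigenvalue as [v], and uniqueness makes it a
    multiple of [v]. Normalising at the unit gives multiplicativity. *)
Lemma fp_character_exists : exists d, fp_character d.
Proof.
have [i1 one_i1] := one_irr.
have [||v [lam [av v_gt0 tv]]] := perron_functional sepC hS
  (F := fun k : irr_index C => TR (irr k)) (F' := fun k => TR (irr k)^*) _ _
  (leq_ltn_trans (leq0n i1) (ltn_ord i1)).
- by move=> k A B /=; rewrite (hdim_sym sepC hS) -hdim_tensr (hdim_sym sepC hS).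
(* Any two simple objects are joined through the unit; the map out of the unit comes from the
   symmetry of Hom dimensions. *)
- move=> a b; have [l [f f0]] := irr_hub a; have [k [g g0]] := irr_hub b.
  have [g' g'0] := hom_neq0_sym sepC hS g0.
  by exists k, l, (g' ∘ f); exact: (through_simple_neq0 sepC fusion_one).
have v1_gt0 : 0 < v one by rewrite (additive_iso av one_i1) v_gt0.
have v1_neq0 : v one != 0 by rewrite gt_eqF.
have vM X Y : v (Y ⊗ X) * v one = v Y * v X.
  pose u Z := v (Y ⊗ Z).
  have au : dsum_additive u by move=> J F Z /(functor_direct_sum (TL Y))/av.
  rewrite -(additive_iso av (X := Y ⊗ one) (Y := Y)); last first.
    by exists (runit Y), (runitV Y); exact: runit_inv.
  apply: (perron_functional_unique sepC hS (F := fun k : irr_index C => TR (irr k))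
    (F' := fun k => TR (irr k)^*) _ _ (lam := lam) (f2 := u)) => //.
  - by move=> k A B /=; rewrite (hdim_sym sepC hS) -hdim_tensr (hdim_sym sepC hS).
  - move=> a b; have [l [f f0]] := irr_hub a; have [k [g g0]] := irr_hub b.
    have [g' g'0] := hom_neq0_sym sepC hS g0.
    by exists k, l, (g' ∘ f); exact: (through_simple_neq0 sepC fusion_one).
  - move=> i; apply: ger0_real; rewrite /u; apply: (additive_ge0 sepC hS _ av) => j.
    by apply: ltW; exact: v_gt0.
  - move=> Z; rewrite -[RHS]tv; apply: eq_bigr => k _; apply: eq_bigr => l _.
    apply: (additive_iso av) => /=.
    have a1 A B D : isomorphic (A ⊗ (B ⊗ D) : C) ((A ⊗ B) ⊗ D).
      by exists (assocV A B D), (assoc A B D); split; [exact: assocVK | exact: assocK].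
    apply: iso_trans (a1 _ _ _) _.
    exact: (functor_iso (TR (irr k)^*) (a1 _ _ _)).
exists (fun X => v X / v one); split.
- by move=> J F X /av ->; rewrite mulr_suml.
- by move=> i; rewrite divr_gt0 //; exact: v_gt0.
- by move=> X Y; rewrite mulf_div -vM; field.
- by rewrite divff.
Qed.

Section Character.
Variable d : C -> algC.
Hypothesis hd : fp_character d.

Let ad : dsum_additive d. Proof. by case: hd. Qed.
Let d_gt0 i : 0 < d (irr i). Proof. by case: hd => _ h _ _; exact: h. Qed.
Let dM X Y : d (X ⊗ Y) = d X * d Y. Proof. by case: hd => _ _ h _; exact: h. Qed.

Lemma character_ge0 X : 0 <= d X.
Proof. by apply: (additive_ge0 sepC hS) => // i; apply: ltW; exact: d_gt0. Qed.

Let M Y := left_mul_mx Y.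

Lemma left_mul_mxE Y j : \sum_i M Y j i * d (irr i) = d Y * d (irr j).
Proof.
rewrite -dM (additive_mult sepC hS _ ad); apply: eq_bigr => i _.
by rewrite mxE mulrC.
Qed.

(** The values of [d] form a column eigenvector while [eigenvalue] asks for a row; transposition
    keeps the characteristic polynomial. *)
Lemma eigenvalue_character Y : eigenvalue (M Y) (d Y).
Proof.
have h : eigenvalue (M Y)^T (d Y).
  apply/eigenvalueP; exists (\row_i d (irr i)).
    apply/rowP => j; rewrite !mxE -left_mul_mxE; apply: eq_bigr => i _.
    by rewrite !mxE mulrC.
  have [i1 _] := one_irr; apply/eqP => /rowP/(_ i1); rewrite !mxE => h.
  by have := d_gt0 i1; rewrite h ltxx.
rewrite eigenvalue_root_char; move: h; rewrite eigenvalue_root_char.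
congr (root _ _); rewrite /char_poly -det_tr; congr (\det _).
by apply/matrixP => i j; rewrite !mxE eq_sym.
Qed.

(** Pair the absolute values of an eigenvector with the positive column eigenvector [d]. *)
Lemma eigenvalue_le_character Y b : eigenvalue (M Y) b -> 0 <= b -> b <= d Y.
Proof.
move=> /eigenvalueP[x xM x0] b0.
have s_gt0 : 0 < \sum_i `|x 0 i| * d (irr i).
  have pos i : 0 <= `|x 0 i| * d (irr i) by rewrite mulr_ge0 // ltW.
  rewrite lt0r sumr_ge0 // andbT; apply: contra x0.
  rewrite psumr_eq0 // => /allP h; apply/eqP/rowP => i; rewrite mxE.
  have := h i (mem_index_enum i); rewrite mulf_eq0 normr_eq0 (gt_eqF (d_gt0 i)) orbF.
  by move/eqP.
rewrite -(ler_pM2r s_gt0) mulr_sumr [leRHS]mulr_sumr.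
apply: (@le_trans _ _ (\sum_i \sum_j `|x 0 j| * M Y j i * d (irr i))).
  apply: ler_sum => i _; rewrite mulrA -mulr_suml ler_wpM2r //; first exact: (ltW (d_gt0 i)).
  have /rowP/(_ i) := xM; rewrite !mxE => /(congr1 Num.norm).
  rewrite normrM (ger0_norm b0) => <-; apply: (le_trans (ler_norm_sum _ _ _)).
  by apply: ler_sum => j _; rewrite normrM [X in _ * X]ger0_norm // mxE ler0n.
rewrite exchange_big; apply: ler_sum => j _.
under eq_bigr => i _ do rewrite -mulrA.
by rewrite -mulr_sumr left_mul_mxE mulrCA.
Qed.

Lemma FPdim_character Y : FPdim Y = d Y.
Proof.
have [|e1 e2 e3] := @epsilon_spec _ (inhabits 0) (fun a =>
    [/\ eigenvalue (left_mul_mx Y) a, 0 <= a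
      & forall b, eigenvalue (left_mul_mx Y) b -> 0 <= b -> b <= a]).
  exists (d Y); split; [exact: eigenvalue_character | exact: character_ge0 |].
  exact: eigenvalue_le_character.
apply/le_anti; rewrite eigenvalue_le_character //=.
by apply: e3; [exact: eigenvalue_character | exact: character_ge0].
Qed.

Lemma character_Aint Y : d Y \in Aint.
Proof.
have := eigenvalue_character Y; rewrite eigenvalue_root_char => /root_monic_Aint.
apply; first exact: char_poly_monic.
have -> : M Y = map_mx intr (\matrix_(j, i) (gclass (Y ⊗ irr j) i)%:Z).
  by apply/matrixP => i j; rewrite !mxE.
rewrite -map_char_poly; apply/polyOverP => i; rewrite coef_map.
exact: intr_int.
Qed.

Definition weight (i : irr_index C) : algC := d (irr i) / (hdim (irr i) (irr i))%:R.

Lemma weight_gt0 i : 0 < weight i.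
Proof. by rewrite divr_gt0 // ltr0n; exact: (sdim_gt0 sepC hS). Qed.

Lemma character_hdim X : d X = \sum_i weight i * (hdim (irr i) X)%:R.
Proof. exact: (additive_hdim sepC hS). Qed.

(** The formal sum of the simple classes with coefficients [weight] plays the part of a regular
    object, an eigenvector for multiplication by [[Y^*]]. The adjunction moves [Y^*] to [Y] on the
    other side, where [d] is multiplicative. *)
Lemma weight_dual (f : C -> algC) (Y : C) : dsum_additive f ->
  \sum_i weight i * f (Y^* ⊗ irr i)%C = d Y * \sum_i weight i * f (irr i).
Proof.
move=> af; transitivity (\sum_j f (irr j) / (hdim (irr j) (irr j))%:R * d (Y ⊗ irr j)).
  under eq_bigr => i _ do rewrite (additive_hdim sepC hS _ af) mulr_sumr.
  rewrite exchange_big; apply: eq_bigr => j _; rewrite character_hdim mulr_sumr.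
  apply: eq_bigr => i _; rewrite (hdim_sym sepC hS) hdim_tensl.
  by rewrite mulrCA.
rewrite mulr_sumr; apply: eq_bigr => j _; rewrite dM /weight.
by move: (_%:R) => q; rewrite mulrCA; congr (_ * _); rewrite mulrC mulrA mulrAC.
Qed.

(** Taking [f = d] in [weight_dual], both values multiply the same positive sum. *)
Lemma character_dual (Y : C) : d Y^* = d Y.
Proof.
have := weight_dual Y ad; under eq_bigr => i _ do rewrite dM mulrCA.
rewrite -mulr_sumr => /mulIf; apply; rewrite gt_eqF //.
have [i1 _] := one_irr.
rewrite (bigD1 i1) //=; apply: ltr_wpDr.
  by apply: sumr_ge0 => i _; rewrite ltW // mulr_gt0 ?weight_gt0.
by rewrite mulr_gt0 ?weight_gt0.
Qed.

End Character.
End FusionCategory.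

(** * The Frobenius-Perron dimension of [X^* ⊗_(End X) X] *)

Section CasimirOfSimple.
Variables (K : fieldType) (C : linCat K).
Hypothesis sepC : fin_separable C.

Lemma simple_mono (A T : C) (f : Hom T A) : simple T -> f <> 0 ->
  exists h, h ∘ f = idm T.
Proof.
move=> sT f0.
have [h fhf] := separated_regular (fs_findim sepC) (fs_separated sepC) f.
exists h; have [||//] := simple_idem (fs_split sepC) sT (p := h ∘ f).
  by rewrite comp_assoc -(comp_assoc h) -(comp_assoc h) fhf.
by move=> hf; case: f0; rewrite -fhf -comp_assoc hf comp0r.
Qed.

(** Decompose [G] in the natural casimir element at [X]. Only summands isomorphic to [X] contribute,
    and identifying them with [X] puts both factors into [Hom X X]. *)
Lemma simple_casimir (X : C) : simple X -> exists s : seq (Hom X X * Hom X X), casimir s.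
Proof.
move=> sX; have [G [t [t1 tn]]] := separated_natural (fs_separated sepC).
have [J [F [sF [inj [pr [_ _ ip]]]]]] := decomposition sepC G.
(* Inverse isomorphisms if [F j] is isomorphic to [X], and zeros otherwise; in the latter case [a]
   vanishes, so the equation holds uniformly. *)
have uvP j : exists uv : Hom X (F j) * Hom (F j) X,
    forall a : Hom (F j) X, a ∘ uv.1 ∘ uv.2 = a.
  have [[u [v [_ uv]]]|nXF] := pselect (isomorphic X (F j)).
    by exists (u, v) => a; rewrite -comp_assoc uv comp_idr.
  exists (0, 0) => a; rewrite comp0r; apply/esym.
  by apply: (simple_hom0 sepC) => // /iso_sym.
have [uv uvE] := choice_dep uvP.
exists [seq (x.1 ∘ (inj j ∘ (uv j).1), (uv j).2 ∘ pr j ∘ x.2) | x <- t X, j <- enum J].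
split; first rewrite big_allpairs_dep -[RHS](t1 X).
  apply: eq_bigr => x _; rewrite big_enum /= -[in RHS](comp_idr x.1) -ip.
  rewrite comp_sumr comp_suml; apply: eq_bigr => j _.
  by rewrite !comp_assoc uvE.
move=> V b [bl br] z; rewrite !big_allpairs_dep exchange_big [RHS]exchange_big.
apply: eq_bigr => j _ /=.
transitivity (\sum_(x <- t X) b (z ∘ x.1 ∘ (inj j ∘ (uv j).1)) ((uv j).2 ∘ pr j ∘ x.2)).
  by apply: eq_bigr => x _; rewrite comp_assoc.
rewrite (tn _ _ z _ (fun u v => b (u ∘ (inj j ∘ (uv j).1)) ((uv j).2 ∘ pr j ∘ v))).
  by apply: eq_bigr => x _; congr (b _ _); exact: comp_assoc.
split=> [v | u]; first exact: (linear_comp (bl _) (comp_linl _)).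
exact: (linear_comp (br _) (comp_linr _)).
Qed.

End CasimirOfSimple.

(** The two objects carry the idempotents [fhom F (idm X)] and [idm (F X)], equal but not
    convertible; an isomorphism avoids transport. *)
Lemma kar_functor_full (K : fieldType) (C D : linCat K) (F : linFunctor C D) (X : C) :
  isomorphic (kar_functor F (kar_embed C X)) (kar_embed D (F X)).
Proof.
pose P := kar_functor F (kar_embed C X); pose Q : karoubi D := kar_embed D (F X).
exists (kar_cut (P := P) (Q := Q) (idm (F X))), (kar_cut (P := Q) (Q := P) (idm (F X))).
by split; apply: val_inj; rewrite /= !fhom_id !comp_idl.
Qed.

Section RelativeTensorSquare.
Variables (K : fieldType) (C : rigidCat K).
Hypothesis hC : fusion C.
Variable d : C -> algC.
Hypothesis hd : fp_character d.
Variable X : C.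
Hypothesis sX : simple X.
Variable s : seq (Hom X X * Hom X X).
Hypothesis hs : casimir s.

Let sepC := fusion_fin_separable hC.
Let hS := fusion_simples hC.
Let findimC := fs_findim sepC.
Let tl := fusion_linl hC.
Let tr := fusion_linr hC.
Let ad : dsum_additive d. Proof. by case: hd. Qed.
Let dM Y Z : d (Y ⊗ Z) = d Y * d Z. Proof. by case: hd => _ _ h _; exact: h. Qed.
Let d1 : d one = 1. Proof. by case: hd. Qed.

Lemma dualm_linear (V W : C) : linear (fun f : Hom V W => dualm f).
Proof.
move=> k f g; apply: ev_inj; rewrite ev_dualm !tl tr !compDr !compZr.
by rewrite !ev_dualm.
Qed.

Definition rel_idem : Hom (X^* ⊗ X) (X^* ⊗ X) := \sum_(a <- s) dualm a.1 ⊗m a.2.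

Lemma rel_idem_balanced x : rel_idem ∘ (dualm x ⊗m idm X) = rel_idem ∘ (idm X^* ⊗m x).
Proof.
rewrite /rel_idem !comp_suml.
transitivity (\sum_(a <- s) dualm (x ∘ a.1) ⊗m a.2).
  by apply: eq_bigr => a _; rewrite -tensm_comp dualm_comp comp_idr.
rewrite (hs.2 _ (fun u v => dualm u ⊗m v)).
  by apply: eq_bigr => a _; rewrite -tensm_comp comp_idr.
split=> [v | u]; last exact: tr.
exact: (linear_comp (tl v) (@dualm_linear _ _)).
Qed.

(** Together with [rel_idem_balanced] this identifies the image of [rel_idem] with the common
    coequaliser of the two actions of [End X], that is [X^* ⊗_(End X) X]. *)
Lemma balanced_rel_idem (Z : C) (j : Hom (X^* ⊗ X) Z) :
  (forall f : Hom X X, j ∘ (dualm f ⊗m idm X) = j ∘ (idm X^* ⊗m f)) ->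
  j ∘ rel_idem = j.
Proof.
move=> jb; rewrite /rel_idem comp_sumr.
transitivity (\sum_(a <- s) (j ∘ (idm X^* ⊗m (a.1 ∘ a.2)))%C).
  apply: eq_bigr => a _.
  by rewrite tens_lr comp_assoc jb -comp_assoc -tensr_comp.
by rewrite -comp_sumr -(lin_sum (tr _)) hs.1 tensm_id comp_idr.
Qed.

Lemma rel_idemK : rel_idem ∘ rel_idem = rel_idem.
Proof. exact: balanced_rel_idem rel_idem_balanced. Qed.

Lemma ev_rel_idem : ev X ∘ rel_idem = ev X.
Proof. by apply: balanced_rel_idem => f; exact: ev_dualm. Qed.

Local Notation H := (span_cat tl X).
Local Notation S := (karoubi (span_cat tl X)).
Local Notation st := (@span_tens K C X).

Let sepS : fin_separable S.
Proof.
apply: karoubi_fin_separable; first exact: (span_findim findimC).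
exact: (span_separated tl tr hs (fs_separated sepC)).
Qed.

(** [Fr] is the free module functor, [L Y] tensors a module by [Y] on the left, and [Im] is
    [N ⊗_(End X) X]. *)
Let Fr : linFunctor C S := functor_comp (kar_embed H) (span_free tl X).
Let L (Y : C) : linFunctor S S := kar_functor (span_tensl tl tr X Y).
Let Im : linFunctor S C :=
  functor_comp (image_functor (fs_split sepC)) (kar_functor (span_forget tl X)).

Let L_adj Y (M N : S) : hdim (L Y^* M) N = hdim M (L Y N).
Proof. exact: (adjunction_hdim M N (kar_adjunction (span_adjunction tl tr X (ev_coev Y)))). Qed.

Let L_free Y Z : isomorphic (L Y (Fr Z)) (Fr (Y ⊗ Z)).
Proof. exact: (kar_functor_full (span_tensl tl tr X Y) (Z : H)). Qed.

(* [phi N] is the dimension of the object of [C] underlying the [End X]-module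
   [N], and [psi N] that of [N ⊗_(End X) X]. *)
Let phi (N : S) : algC := \sum_i weight d i * (hdim (Fr (irr i)) N)%:R.
Let psi (N : S) : algC := d (Im N).

Let phi_additive : dsum_additive phi.
Proof.
apply: additive_sum => i; apply: additive_scale.
exact: additive_hdimr.
Qed.

Let psi_additive : dsum_additive psi.
Proof. by move=> J F N /(functor_direct_sum Im)/ad. Qed.

(** Morphisms [Fr Z -> N] stand for morphisms from [Z] to the underlying object of [N], and [L_adj]
    moves [Y] to the side of [Z], where [weight_dual] applies. *)
Let phi_L Y N : phi (L Y N) = d Y * phi N.
Proof.
pose chi Z : algC := (hdim (Fr Z) N)%:R.
have achi : dsum_additive chi.
  move=> J F Z /(functor_direct_sum Fr) dZ.
  by rewrite /chi (hdim_suml _ (fs_findim sepS) dZ) natr_sum.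
rewrite /phi -[RHS](weight_dual hC hd Y achi); apply: eq_bigr => i _; congr (_ * _).
rewrite -L_adj /chi; congr (_%:R); apply: (hdim_iso sepS); last exact: iso_refl.
exact: L_free.
Qed.

Let psi_L Y N : psi (L Y N) = d Y * psi N.
Proof.
rewrite /psi -dM; apply: (additive_iso ad).
pose M := kar_functor (span_forget tl X) N.
have [qi iq] := image_split (fs_split sepC) M.
apply: (image_iso (fs_split sepC) (P := kar_functor (span_forget tl X) (L Y N))
  (i := assocV Y (kar_base N) X ∘ (idm Y ⊗m image_in (fs_split sepC) M))
  (q := (idm Y ⊗m image_out (fs_split sepC) M) ∘ assoc Y (kar_base N) X)).
split.
  rewrite comp_assoc -(comp_assoc _ (assoc _ _ _)) assocVK comp_idr.
  by rewrite -tensr_comp qi tensm_id.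
by rewrite comp_assoc -(comp_assoc (assocV _ _ _)) -tensr_comp iq.
Qed.

Let D : S := Fr one.

Let tau (x : Hom X X) : Hom D D := fhom (kar_embed H) (st (idm one) x : Hom (one : H) one).

Let tau_linear : linear tau.
Proof. by move=> k x y; apply: val_inj; apply: val_inj; exact: tr. Qed.

Let tau_comp x y : tau (x ∘ y) = tau x ∘ tau y.
Proof. by apply: val_inj; apply: val_inj; rewrite /= tensr_comp. Qed.

Let tau1 : tau (idm X) = idm D.
Proof. by rewrite /tau -(fhom_id Fr). Qed.

Let tau_inj : injective tau.
Proof.
move=> x y /(congr1 (fun f : Hom D D => lunit X ∘ span_fun (kar_fun f))) /=.
by rewrite !lunit_nat; apply: (iso_epi (lunitVK X)).
Qed.

(** Scalars from the unit cross the tensor sign: [e ⊗ x] equals [id ⊗ (left_embedding X e ∘ x)]. *)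
Let tau_surj (f : Hom D D) : exists x, tau x = f.
Proof.
have [r rE] := span_hom_sum tl (kar_fun f).
exists (\sum_(y <- r) left_embedding X y.1 ∘ y.2).
rewrite (lin_sum tau_linear); apply: val_inj; rewrite /= rE (lin_sum (@kar_fun_linear _ _ _ _)).
apply: eq_bigr => y _; apply: val_inj; rewrite /= tensr_comp.
rewrite [RHS]tens_lr; congr (_ ∘ _); rewrite /left_embedding.
by apply: (iso_mono (lunitK X)); rewrite lunit_nat (cancelr _ (lunitK X)).
Qed.

(** Idempotents of [D] come from idempotents of the simple object [X] through [tau]. Simplicity lets
    [D] play the part that the unit had for [C]. *)
Let D_simple : simple D.
Proof.
apply: idem_simple.
- exact: (separated_regular (fs_findim sepS) (fs_separated sepS)).
- rewrite /is_zero -tau1 -(lin_0 tau_linear) => /tau_inj; exact: sX.1.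
- move=> p; have [x <-] := tau_surj p; rewrite -tau_comp => /tau_inj.
  move=> /(simple_idem (fs_split sepC) sX)[->|->]; [left|right].
    exact: lin_0 tau_linear.
  exact: tau1.
Qed.

Let hdim_DD : hdim D D = hdim X X.
Proof. by apply/esym; exact: (vdim_bijective tau_linear tau_inj tau_surj). Qed.

(** Only the simple object isomorphic to the unit maps nontrivially to it, and its weight is the
    inverse of the dimension of [End 1]. *)
Let phi_D : phi D = (hdim X X)%:R / (hdim (one : C) one)%:R.
Proof.
have [i1 one_i1] := one_irr hC.
rewrite /phi (bigD1 i1) //= [X in _ + X]big1 ?addr0 => [|i ii1].
  rewrite (hdim_iso sepS (X' := D) (Y' := D)); last first.
  - exact: iso_refl.
  - by apply: (functor_iso Fr); exact: iso_sym.
  rewrite hdim_DD /weight -(additive_iso ad one_i1) d1 mul1r mulrC; congr (_ / _%:R).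
  by apply: (hdim_iso sepC); exact: iso_sym.
suff -> : hdim (Fr (irr i)) D = 0%N by rewrite mulr0.
apply/(vdim_eq0 (fs_findim sepS _ _)) => f; apply: val_inj => /=.
have [r ->] := span_hom_sum tl (kar_fun f).
apply: big1 => y _; have -> : y.1 = 0.
  apply: (simple_hom0 sepC); [exact: irr_simple hC _ | exact: fusion_one hC |] => h.
  have [_ inj _] := hS; case/eqP: ii1; apply: inj.
  exact: iso_trans h one_i1.
by apply: val_inj; exact: (lin_0 (tl _)).
Qed.

Let psi_D : psi D = d X.
Proof.
apply: (additive_iso ad).
apply: (image_iso (fs_split sepC) (P := kar_functor (span_forget tl X) D) (i := lunitV X) (q := lunit X)).
split; first exact: lunitVK.
exact: lunitK.
Qed.

Let irr_in_dual (i : irr_index C) : exists (k : irr_index C) (f : Hom (irr i) (irr k)^*), f <> 0.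
Proof.
have [k [f f0]] := irr_hub hC i; exists k.
apply: contrapT => nf; have := hdim_gt0 sepC f0.
rewrite hdim_tensr //.
have -> : hdim (irr i) (one ⊗ (irr k)^*) = hdim (irr i) (irr k)^*.
  apply: (hdim_iso sepC); first exact: iso_refl.
  by exists (lunit _), (lunitV _); exact: lunit_inv.
suff -> : hdim (irr i) (irr k)^* = 0%N by [].
apply/(vdim_eq0 (findimC _ _)) => g.
by apply: contrapT => g0; apply: nf; exists g.
Qed.

(** [N] is a retract of the free module on its base, which splits into free modules on simple
    objects. *)
Let free_cover (N : S) : ~ is_zero N -> exists i (f : Hom (Fr (irr i)) N), f <> 0.
Proof.
move=> nz.
pose e : Hom (Fr (kar_base N)) N :=
  kar_cut (P := Fr (kar_base N)) (Q := N) (idm (kar_base N)).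
have e0 : e <> 0.
  move=> /(congr1 (fun f : Hom (Fr (kar_base N)) N => kar_fun f)) h; apply: nz; apply: val_inj; move: h.
  change (kar_idem N ∘ idm (kar_base N) ∘ idm (kar_base N) = 0 -> kar_idem N = 0).
  by rewrite !comp_idr.
have [inj [pr [_ _ ip]]] := functor_direct_sum Fr (multP sepC hS (kar_base N)).
have [t ht] := sum_neq0 N ip e0.
by exists (tag t), (e ∘ inj t).
Qed.

(** This is the irreducibility of the module category. A simple object occurs in some [(irr k)^*],
    and the adjunction turns a map from the free module on [(irr k)^*] to [N] into a map from
    [D]. *)
Let hub (N : S) : ~ is_zero N -> exists k (f : Hom D (L (irr k) N)), f <> 0.
Proof.
move=> /free_cover[i [f f0]]; have [k [g g0]] := irr_in_dual i; exists k.
have [h hg] := simple_mono sepC (irr_simple hC i) g0.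
have fh0 : f ∘ fhom Fr h <> 0.
  move=> e; apply: f0; rewrite -[f]comp_idr -(fhom_id Fr) -hg fhom_comp comp_assoc e.
  exact: comp0l.
apply: contrapT => nf; have := hdim_gt0 sepS fh0.
suff -> : hdim (Fr (irr k)^*) N = 0%N by [].
have <- : hdim D (L (irr k) N) = hdim (Fr (irr k)^*) N.
  rewrite -L_adj; apply: (hdim_iso sepS); last exact: iso_refl.
  apply: iso_trans (L_free _ _) _; apply: (functor_iso Fr).
  by exists (runit _), (runitV _); exact: runit_inv.
apply/(vdim_eq0 (fs_findim sepS _ _)) => e.
by apply: contrapT => e0; apply: nf; exists e.
Qed.

Let phi_psi (M N : S) : psi M * phi N = psi N * phi M.
Proof.
have [T hT] := simples_exist sepS.
(* Since [L Y] multiplies both functions by [d Y], they share the eigenvalue [lam]. *)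
apply: (perron_functional_unique sepS hT (F := fun k : irr_index C => L (irr k))
  (F' := fun k => L (irr k)^*) _ _
  (lam := \sum_(k : irr_index C) \sum_(l : irr_index C) d ((irr k)^*)%C * d (irr l))
  (f1 := phi) (f2 := psi))
  => //.
- move=> a b; have nz c : ~ is_zero (@fam _ _ T c) by case: hT => sT _ _; exact: (sT c).1.
  have [k [g g0]] := hub (nz b); have [l [f f0]] := hub (nz a).
  have [f' f'0] := hom_neq0_sym sepS hT f0.
  by exists k, l, (g ∘ f'); exact: (through_simple_neq0 sepS D_simple).
- move=> c; have [|i [f f0]] := @free_cover (@fam _ _ T c).
    by case: hT => sT _ _; exact: (sT c).1.
  rewrite /phi (bigD1 i) //=; apply: ltr_wpDr.
    by apply: sumr_ge0 => j _; rewrite mulr_ge0 ?ler0n // ltW // (weight_gt0 hC hd).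
  by rewrite mulr_gt0 ?(weight_gt0 hC hd) // ltr0n (hdim_gt0 sepS f0).
- by move=> c; apply: ger0_real; exact: (character_ge0 hC hd).
- move=> A; rewrite mulr_suml; apply: eq_bigr => k _; rewrite mulr_suml.
  by apply: eq_bigr => l _; rewrite !phi_L mulrA.
- move=> A; rewrite mulr_suml; apply: eq_bigr => k _; rewrite mulr_suml.
  by apply: eq_bigr => l _; rewrite !psi_L mulrA.
Qed.

Let stH (Y Z : C) (f : Hom Y Z) (x : Hom X X) : Hom (Y : H) Z := st f x.

Let rel_span : Hom (X^* : H) X^* := \sum_(a <- s) stH (dualm a.1) a.2.

Let rel_spanE : span_fun rel_span = rel_idem.
Proof. by rewrite /rel_span (lin_sum (@span_fun_linear _ _ tl X _ _)). Qed.

Let rel_spanK : rel_span ∘ rel_span = rel_span.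
Proof. by apply: val_inj; rewrite /= rel_spanE rel_idemK. Qed.

(** The [End X]-module [X^*], as a direct summand of the free module on [X^*]. *)
Let P : S := KarOb rel_spanK.

(** Maps from the free module on [Z] to [P] correspond to maps [Z -> X^*]. Injectivity holds because
    [ev] factors through [rel_idem]; surjectivity because balancing moves the factor [x] of [f ⊗ x]
    to [X^*]. *)
Let phi_P : phi P = d X.
Proof.
rewrite -(character_dual hC hd) (character_hdim hC hd); apply: eq_bigr => i _.
congr (_ * _%:R).
pose F (f : Hom (irr i) X^*) : Hom (Fr (irr i)) P :=
  kar_cut (P := Fr (irr i)) (Q := P) (st f (idm X)).
have FE f : span_fun (kar_fun (F f)) = rel_idem ∘ (f ⊗m idm X).
  by rewrite /= comp_idr rel_spanE.
apply/esym; apply: (vdim_bijective (f := F)).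
- move=> k f g; apply: val_inj; apply: val_inj.
  change (span_fun (kar_fun (F (k *: f + g))) =
    k *: span_fun (kar_fun (F f)) + span_fun (kar_fun (F g))).
  by rewrite !FE tl compDr compZr.
- move=> f g fg; apply: ev_inj.
  rewrite -ev_rel_idem -!comp_assoc -!FE fg //.
- move=> k; have [r rE] := span_hom_sum tl (kar_fun k).
  exists (\sum_(y <- r) dualm y.2 ∘ y.1); apply: val_inj; apply: val_inj.
  change (span_fun (kar_fun (F (\sum_(y <- r) (dualm y.2 ∘ y.1)%C))) = span_fun (kar_fun k)).
  rewrite FE -[in RHS](kar_homl k) rE /= rel_spanE.
  rewrite (lin_sum (@span_fun_linear _ _ tl X _ _)) (lin_sum (tl _)) !comp_sumr.
  apply: eq_bigr => y _; rewrite tensl_comp comp_assoc rel_idem_balanced.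
  by rewrite -comp_assoc -tens_rl.
Qed.

Lemma character_image (Y : C) (i : Hom Y (X^* ⊗ X)) (q : Hom (X^* ⊗ X) Y) :
  split_by rel_idem i q ->
  d Y = d X ^+ 2 / ((hdim X X)%:R / (hdim (one : C) one)%:R).
Proof.
move=> sp; have psi_P : psi P = d Y.
  apply: (additive_iso ad); apply: (image_iso (fs_split sepC) (P := kar_functor (span_forget tl X) P) (i := i) (q := q)).
  by rewrite /= rel_spanE.
have := phi_psi P D; rewrite psi_P psi_D phi_P phi_D -expr2 => <-.
rewrite mulfK // mulf_neq0 ?invr_neq0 // pnatr_eq0 -lt0n.
  by apply: (hdim_gt0 sepC (f := idm X)); exact: sX.1.
by apply: (hdim_gt0 sepC (f := idm one)); exact: (fusion_one hC).1.
Qed.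

End RelativeTensorSquare.

(** * The canonical coend *)

Section LeftEmbedding.
Variables (K : fieldType) (C : rigidCat K).
Hypothesis hC : fusion C.
Variable X : C.

Let sepC := fusion_fin_separable hC.
Let findimC := fs_findim sepC.
Local Notation E := (Hom (one : C) one).
Local Notation lam := (left_embedding X).

Lemma left_embedding_linear : linear lam.
Proof.
by move=> k e f; rewrite /left_embedding (fusion_linl hC) compDr compZr compDl compZl.
Qed.

Lemma left_embeddingM (e f : E) : lam (e ∘ f) = lam e ∘ lam f.
Proof.
by rewrite /left_embedding tensl_comp !comp_assoc (cancelr _ (lunitK X)).
Qed.

Lemma left_embedding1 : lam (idm one) = idm X.
Proof. by rewrite /left_embedding tensm_id comp_idr lunitVK. Qed.

Definition E_basis n (b : 'I_n -> Hom X X) : Prop := forall f : Hom X X,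
  exists! c : {ffun 'I_n -> E}, f = \sum_k lam (c k) ∘ b k.

(** The tower law for [K], [End 1] and [End X]. *)
Lemma E_basis_hdim n (b : 'I_n -> Hom X X) : E_basis b ->
  hdim X X = (n * hdim (one : C) one)%N.
Proof.
move=> hb; apply: has_dim_vdim.
have [e [se ie]] := ordinal_basis (vdimP (findimC (one : C) one)).
exists ('I_n * 'I_(hdim (one : C) one))%type, (fun p => lam (e p.2) ∘ b p.1).
split; first by rewrite card_prod !card_ord.
have sumE (a : 'I_n * 'I_(hdim (one : C) one) -> K) :
    \sum_p a p *: (lam (e p.2) ∘ b p.1) =
    \sum_k lam (\sum_j a (k, j) *: e j) ∘ b k.
  rewrite (eq_bigr (fun p => a (p.1, p.2) *: (lam (e p.2) ∘ b p.1))); last by case.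
  rewrite -(pair_bigA _ (fun k j => a (k, j) *: (lam (e j) ∘ b k))) /=.
  apply: eq_bigr => k _; rewrite (lin_sum left_embedding_linear) comp_suml.
  by apply: eq_bigr => j _; rewrite (lin_Z left_embedding_linear) compZl.
split=> [f | a].
  have [c [-> _]] := hb f; have [a aE] := choice (fun k => se (c k)).
  exists (fun p => a p.1 p.2); rewrite sumE; apply: eq_bigr => k _.
  by rewrite [in LHS]aE.
rewrite sumE => h [k j].
have [c [_ c_uniq]] := hb 0.
have c1 : c = [ffun k => \sum_j a (k, j) *: e j].
  by apply: c_uniq; rewrite -[LHS]h; apply: eq_bigr => l _; rewrite ffunE.
have c2 : c = [ffun=> 0].
  apply: c_uniq; rewrite big1 // => l _.
  by rewrite ffunE (lin_0 left_embedding_linear) comp0l.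
apply: (ie (fun j => a (k, j))).
by have := congr1 (fun g : {ffun 'I_n -> E} => g k) (etrans (esym c1) c2); rewrite !ffunE.
Qed.

(** A family of maximal length independent over [End 1] spans, since nonzero endomorphisms of the
    unit are invertible by Schur's lemma. Its length is bounded because it is independent over
    [K]. *)
Lemma E_basis_exists : exists n (b : 'I_n -> Hom X X), E_basis b.
Proof.
pose P m := `[< exists b : 'I_m -> Hom X X, forall c : 'I_m -> E,
  \sum_k lam (c k) ∘ b k = 0 -> forall k, c k = 0 >].
have P0 : exists m, P m by exists 0; apply/asboolP; exists (fun=> 0) => c _ [].
have one0 : idm (one : C) <> 0 by exact: (fusion_one hC).1.
have Pn m : P m -> (m <= hdim X X)%N.
  move=> /asboolP[b ib].
  have lin : linear (fun u : 'rV[K]_m => \sum_k u 0 k *: b k).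
    move=> a u v; rewrite scaler_sumr -big_split; apply: eq_bigr => i _.
    by rewrite !mxE scalerDl scalerA.
  apply: (injective_dim lin) (vdimP (findimC X X)).
    move=> u v /eqP; rewrite -subr_eq0 -(lin_B lin) => /eqP h.
    apply/eqP; rewrite -subr_eq0; apply/eqP/rowP => k.
    rewrite [RHS]mxE.
    have h1 : (u - v) 0 k *: idm one = 0 :> E.
      apply: (ib (fun k => (u - v) 0 k *: idm one)).
      rewrite -[RHS]h; apply: eq_bigr => l _.
      by rewrite (lin_Z left_embedding_linear) left_embedding1 compZl comp_idl.
    apply/eqP; apply: contraT => n0; case: one0.
    by rewrite -[LHS]scale1r -(mulVf n0) -scalerA h1 scaler0.
  by apply: (@has_dim_rV _ _ _ id id).
case: (ex_maxnP P0 Pn) => n /asboolP[b ib] maxn; exists n, b => f.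
have [c cE] : exists c : {ffun 'I_n -> E}, f = \sum_k lam (c k) ∘ b k.
  apply: contrapT => nf; suff : P n.+1 by move/maxn; rewrite ltnn.
  apply/asboolP; exists (fun i => oapp b f (unlift ord0 i)) => c.
  rewrite big_ord_recl unlift_none /=; under eq_bigr => i _ do rewrite liftK /=.
  move=> h; have c0 : c ord0 = 0.
    apply: contrapT => c0.
    have [g [gc _]] := simple_iso sepC (fusion_one hC) (fusion_one hC) c0.
    apply: nf; exists [ffun k => - (g ∘ c (lift ord0 k))].
    rewrite -[LHS]comp_idl -left_embedding1 -gc left_embeddingM -comp_assoc.
    rewrite -[lam (c ord0) ∘ f]opprK (addr0_eq h) -sumrN comp_sumr.
    apply: eq_bigr => k _; rewrite ffunE (lin_N left_embedding_linear) left_embeddingM.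
    by rewrite (lin_N (comp_linl _)) (lin_N (comp_linr _)) comp_assoc.
  move: h; rewrite c0 (lin_0 left_embedding_linear) comp0l add0r => /ib h i.
  by case: (unliftP ord0 i) => [j|] ->.
exists c; split=> // c' c'E; apply/ffunP => k; apply/eqP; rewrite -subr_eq0; apply/eqP.
apply: (ib (fun k => c k - c' k)).
under eq_bigr => l _ do rewrite (lin_B left_embedding_linear) compBl.
by rewrite sumrB -cE -c'E subrr.
Qed.

Lemma dimE_EndE : (dimE_End X)%:R = (hdim X X)%:R / (hdim (one : C) one)%:R :> algC.
Proof.
have h1 : (hdim (one : C) one)%:R != 0 :> algC.
  rewrite pnatr_eq0 -lt0n; apply: (hdim_gt0 sepC (f := idm _)).
  exact: (fusion_one hC).1.
have [b /E_basis_hdim ->] : exists b : 'I_(dimE_End X) -> Hom X X, E_basis b.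
  exact: (epsilon_spec _ _ E_basis_exists).
by rewrite natrM mulfK.
Qed.

End LeftEmbedding.

(** * Decomposition of the coend over the simple objects *)

Section CoendDecomposition.
Variables (K : fieldType) (C : rigidCat K).
Hypothesis hC : fusion C.

Let sepC := fusion_fin_separable hC.
Let hS := fusion_simples hC.
Let tl := fusion_linl hC.
Let tr := fusion_linr hC.

Variable s : forall i : irr_index C, seq (Hom (irr i) (irr i) * Hom (irr i) (irr i)).
Hypothesis hs : forall i, casimir (s i).
Variable Q : irr_index C -> C.
Variable iQ : forall i, Hom (Q i) ((irr i)^* ⊗ irr i).
Variable qQ : forall i, Hom ((irr i)^* ⊗ irr i) (Q i).
Hypothesis spQ : forall i, split_by (rel_idem (s i)) (iQ i) (qQ i).

Let irr_hom0 (i j : irr_index C) (f : Hom (irr i) (irr j)) : i != j -> f = 0.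
Proof.
move=> ij; apply: (simple_hom0 sepC); try exact: (irr_simple hC).
by move=> h; case: hS => _ inj _; case/eqP: ij; exact: inj.
Qed.

Let qQ_balanced i (f : Hom (irr i) (irr i)) :
  qQ i ∘ (dualm f ⊗m idm _) = qQ i ∘ (idm _ ⊗m f).
Proof.
have -> : qQ i = qQ i ∘ rel_idem (s i).
  by rewrite -(spQ i).2 comp_assoc (spQ i).1 comp_idl.
by rewrite -!comp_assoc (rel_idem_balanced hC (hs i)).
Qed.

Section Isotypic.
Variables (V : C) (n : irr_index C -> nat).
Variable inj : forall i, 'I_(n i) -> Hom (irr i) V.
Variable pr : forall i, 'I_(n i) -> Hom V (irr i).
Hypothesis ip : \sum_i \sum_(t < n i) @inj i t ∘ @pr i t = idm V.

Lemma isotypic_l i (a : Hom (irr i) V) : a = \sum_(t < n i) @inj i t ∘ (@pr i t ∘ a).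
Proof.
rewrite -[LHS]comp_idl -ip comp_suml (bigD1 i) //= comp_suml [X in _ + X]big1 ?addr0.
  by apply: eq_bigr => t _; rewrite comp_assoc.
move=> j ji; rewrite comp_suml big1 // => t _.
by rewrite -comp_assoc (irr_hom0 (@pr j t ∘ a)) ?comp0r // eq_sym.
Qed.

Lemma isotypic_r i (a : Hom V (irr i)) : a = \sum_(t < n i) a ∘ @inj i t ∘ @pr i t.
Proof.
rewrite -[LHS]comp_idr -ip comp_sumr (bigD1 i) //= comp_sumr [X in _ + X]big1 ?addr0.
  by apply: eq_bigr => t _; rewrite comp_assoc.
move=> j ji; rewrite comp_sumr big1 // => t _.
by rewrite comp_assoc (irr_hom0 (a ∘ @inj j t)) ?comp0l.
Qed.

End Isotypic.

(** The decompositions are chosen for all objects at once, because a cowedge is a family over all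
    objects. *)
Lemma isotypic_exists : exists (n : C -> irr_index C -> nat)
  (inj : forall V i, 'I_(n V i) -> Hom (irr i) V)
  (pr : forall V i, 'I_(n V i) -> Hom V (irr i)),
  forall V, \sum_i \sum_(t < n V i) inj V i t ∘ pr V i t = idm V.
Proof.
exists (fun V i => mult (simples C) V i).
have [inj injP] := choice_dep (fun V => multP sepC hS V).
have [pr prP] := choice_dep injP.
exists (fun V i t => inj V (Tagged (fun i => 'I_(mult (simples C) V i)) t)).
exists (fun V i t => pr V (Tagged (fun i => 'I_(mult (simples C) V i)) t)).
move=> V; have [_ _ <-] := prP V; rewrite sig_big_dep /=.
by apply: eq_bigr => -[].
Qed.

(** [J i] projects [V] to its [i]-th isotypic part and then to the quotient [Q i]. Being a cowedge,
    it factors through [R] and yields the projections of the direct sum; the injections are the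
    structure maps of [R] restricted to [Q i]. *)
Lemma coend_direct_sum (R : C) : canonical_coend R -> is_direct_sum Q R.
Proof.
move=> [r [cr ur]]; have [n [inj [pr ip]]] := isotypic_exists.
pose J i (V : C) : Hom (V^* ⊗ V) (Q i) :=
  \sum_(t < n V i) (qQ i ∘ (dualm (inj V i t) ⊗m pr V i t))%C.
have J_cowedge i : cowedge (J i).
  move=> V W f; rewrite /J comp_suml.
  (* The block of [f] on [i]-th isotypic parts: its entries are endomorphisms of [irr i], which
     [qQ_balanced] moves across the tensor sign. *)
  pose m t u : Hom (irr i) (irr i) := pr W i u ∘ (f ∘ inj V i t).
  transitivity (\sum_(t < n V i) \sum_(u < n W i)
     (qQ i ∘ (dualm (inj W i u) ⊗m (m t u ∘ pr V i t)))%C).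
    apply: eq_bigr => t _; rewrite -comp_assoc -tensm_comp comp_idr -dualm_comp.
    rewrite [f ∘ _](isotypic_l (ip W)) (lin_sum (dualm_linear hC (W := _))).
    rewrite (lin_sum (tl _)) comp_sumr; apply: eq_bigr => u _.
    rewrite dualm_comp -[in LHS](comp_idl (pr V i t)) tensm_comp comp_assoc.
    rewrite qQ_balanced -comp_assoc -tensm_comp comp_idl //.
  rewrite exchange_big comp_suml; apply: eq_bigr => u _.
  rewrite -comp_assoc -tensm_comp comp_idr -comp_sumr -(lin_sum (tr _)).
  congr (_ ∘ (_ ⊗m _)).
  rewrite [RHS](isotypic_r (ip V)); apply: eq_bigr => t _.
  by rewrite /m !comp_assoc.
have J_irr i : J i (irr i) = qQ i.
  transitivity (qQ i ∘ (idm _ ⊗m \sum_(t < n (irr i) i)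
      (inj (irr i) i t ∘ (pr (irr i) i t ∘ idm (irr i)))%C)).
    rewrite (lin_sum (tr _)) comp_sumr; apply: eq_bigr => t _.
    by rewrite tens_lr comp_assoc qQ_balanced -comp_assoc -tensr_comp comp_idr.
  by rewrite -isotypic_l // tensm_id comp_idr.
have J_irr0 i j : i != j -> J i (irr j) = 0.
  move=> ij; apply: big1 => t _; rewrite (irr_hom0 (inj (irr j) i t) ij).
  by rewrite (lin_0 (dualm_linear hC (W := _))) (lin_0 (tl _)) comp0r.
have r_rel i : r (irr i) ∘ rel_idem (s i) = r (irr i).
  by apply: (balanced_rel_idem hC (hs i)) => f; exact: cr.
have [pj pjE] := choice_dep (fun i => ur (Q i) (J i) (J_cowedge i)).
exists (fun i => r (irr i) ∘ iQ i), pj; split.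
- by move=> i; rewrite comp_assoc (pjE i).1 J_irr (spQ i).1.
- by move=> i j ij; rewrite comp_assoc (pjE i).1 J_irr0 // comp0l.
(* The identity of [R] and the sum of the projectors both restrict to [r V] on every [V], so
   uniqueness identifies them. *)
have [h [_ h_uniq]] := ur R r cr.
transitivity h; last by apply: h_uniq => V; rewrite comp_idl.
apply/esym/h_uniq => V; rewrite comp_suml.
transitivity (\sum_i \sum_(t < n V i)
    (r V ∘ (idm _ ⊗m (inj V i t ∘ pr V i t)))%C).
  apply: eq_bigr => i _; rewrite -comp_assoc (pjE i).1 /J comp_sumr.
  apply: eq_bigr => t _; rewrite comp_assoc -(comp_assoc _ (iQ i)) (spQ i).2 r_rel.
  by rewrite tens_lr comp_assoc cr -comp_assoc -tensr_comp.
under eq_bigr => i _ do rewrite -comp_sumr -(lin_sum (tr _)).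
by rewrite -comp_sumr -(lin_sum (tr _)) ip tensm_id comp_idr.
Qed.

End CoendDecomposition.

Theorem theorem3p38 (K : fieldType) (C : rigidCat K) (hC : fusion C) :
  (forall R : C, canonical_coend R -> FPdim_cat C = FPdim R) /\
  FPdim_cat C \in Aint.
Proof.
have [d hd] := fp_character_exists hC.
have [ad _ _ _] := hd.
have sepC := fusion_fin_separable hC.
have [s hs] := choice_dep (fun i => simple_casimir sepC (irr_simple hC i)).
have [Q QP] := choice_dep (fun i => fs_split sepC (rel_idemK hC (hs i))).
have [iQ iQP] := choice_dep QP; have [qQ spQ] := choice_dep iQP.
have E : FPdim_cat C = \sum_i d (Q i).
  apply: eq_bigr => i _; rewrite (FPdim_character hC hd) (dimE_EndE hC).
  by rewrite (character_image hC hd (irr_simple hC i) (hs i) (spQ i)).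
split=> [R hR|]; last first.
  (* The identity [E] mentions no coend, and each [d (Q i)] is an eigenvalue of an integer
     matrix. *)
  by rewrite E rpred_sum // => i _; exact: (character_Aint hC hd).
rewrite E (FPdim_character hC hd).
exact: (esym (ad _ _ _ (coend_direct_sum hC hs spQ hR))).
Qed.
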